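(* Let $f=(f_1,\dots,f_n)$ be an $n$-tuple of formal power series in the class $\mathcal M^{||}$ and let $(M_{Z_1},\dots,M_{Z_n})$ be the universal model associated with $\mathbb B_f$. If $\pi:C^*(M_{Z_1},\dots,M_{Z_n})\to B(\mathcal K)$ is a nondegenerate $*$-representation of $C^*(M_{Z_1},\dots,M_{Z_n})$ on a separable Hilbert space $\mathcal K$, then $\pi$ decomposes into a direct sum $$\pi=\pi_0\oplus\pi_1\quad\text{on}\quad\mathcal K=\mathcal K_0\oplus\mathcal K_1,$$ where $\pi_0,\pi_1$ are disjoint representations of $C^*(M_{Z_1},\dots,M_{Z_n})$ on the Hilbert spaces $$\mathcal K_0:=\overline{\mathrm{span}}\Big\{\pi\big((M_Z)_\alpha\big)\Big(I-\sum_{i=1}^nf_i(\pi(M_{Z_1}),\dots,\pi(M_{Z_n}))f_i(\pi(M_{Z_1}),\dots,\pi(M_{Z_n}))^*\Big)\mathcal K:\ \alpha\in\mathbb F_n^+\Big\}$$ and $\mathcal K_1:=\mathcal K_0^\perp$, respectively, such that, up to an isomorphism, $$\mathcal K_0\simeq\mathbb H^2(f)\otimes\mathcal G,\qquad\pi_0(X)=X\otimes I_{\mathcal G},\quad X\in C^*(M_{Z_1},\dots,M_{Z_n}),$$ for some Hilbert space $\mathcal G$ with $$\dim\mathcal G=\dim\Big[\mathrm{range}\Big(I-\sum_{i=1}^nf_i(\pi(M_{Z_1}),\dots,\pi(M_{Z_n}))f_i(\pi(M_{Z_1}),\dots,\pi(M_{Z_n}))^*\Big)\Big],$$ and $\pi_1$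 is a $*$-representation which annihilates the compact operators and satisfies $$\sum_{i=1}^nf_i(\pi_1(M_{Z_1}),\dots,\pi_1(M_{Z_n}))f_i(\pi_1(M_{Z_1}),\dots,\pi_1(M_{Z_n}))^*=I_{\mathcal K_1}.$$ Moreover, if $\pi'$ is another nondegenerate $*$-representation of $C^*(M_{Z_1},\dots,M_{Z_n})$ on a separable Hilbert space $\mathcal K'$, with corresponding decomposition data $\pi_0',\pi_1',\mathcal G'$, then $\pi$ is unitarily equivalent to $\pi'$ if and only if $\dim\mathcal G=\dim\mathcal G'$ and $\pi_1$ is unitarily equivalent to $\pi_1'$.
   Context: Words and series. $\mathbb F_n^+$ is the free semigroup of words in the letters $1,\dots,n$, with empty word $\varnothing$; $|\alpha|$ is the length of $\alpha$. For an $n$-tuple $Y=(Y_1,\dots,Y_n)$ of elements of a unital algebra, $Y_\alpha:=Y_{i_1}\cdots Y_{i_k}$ if $\alpha=i_1\cdots i_k$, and $Y_\varnothing:=1$. Power series are formal power series $\psi=\sum_\alpha a_\alpha Z_\alpha$ with complex coefficients in noncommuting indeterminates $Z_1,\dots,Z_n$. For $Y\in B(\mathcal H)^n$ put $\psi(Y):=\sum_{k\ge0}\sum_{|\alpha|=k}a_\alpha Y_\alpha$ (series over $k$); $\mathcal C_\psi(\mathcal H)$ (resp. $\mathcal C_\psi^{SOT}(\mathcal H)$) is the set of $Y$ for which this converges in norm (resp. in the strong operator topology, SOT). $\mathcal C_\psi^{rad}(\mathcal H)$ is the set of $Y$ for which there is $\delta\in(0,1)$ with $rY\in\mathcal C_\psi(\mathcal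 H)$ for $r\in(\delta,1)$ and $\text{SOT-}\lim_{r\to1}\psi(rY)$ exists; then $\psi(Y)$ denotes this limit. For an $n$-tuple $f=(f_1,\dots,f_n)$ of power series these conditions are required for every $f_i$. $[B(\mathcal H)^n]_r:=\{X\in B(\mathcal H)^n:\|\sum_iX_iX_i^*\|^{1/2}<r\}$. A free holomorphic function on $[B(\mathcal H)^n]_\gamma$ is (the evaluation map of) a power series with $\limsup_k(\sum_{|\alpha|=k}|a_\alpha|^2)^{1/2k}\le1/\gamma$. Model property. $\mathbb H^2(f)$ denotes the Hilbert space with orthonormal basis $\{f_\alpha\}_{\alpha\in\mathbb F_n^+}$ ($f_\varnothing=1$), whose elements are the series $\sum_\alpha c_\alpha f_\alpha$, $\sum|c_\alpha|^2<\infty$. $f$ has the model property ($f\in\mathcal M$) if one of the following holds. ($\mathcal A$) $f$ is an $n$-tuple of noncommutative polynomials and there is an $n$-tuple $q$ of polynomials with $f\circ q=q\circ f=\mathrm{id}$. ($\mathcal S$) $f(0)=0$, each $f_i$ has nonzero radius of convergence, the matrix of linear coefficients of $f$ is invertible ($\det J_f(0)\ne0$; then elements of $\mathbb H^2(f)$ are formal power series), $Z_1,\dots,Z_n\in\mathbb H^2(f)$, each $M_{Z_i}\psi:=Z_i\psi$ is a bounded operator on $\mathbb H^2(f)$, and $M_{f_j}=f_j(M_{Z_1},\dots,M_{Z_n})$, where $M_{f_j}\psi:=f_j\psi$ and $(M_{Z_1},\dots,M_{Z_n})$ is in $\mathcal C_f^{SOT}(\mathbb H^2(f))$ or $\mathcal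 C_f^{rad}(\mathbb H^2(f))$. ($\mathcal F$) for some $\gamma>0$, $f$ is an $n$-tuple of free holomorphic functions on $[B(\mathcal H)^n]_\gamma$ ($\mathcal H$ infinite dimensional) with range in $[B(\mathcal H)^n]_1$, there is no nonzero free holomorphic $G$ on $[B(\mathcal H)^n]_1$ with $G\circ f=0$ (then $\mathbb H^2(f)=\{G\circ f: G=\sum c_\alpha Z_\alpha,\ \sum|c_\alpha|^2<\infty\}$), the coordinate functions lie in $\mathbb H^2(f)$, and the boundedness of $M_{Z_i}$ and $M_{f_j}=f_j(M_{Z_1},\dots,M_{Z_n})$ hold as in ($\mathcal S$). The universal model of the noncommutative domain $\mathbb B_f$ is $M_Z=(M_{Z_1},\dots,M_{Z_n})$. Class $\mathcal M^{||}$. $f\in\mathcal M^{||}$ means $f\in\mathcal M$ and $M_Z$ is in the set of norm-convergence of $f$ (the series $f_i(M_Z)$ converge in norm) or of radial norm-convergence of $f$ ($f_i(rM_Z)$ converges in norm for $r<1$ close to $1$ and $f_i(M_Z)=\lim_{r\to1}f_i(rM_Z)$ in norm). Accordingly $f_i(\pi(M_{Z_1}),\dots,\pi(M_{Z_n}))$ is defined by the corresponding norm convergence (and equals $\pi(f_i(M_Z))$). $C^*(M_{Z_1},\dots,M_{Z_n})$ is the $C^*$-algebra generated by $M_{Z_1},\dots,M_{Z_n}$ and the identity on $\mathbb H^2(f)$ (it contains all compact operators on $\mathbb H^2(f)$; ''annihilates the compact operators'' refers to these). *)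

(* Defs.v *)
From HB Require Import structures.
From mathcomp Require Import all_boot all_order all_algebra.
From mathcomp Require Import complex.
From mathcomp Require Import all_classical all_reals all_analysis.

Set Implicit Arguments.
Unset Strict Implicit.
Unset Printing Implicit Defensive.

Import Order.TTheory GRing.Theory Num.Theory.
Import numFieldNormedType.Exports.

Local Open Scope classical_set_scope.
Local Open Scope complex_scope.
Local Open Scope ring_scope.

HB.mixin Record isHilbert (R : realType) V & CompleteNormedModule R[i] V := {
  inner : V -> V -> R[i];
  inner_linearl : forall (y : V) (a : R[i]) (x1 x2 : V),
    inner (a *: x1 + x2) y = a * inner x1 y + inner x2 y;
  inner_conj : forall x y : V, inner y x = Num.conj (inner x y);
  inner_norm : forall x : V, inner x x = `|x| ^+ 2
}.

#[short(type="hilbertType")]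
HB.structure Definition Hilbert (R : realType) :=
  {V of isHilbert R V & CompleteNormedModule R[i] V}.

Definition cabs (R : realType) (z : R[i]) : R := complex.Re `|z|.

Section BasicHilbert.
Variable R : realType.
Local Notation C := R[i].
Variable V : hilbertType R.
Implicit Types (x y z : V) (a : C).

Lemma innerDl y x1 x2 : inner (x1 + x2) y = inner x1 y + inner x2 y.
Proof. by have := inner_linearl y 1 x1 x2; rewrite scale1r mul1r. Qed.

Lemma inner0l y : inner 0 y = 0.
Proof. by apply: (addIr (inner 0 y)); rewrite -innerDl !add0r. Qed.

Lemma innerZl y a x : inner (a *: x) y = a * inner x y.
Proof. by have := inner_linearl y a x 0; rewrite !addr0 inner0l addr0. Qed.

Lemma innerNl y x : inner (- x) y = - inner x y.
Proof. by rewrite -scaleN1r innerZl mulN1r. Qed.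

Lemma innerBl y x1 x2 : inner (x1 - x2) y = inner x1 y - inner x2 y.
Proof. by rewrite innerDl innerNl. Qed.

Lemma innerDr y x1 x2 : inner y (x1 + x2) = inner y x1 + inner y x2.
Proof. by rewrite inner_conj innerDl rmorphD/= -!inner_conj. Qed.

Lemma innerZr y a x : inner y (a *: x) = Num.conj a * inner y x.
Proof. by rewrite inner_conj innerZl rmorphM/= -inner_conj. Qed.

Lemma inner_CauchySchwarz x y : `|inner x y| <= `|x| * `|y|.
Proof.
have [->|y0] := eqVneq y 0.
  by rewrite inner_conj inner0l rmorph0 normr0 normr0 mulr0.
have ny : 0 < `|y| by rewrite normr_gt0.
rewrite -(@ler_pXn2r _ 2) ?nnegrE ?mulr_ge0// exprMn.
set b := inner x y; set N := `|y| ^+ 2.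
have N0 : 0 < N by rewrite exprn_gt0.
have : 0 <= `|N *: x - b *: y| ^+ 2 by rewrite exprn_ge0.
rewrite -inner_norm innerBl !innerZl.
have E z : inner z (N *: x - b *: y) =
    Num.conj N * inner z x - Num.conj b * inner z y.
  by rewrite innerDr -scaleNr !innerZr rmorphN mulNr.
have cN : Num.conj N = N by rewrite conj_Creal// realE ltW.
have by_ : inner y x = Num.conj b by rewrite inner_conj.
rewrite !E cN by_ !inner_norm -/N -/b.
have -> : N * (N * `|x| ^+ 2 - Num.conj b * b) -
   b * (N * Num.conj b - Num.conj b * N) =
   N * (`|x| ^+ 2 * N - b * Num.conj b).
  by rewrite (mulrC N (Num.conj b)) subrr mulr0 subr0 (mulrC (Num.conj b))
     (mulrC N (_ ^+ 2)).
by rewrite pmulr_rge0// subr_ge0 -normCK.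
Qed.

End BasicHilbert.

Section Operators.
Variable R : realType.
Local Notation C := R[i].
Variables V W : hilbertType R.

Definition bounded_op : {pred V -> W} :=
  mem [set T : V -> W | linear T /\ exists M : R, forall x, `|T x| <= M%:C * `|x|].

Record bop := Bop { bop_fun :> V -> W ; _ : bop_fun \in bounded_op }.

HB.instance Definition _ := [isSub for bop_fun].
HB.instance Definition _ := [Choice of bop by <:].

Lemma bopE (S T : bop) : (forall x, S x = T x) -> S = T.
Proof. by move=> h; apply/val_inj/funext. Qed.

Lemma bounded_op_submod : submod_closed bounded_op.
Proof.
split.
  rewrite inE; split; first by move=> a x y /=; rewrite scaler0 addr0.
  by exists 0 => x; rewrite /= normr0 mul0r.
move=> a S T; rewrite !inE => -[lS [M hM]] [lT [N hN]]; split.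
  move=> b x y; rewrite -[LHS]/(a *: S _ + T _) lS lT.
  rewrite -[(a *: S + T) x]/(a *: S x + T x) -[(a *: S + T) y]/(a *: S y + T y).
  by rewrite !scalerDr !scalerA (mulrC a) addrACA.
exists (cabs a * M + N) => x; rewrite -[X in `|X|]/(a *: S x + T x).
rewrite (le_trans (ler_normD _ _))// rmorphD rmorphM/= mulrDl lerD// normrZ.
by rewrite RRe_real ?normr_real// -mulrA ler_wpM2l.
Qed.

HB.instance Definition _ := GRing.isSubmodClosed.Build C (V -> W) bounded_op
  bounded_op_submod.
HB.instance Definition _ := [SubChoice_isSubLmodule of bop by <:].

Lemma bop_linear (T : bop) : linear T.
Proof. by case: T => T /=; rewrite inE => -[]. Qed.

HB.instance Definition _ (T : bop) :=
  GRing.isLinear.Build C V W *:%R (bop_fun T) (@bop_linear T).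

Lemma bop_bounded (T : bop) : exists M : R, forall x, `|T x| <= M%:C * `|x|.
Proof. by case: T => T /=; rewrite inE => -[]. Qed.

Definition opnorm (T : bop) : R :=
  sup [set complex.Re `|T x| | x in [set x : V | `|x| <= 1]].


Lemma opnorm_has_sup (T : bop) :
  has_sup [set complex.Re `|T x| | x in [set x : V | `|x| <= 1]].
Proof.
split; first by exists (complex.Re `|T 0|); exists 0 => //=; rewrite normr0.
have [M hM] := bop_bounded T.
exists `|M| => _ [x /= x1 <-].
rewrite -lecR RRe_real ?normr_real//; apply: le_trans (hM x) _.
rewrite (@le_trans _ _ (`|M|%:C * `|x|))//.
  by rewrite ler_wpM2r// lecR ler_norm.
by rewrite ler_piMr// ler0c.
Qed.

Lemma opnorm_ge0 (T : bop) : 0 <= opnorm T.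
Proof.
apply: (ub_le_sup (proj2 (opnorm_has_sup T))).
by exists 0; rewrite /= ?linear0 normr0.
Qed.

Lemma opnorm_ub (T : bop) x : `|T x| <= (opnorm T)%:C * `|x|.
Proof.
have [->|x0] := eqVneq x 0; first by rewrite linear0 !normr0 mulr0.
have nx : 0 < `|x| by rewrite normr_gt0.
rewrite -ler_pdivrMr// mulrC.
have e : `|T (`|x|^-1 *: x)| = `|x|^-1 * `|T x|.
  by rewrite linearZ normrZ normfV normr_id.
rewrite -e -(@RRe_real _ `|T _|) ?normr_real// lecR.
apply: ub_le_sup; first exact: (proj2 (opnorm_has_sup T)).
by exists (`|x|^-1 *: x) => //=; rewrite normrZ normfV normr_id mulVf ?gt_eqF.
Qed.

Lemma opnorm_le (T : bop) (M : R) : 0 <= M ->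
  (forall x, `|T x| <= M%:C * `|x|) -> opnorm T <= M.
Proof.
move=> M0 hM; apply: ge_sup; first exact: (proj1 (opnorm_has_sup T)).
move=> _ [x /= x1 <-]; rewrite -lecR RRe_real ?normr_real//.
by apply: le_trans (hM x) _; rewrite ler_piMr// ler0c.
Qed.

Definition bop_norm (T : bop) : C := (opnorm T)%:C.

Lemma bop_normD S T : bop_norm (S + T) <= bop_norm S + bop_norm T.
Proof.
rewrite /bop_norm -rmorphD lecR opnorm_le ?addr_ge0 ?opnorm_ge0// => x.
rewrite (le_trans (ler_normD _ _))// rmorphD mulrDl.
by rewrite lerD// opnorm_ub.
Qed.

Lemma bop_normZ a T : bop_norm (a *: T) = `|a| * bop_norm T.
Proof.
have le1 b S : bop_norm (b *: S) <= `|b| * bop_norm S.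
  have e : (cabs b)%:C = `|b| by rewrite RRe_real ?normr_real.
  have b0 : 0 <= cabs b by rewrite -ler0c e.
  rewrite /bop_norm -e -rmorphM lecR opnorm_le ?mulr_ge0 ?opnorm_ge0// => x.
  have -> : (cabs b * opnorm S)%:C = `|b| * (opnorm S)%:C.
    by rewrite -e -rmorphM.
  by rewrite normrZ -mulrA ler_wpM2l// opnorm_ub.
apply/eqP; rewrite eq_le le1/=.
have [->|a0] := eqVneq a 0.
  by rewrite normr0 mul0r ler0c opnorm_ge0.
have := le1 a^-1 (a *: T); rewrite scalerA mulVf// scale1r normfV.
by rewrite mulrC ler_pdivlMr ?normr_gt0// mulrC.
Qed.

Lemma bop_norm_eq0 T : bop_norm T = 0 -> T = 0.
Proof.
move=> T0; apply: bopE => x; apply/eqP; rewrite -normr_le0.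
by have := opnorm_ub T x; rewrite -/(bop_norm T) T0 mul0r.
Qed.

HB.instance Definition _ :=
  Lmodule_isNormed.Build C bop bop_normD bop_normZ bop_norm_eq0.

End Operators.

Section OperatorAlgebra.
Variable R : realType.
Local Notation C := R[i].

Section Comp.
Variables U V W : hilbertType R.

Lemma bop_comp_subproof (S : bop V W) (T : bop U V) :
  (S \o T) \in @bounded_op R U W.
Proof.
rewrite inE; split; first by move=> a x y /=; rewrite !linearP.
exists (opnorm S * opnorm T) => x /=.
rewrite (le_trans (opnorm_ub _ _))// rmorphM -mulrA ler_wpM2l ?ler0c ?opnorm_ge0//.
exact: opnorm_ub.
Qed.

Definition bop_comp S T : bop U W := Bop (bop_comp_subproof S T).

End Comp.

Lemma bop_id_subproof (V : hilbertType R) : (fun x => x) \in @bounded_op R V V.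
Proof. by rewrite inE; split=> //; exists 1 => x; rewrite mul1r. Qed.

Definition bop_id (V : hilbertType R) : bop V V := Bop (bop_id_subproof V).

(* Adjoints exist and are unique by the Riesz representation theorem.      *)
Definition adj (V W : hilbertType R) (T : bop V W) : bop W V :=
  xget (0 : bop W V) [set S : bop W V | forall x y, inner (T x) y = inner x (S y)].

End OperatorAlgebra.

Record csubspace (R : realType) (V : hilbertType R) := CSubspace {
  csub_set :> set V ;
  csub_submod : submod_closed (mem csub_set) ;
  csub_closed : closed csub_set
}.

Section Subspaces.
Variable R : realType.
Local Notation C := R[i].
Variable V : hilbertType R.

Definition csub_pred (M : csubspace V) : {pred V} := mem (csub_set M).

HB.instance Definition _ (M : csubspace V) :=
  GRing.isSubmodClosed.Build C V (csub_pred M) (csub_submod M).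

Section SubHilbert.
Variable M : csubspace V.

Record sub_hilbert := SubHilbert {
  sub_val :> V ; _ : sub_val \in csub_pred M }.

HB.instance Definition _ := [isSub for sub_val].
HB.instance Definition _ := [Choice of sub_hilbert by <:].
HB.instance Definition _ := [SubChoice_isSubLmodule of sub_hilbert by <:].

Definition sub_norm (x : sub_hilbert) : C := `|sub_val x|.

Lemma sub_normD x y : sub_norm (x + y) <= sub_norm x + sub_norm y.
Proof. exact: ler_normD. Qed.

Lemma sub_normZ a x : sub_norm (a *: x) = `|a| * sub_norm x.
Proof. exact: normrZ. Qed.

Lemma sub_norm_eq0 x : sub_norm x = 0 -> x = 0.
Proof. by move=> /normr0_eq0 x0; apply: val_inj. Qed.

HB.instance Definition _ :=
  Lmodule_isNormed.Build C sub_hilbert sub_normD sub_normZ sub_norm_eq0.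

Lemma sub_normE (x : sub_hilbert) : `|x| = `|sub_val x|.
Proof. by []. Qed.

Lemma sub_hilbert_complete (F : set_system sub_hilbert) :
  ProperFilter F -> cauchy F -> cvg F.
Proof.
move=> FF /cauchy_ballP cF.
have cG : cauchy (sub_val @ F).
  apply/cauchy_ballP => e e0; have := cF e e0.
  move=> -[[A B] /= [FA FB] AB].
  exists (sub_val @` A, sub_val @` B) => /=.
    by split; [apply: filterS FA|apply: filterS FB] => x; exists x.
  move=> -[_ _] [/= [x Ax <-] [y By <-]].
  by have := AB (x, y) (conj Ax By); rewrite /= -!ball_normE.
have cvgG : cvg (sub_val @ F) by exact: cauchy_cvg.
have [l Fl] : exists l : V, sub_val @ F --> l by exists (lim (sub_val @ F)).
have Ml : csub_set M l.
  have nM : \forall x \near F, csub_set M (sub_val x).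
    by apply: nearW => x; apply/set_mem; case: x.
  exact: (@closed_cvg _ _ _ _ sub_val (csub_set M) (@csub_closed _ _ M) nM l Fl).
apply/cvg_ex; exists (SubHilbert (mem_set Ml)).
apply/cvgrPdist_lt => e e0; move/cvgrPdist_lt : Fl => /(_ e e0).
by apply: filterS => x; rewrite sub_normE.
Qed.

HB.instance Definition _ :=
  Uniform_isComplete.Build sub_hilbert sub_hilbert_complete.

Definition sub_inner (x y : sub_hilbert) : C := inner (sub_val x) (sub_val y).

Lemma sub_inner_linearl y a x1 x2 :
  sub_inner (a *: x1 + x2) y = a * sub_inner x1 y + sub_inner x2 y.
Proof. exact: inner_linearl. Qed.

Lemma sub_inner_conj x y : sub_inner y x = Num.conj (sub_inner x y).
Proof. exact: inner_conj. Qed.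

Lemma sub_inner_norm x : sub_inner x x = `|x| ^+ 2.
Proof. exact: inner_norm. Qed.

HB.instance Definition _ := isHilbert.Build R sub_hilbert
  sub_inner_linearl sub_inner_conj sub_inner_norm.

End SubHilbert.

Definition lspan (S : set V) : set V := [set x | exists m (a : 'I_m -> C)
  (s : 'I_m -> V), (forall i, S (s i)) /\ x = \sum_i a i *: s i].

Lemma closure_normP (S : set V) x :
  closure S x <-> forall e : C, 0 < e -> exists2 y, S y & `|x - y| < e.
Proof.
split=> [cx e e0|h U /nbhs_ballP[e /= e0 eU]].
  have [y [Sy]] := cx _ (nbhsx_ballx x e e0).
  by rewrite -ball_normE; exists y.
by have [y Sy xy] := h e e0; exists y; split=> //; apply: eU; rewrite -ball_normE.
Qed.

Lemma closure_lspan_submod S : submod_closed (mem (closure (lspan S))).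
Proof.
have S0 : lspan S 0.
  by exists 0%N, (fun=> 0), (fun=> 0); rewrite big_ord0; split=> // -[].
have SD a x y : lspan S x -> lspan S y -> lspan S (a *: x + y).
  move=> [m [b [s [hs ->]]]] [k [c [t [ht ->]]]].
  exists (m + k)%N.
  exists (fun i => match fintype.split i with inl i => a * b i | inr i => c i end).
  exists (fun i => match fintype.split i with inl i => s i | inr i => t i end).
  split; first by move=> i; case: fintype.split.
  rewrite big_split_ord scaler_sumr; congr (_ + _); apply: eq_bigr => i _.
    by rewrite (unsplitK (inl i)) scalerA.
  by rewrite (unsplitK (inr i)).
split; first by rewrite inE; exact: subset_closure.
move=> a x y; rewrite !inE => /closure_normP cx /closure_normP cy.
apply/closure_normP => e e0.
have a1 : 0 < `|a| + 1 by rewrite ltr_wpDl.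
have [x' Sx' xx'] := cx (e / 2 / (`|a| + 1)) ltac:(by rewrite !divr_gt0).
have [y' Sy' yy'] := cy (e / 2) ltac:(by rewrite divr_gt0).
exists (a *: x' + y'); first exact: SD.
rewrite opprD addrACA -scalerBr (le_lt_trans (ler_normD _ _))//.
rewrite [e in _ < e]splitr ltr_leD// ?ltW// normrZ.
rewrite (@le_lt_trans _ _ ((`|a| + 1) * `|x - x'|))//.
  by rewrite ler_wpM2r// lerDl.
by rewrite mulrC -ltr_pdivlMr.
Qed.

Definition closed_span (S : set V) : csubspace V :=
  CSubspace (closure_lspan_submod S) (@closed_closure _ (lspan S)).

Definition orthocompl_set (M : set V) : set V :=
  [set x | forall y, M y -> inner x y = 0].

Lemma orthocompl_submod M : submod_closed (mem (orthocompl_set M)).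
Proof.
split; first by rewrite inE => y _; rewrite inner0l.
move=> a x y; rewrite !inE => hx hy z Mz.
by rewrite inner_linearl hx// hy// mulr0 addr0.
Qed.

Lemma orthocompl_closed M : closed (orthocompl_set M).
Proof.
move=> x /closure_normP cx y My; apply/eqP/negPn/negP => n0.
have [y0|y0] := eqVneq y 0.
  by move/eqP: n0; apply; rewrite y0 inner_conj inner0l rmorph0.
have ny : 0 < `|y| by rewrite normr_gt0.
have [z /(_ y My) zy xz] := cx (`|inner x y| / `|y|)
  ltac:(by rewrite divr_gt0// normr_gt0).
have := inner_CauchySchwarz (x - z) y.
rewrite innerBl zy subr0 -ler_pdivrMr// => h.
by have := le_lt_trans h xz; rewrite ltxx.
Qed.

Definition orthocompl (M : set V) : csubspace V :=
  CSubspace (@orthocompl_submod M) (@orthocompl_closed M).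

End Subspaces.

Section PowerSeries.
Variables (R : realType) (n : nat).
Local Notation C := R[i].

Definition word := seq 'I_n.
Definition fps := word -> C.

Definition fps_one : fps := fun a => (a == [::])%:R.
Definition fps_var (i : 'I_n) : fps := fun a => (a == [:: i])%:R.
Definition fps_mul (p q : fps) : fps :=
  fun a => \sum_(k < (size a).+1) p (take k a) * q (drop k a).
Definition fps_word (g : 'I_n -> fps) (a : word) : fps :=
  foldr (fun i p => fps_mul (g i) p) fps_one a.

(* The sum below has finite support when p is a polynomial, and also when
   every g i has zero constant term.                                       *)
Definition fps_comp (p : fps) (g : 'I_n -> fps) : fps :=
  fun b => \sum_(a \in [set: word]) p a * fps_word g a b.

Definition fps_poly (p : fps) : Prop := finite_set [set a | p a != 0].

(* The reciprocal of the radius of convergence.                            *)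
Definition inv_radius (p : fps) : \bar R :=
  limn_esup (fun k : nat =>
    ((\sum_(a : k.-tuple 'I_n) cabs (p a) ^+ 2) `^ ((2 * k)%:R)^-1)%:E).

Definition free_holomorphic (gamma : R) (p : fps) : Prop :=
  (inv_radius p <= (gamma^-1)%:E)%E.

Definition linear_coefs (f : 'I_n -> fps) : 'M[C]_n :=
  \matrix_(i, j) f i [:: j].

Section Evaluation.
Variable H : hilbertType R.
Implicit Types (p : fps) (Y : 'I_n -> bop H H).

Definition op_word Y (a : word) : bop H H :=
  foldr (fun i T => bop_comp (Y i) T) (bop_id H) a.

Definition partial_sum p Y (N : nat) : bop H H :=
  \sum_(k < N) \sum_(a : k.-tuple 'I_n) p a *: op_word Y a.

Definition norm_cvg p Y : Prop := cvg (partial_sum p Y @ \oo).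
Definition norm_eval p Y : bop H H := lim (partial_sum p Y @ \oo).

Definition dilate Y (r : R) : 'I_n -> bop H H := fun i => r%:C *: Y i.

Definition radial_cvg p Y : Prop := exists delta : R, 0 < delta < 1 /\
  forall r : R, delta < r < 1 -> norm_cvg p (dilate Y r).

Definition sot_limit (I : Type) (F : set_system I) (S : I -> bop H H)
  (T : bop H H) : Prop := forall x : H, S i x @[i --> F] --> T x.

Definition sot_value p Y (T : bop H H) : Prop :=
  sot_limit \oo (partial_sum p Y) T.

Definition sot_radial_value p Y (T : bop H H) : Prop :=
  radial_cvg p Y /\ sot_limit 1^'- (fun r => norm_eval p (dilate Y r)) T.

Definition norm_value p Y (T : bop H H) : Prop := partial_sum p Y @ \oo --> T.

Definition norm_radial_value p Y (T : bop H H) : Prop :=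
  radial_cvg p Y /\ norm_eval p (dilate Y r) @[r --> 1^'-] --> T.

Definition in_norm_domain (f : 'I_n -> fps) Y : Prop :=
  (forall i, exists T, norm_value (f i) Y T) \/
  (forall i, exists T, norm_radial_value (f i) Y T).

(* When both limits exist they agree, by Abel summation. *)
Definition series_at p Y : bop H H :=
  xget 0 [set T | norm_value p Y T \/ norm_radial_value p Y T].

Definition row_ball (r : R) : set ('I_n -> bop H H) :=
  [set X | Num.sqrt (opnorm (\sum_i bop_comp (X i) (adj (X i)))) < r].

End Evaluation.

End PowerSeries.

Definition infinite_dim (R : realType) (V : hilbertType R) : Prop :=
  forall S : set V, finite_set S -> lspan S <> setT.

Definition separable (T : topologicalType) : Prop :=
  exists D : set T, countable D /\ dense D.

Definition orthonormal_basis (R : realType) (V : hilbertType R) (I : eqType)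
    (e : I -> V) : Prop :=
  (forall a b, inner (e a) (e b) = (a == b)%:R) /\
  closure (lspan (range e)) = setT.

(* H^2(f) is a Hilbert space H2 with an orthonormal basis e indexed by words;
   e a plays the role of f_a, so that x is the series \sum_a <x, e a> f_a: a
   formal power series (formal_series) or a function of X (function_at).
   The predicates say that MZ i is the operator of multiplication by Z_i.  *)

Section ModelProperty.
Variables (R : realType) (n : nat).
Local Notation C := R[i].
Variables (f : 'I_n -> fps R n).
Variables (H2 : hilbertType R) (e : word n -> H2) (MZ : 'I_n -> bop H2 H2).

Definition coefs (x : H2) : fps R n := fun a => inner x (e a).

Definition formal_series (x : H2) : fps R n := fps_comp (coefs x) f.

Definition model_value (T : 'I_n -> bop H2 H2) : Prop :=
  (forall j, sot_value (f j) MZ (T j)) \/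
  (forall j, sot_radial_value (f j) MZ (T j)).

(* The multiplication by Z_i is prescribed on polynomials in f_1, ..., f_n;
   these are dense in H^2(f).                                              *)
Definition property_A : Prop :=
  [/\ forall i, fps_poly (f i),
      exists q : 'I_n -> fps R n, [/\ forall i, fps_poly (q i),
        forall i, fps_comp (f i) q = fps_var R i &
        forall i, fps_comp (q i) f = fps_var R i] &
      forall i x, fps_poly (coefs x) -> fps_poly (coefs (MZ i x)) /\
        formal_series (MZ i x) = fps_mul (fps_var R i) (formal_series x)].

Definition property_S : Prop :=
  [/\ forall i, f i [::] = 0,
      forall i, (inv_radius (f i) < +oo)%E,
      \det (linear_coefs f) != 0 &
      [/\ forall i, exists x, formal_series x = fps_var R i,
      forall i x,
        formal_series (MZ i x) = fps_mul (fps_var R i) (formal_series x) &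
      exists T : 'I_n -> bop H2 H2, model_value T /\
        forall j x, formal_series (T j x) = fps_mul (f j) (formal_series x)]].

Section PropertyF.
Variables (H : hilbertType R) (gamma : R).

Definition map_at (X : 'I_n -> bop H H) : 'I_n -> bop H H :=
  fun i => norm_eval (f i) X.

Definition function_at (x : H2) (X : 'I_n -> bop H H) : bop H H :=
  norm_eval (coefs x) (map_at X).

Definition property_F_on : Prop :=
  [/\ forall i, free_holomorphic gamma (f i),
      forall X : 'I_n -> bop H H, row_ball gamma X -> row_ball 1 (map_at X),
      forall G : fps R n, free_holomorphic 1 G ->
        (forall X : 'I_n -> bop H H, row_ball gamma X ->
          norm_eval G (map_at X) = 0) ->
        forall a, G a = 0 &
      [/\ forall i, exists x, forall X, row_ball gamma X ->
        function_at x X = X i,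
      forall i x X, row_ball gamma X ->
        function_at (MZ i x) X = bop_comp (X i) (function_at x X) &
      exists T : 'I_n -> bop H2 H2, model_value T /\
        forall j x X, row_ball gamma X ->
          function_at (T j x) X = bop_comp (map_at X j) (function_at x X)]].

End PropertyF.

Definition property_F (H : hilbertType R) : Prop :=
  exists2 gamma : R, 0 < gamma & property_F_on H gamma.

Definition model_property (H : hilbertType R) : Prop :=
  [\/ property_A, property_S | property_F H].

Definition norm_model_property (H : hilbertType R) : Prop :=
  model_property H /\ in_norm_domain f MZ.

End ModelProperty.

(* A representation of a C*-algebra A of operators on V is a function on all
   of bop V V of which only the values on A matter.                        *)

Section Representations.
Variables (R : realType) (V : hilbertType R).
Local Notation C := R[i].

Definition cstar_subalgebra (A : set (bop V V)) : Prop :=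
  [/\ A (bop_id V),
      forall (a : C) X Y, A X -> A Y -> A (a *: X + Y),
      forall X Y, A X -> A Y -> A (bop_comp X Y),
      forall X, A X -> A (adj X) &
      closed A].

Definition cstar_generated (S : set (bop V V)) : set (bop V V) :=
  smallest cstar_subalgebra S.

Variable A : set (bop V V).

Definition star_rep (K : hilbertType R) (pi : bop V V -> bop K K) : Prop :=
  [/\ forall (a : C) X Y, A X -> A Y -> pi (a *: X + Y) = a *: pi X + pi Y,
      forall X Y, A X -> A Y -> pi (bop_comp X Y) = bop_comp (pi X) (pi Y) &
      forall X, A X -> pi (adj X) = adj (pi X)].

Definition nondegenerate_rep (K : hilbertType R) (pi : bop V V -> bop K K) : Prop :=
  closure (lspan [set x | exists X k, A X /\ x = pi X k]) = setT.

Definition unitary (K L : hilbertType R) (U : bop K L) : Prop :=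
  (forall x y, inner (U x) (U y) = inner x y) /\ range U = setT.

Definition unitarily_equivalent (K L : hilbertType R)
    (pi : bop V V -> bop K K) (rho : bop V V -> bop L L) : Prop :=
  exists2 U : bop K L, unitary U &
    forall X, A X -> bop_comp U (pi X) = bop_comp (rho X) U.

Definition subrep (K : hilbertType R) (pi : bop V V -> bop K K)
    (M : csubspace K)
    (sigma : bop V V -> bop (sub_hilbert M) (sub_hilbert M)) : Prop :=
  forall X, A X -> forall x : sub_hilbert M,
    sub_val (sigma X x) = pi X (sub_val x).

Definition disjoint_reps (K L : hilbertType R)
    (pi : bop V V -> bop K K) (rho : bop V V -> bop L L) : Prop :=
  forall (M : csubspace K) (N : csubspace L)
    (sigma : bop V V -> bop (sub_hilbert M) (sub_hilbert M))
    (tau : bop V V -> bop (sub_hilbert N) (sub_hilbert N)),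
    subrep pi sigma -> subrep rho tau -> unitarily_equivalent sigma tau ->
    csub_set M = [set 0].

Definition direct_sum_rep (K : hilbertType R) (M N : csubspace K)
    (pi : bop V V -> bop K K)
    (sigma : bop V V -> bop (sub_hilbert M) (sub_hilbert M))
    (tau : bop V V -> bop (sub_hilbert N) (sub_hilbert N)) : Prop :=
  [/\ forall x y, csub_set M x -> csub_set N y -> inner x y = 0,
      forall k : K, exists (x : sub_hilbert M) (y : sub_hilbert N),
        k = sub_val x + sub_val y &
      forall X, A X -> forall (x : sub_hilbert M) (y : sub_hilbert N),
        pi X (sub_val x + sub_val y) =
        sub_val (sigma X x) + sub_val (tau X y)].

Definition compact_op (W : hilbertType R) (T : bop V W) : Prop :=
  precompact (T @` [set x : V | `|x| <= 1]).

End Representations.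

Section DimensionTensor.
Variable R : realType.
Local Notation C := R[i].

Definition basis_of_subspace (V : hilbertType R) (M B : set V) : Prop :=
  [/\ B `<=` M, forall x y, B x -> B y -> inner x y = (x == y)%:R &
      M `<=` closure (lspan B)].

Definition same_hilbert_dim (V W : hilbertType R) (M : set V) (N : set W) :
    Prop :=
  exists B B', [/\ basis_of_subspace M B, basis_of_subspace N B' &
    (B #= B')%card].

(* T is the Hilbert space tensor product of U and V, with t u v = u (x) v. *)
Definition hilbert_tensor (U V T : hilbertType R) (t : U -> V -> T) : Prop :=
  [/\ forall v, linear (fun u => t u v), forall u, linear (t u),
      forall u u' v v', inner (t u v) (t u' v') = inner u u' * inner v v' &
      closure (lspan [set x | exists u v, x = t u v]) = setT].

(* Y = X (x) I, for the tensor product exhibited by t. *)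
Definition ampliation (U V T : hilbertType R) (t : U -> V -> T)
    (X : bop U U) (Y : bop T T) : Prop :=
  forall u v, Y (t u v) = t (X u) v.

End DimensionTensor.

Section WoldDecomposition.
Variables (R : realType) (n : nat).
Variables (f : 'I_n -> fps R n).
Variables (H2 : hilbertType R) (MZ : 'I_n -> bop H2 H2).

Definition model_algebra : set (bop H2 H2) := cstar_generated (range MZ).

Definition row_square (K : hilbertType R) (Y : 'I_n -> bop K K) : bop K K :=
  \sum_i bop_comp (series_at (f i) Y) (adj (series_at (f i) Y)).

Variables (K : hilbertType R) (pi : bop H2 H2 -> bop K K).

Definition rep_defect : bop K K := bop_id K - row_square (pi \o MZ).

Definition space0 : csubspace K :=
  closed_span [set x | exists (a : word n) (k : K),
    x = pi (op_word MZ a) (rep_defect k)].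

Definition space1 : csubspace K := orthocompl space0.

Record wold_decomposition
    (pi0 : bop H2 H2 -> bop (sub_hilbert space0) (sub_hilbert space0))
    (pi1 : bop H2 H2 -> bop (sub_hilbert space1) (sub_hilbert space1))
    (G : hilbertType R) : Prop := WoldDecomposition {
  wold_rep0 : star_rep model_algebra pi0 ;
  wold_rep1 : star_rep model_algebra pi1 ;
  wold_sum : direct_sum_rep model_algebra pi pi0 pi1 ;
  wold_disjoint : disjoint_reps model_algebra pi0 pi1 ;
  wold_tensor : exists (T : hilbertType R) (t : H2 -> G -> T)
      (U : bop (sub_hilbert space0) T),
    [/\ hilbert_tensor t, unitary U &
      forall X, model_algebra X -> exists Y : bop T T,
        ampliation t X Y /\ bop_comp U (pi0 X) = bop_comp Y U] ;
  wold_dim : same_hilbert_dim [set: G] (range rep_defect) ;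
  wold_compact : forall X, compact_op X -> model_algebra X /\ pi1 X = 0 ;
  wold_domain : in_norm_domain f (pi1 \o MZ) ;
  wold_row : row_square (pi1 \o MZ) = bop_id (sub_hilbert space1)
}.

End WoldDecomposition.

(* Main.v *)
Require Import Defs.
From HB Require Import structures.
From mathcomp Require Import all_boot all_order all_algebra finmap.
From mathcomp Require Import complex.
From mathcomp Require Import all_classical all_reals all_analysis.
From mathcomp Require Import ring lra.

Set Implicit Arguments.
Unset Strict Implicit.
Unset Printing Implicit Defensive.

Import Order.TTheory GRing.Theory Num.Theory.
Import numFieldNormedType.Exports.

Local Open Scope classical_set_scope.
Local Open Scope complex_scope.
Local Open Scope ring_scope.

(** Write e_a (a a word) for the orthonormal basis f_a of H^2(f) and A for the
C*-algebra generated by the model M_Z and the identity.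

The model property enters only through one consequence (shift_ex): the values
f_j(M_Z) are the left shifts S_j : e_a |-> e_(j a), whatever the case (A), (S)
or (F) and whatever the mode of convergence.  In each case the model property
implies that f_j(M_Z) multiplies by f_j, so that f_j(M_Z) e_a and e_(j a) have the
same series; it remains to see that a vector is determined by its series.  In
case (A) composition with f has a left inverse on polynomials, namely
composition with q (fps_comp_cancel); in case (S) the terms of lowest order of
f_a are those of a tensor power of the invertible matrix of linear coefficients
(fps_comp_eq0); in case (F) square summable coefficients define a free
holomorphic function on the unit ball, and the uniqueness hypothesis on f
applies (coefs_free_holomorphic, row_ball_cvg).  The two modes of summation
give the same value by Abel's theorem (abel, sot_agree).

Once the S_j are in A, so is the vacuum projection 1 - sum_j S_j adj(S_j), which
is the rank one operator e_0 (x) e_0 with e_0 = e_[::], hence every rank one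
operator (rank1_mem) and every compact one (compact_mem).  Moreover e_0 is cyclic
for M_Z: the closed span of the (M_Z)_a e_0 is invariant under M_Z, hence under
the limits S_j of polynomials in M_Z, and so contains every e_a (model_cyclic).

A unital representation pi of A is contractive (rep_contractive), so that
f_j(pi(M_Z)) = pi(S_j) and the defect operator Q is the projection
pi(e_0 (x) e_0) (rep_defectE).  For g in the range G of Q, the map
x (x) g |-> pi(x (x) e_0) g preserves inner products because
adj(y (x) e_0) composed with x (x) e_0 is the multiple <x, y> of e_0 (x) e_0
(rank1_inner); by cyclicity its range spans K_0, and it carries X (x) 1 to pi(X).
This is the tensor decomposition (tensor_hilbert).  On the orthogonal
complement K_1 the rank one operators, hence the compact ones, act by zero
(space1_rank1), and in particular the defect does.  A representation contained
in both parts would kill the compact operators, and on K_0 this forces it to be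
zero (rep_disjoint).

An equivalence U of pi and pi' carries Q to Q', K_0 to K_0' and K_1 to K_1',
which yields the equality of dimensions (wold_dim_eq, where separability makes
the cardinality of an orthonormal basis well defined, basis_card_eq) and the
equivalence of the residual parts (wold_equiv1).  Conversely a bijection of
orthonormal bases of G and G' and an equivalence on K_1 give two total families
with the same Gram matrix, and these are exchanged by a unitary (gram_unitary,
wold_equiv_of_parts). *)

(** * Norms and inner products with real values *)

Section Modulus.
Variable R : realType.
Local Notation C := R[i].

Lemma pos_real (e : C) : 0 < e -> exists2 r : R, 0 < r & e = r%:C.
Proof.
move=> e0; exists (complex.Re e); last by rewrite RRe_real ?gtr0_real.
by move: e0; rewrite ltcE => /andP[].
Qed.

Lemma cabsC (r : R) : cabs (r%:C : C) = `|r|.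
Proof. by rewrite /cabs normc_def/= expr0n/= addr0 sqrtr_sqr. Qed.

Lemma cabs_ge0 (z : C) : 0 <= cabs z.
Proof. by rewrite -ler0c RRe_real ?normr_real. Qed.

Lemma cabs_small (z : C) : (forall e : R, 0 < e -> cabs z <= e) -> z = 0.
Proof.
move=> h; apply/normr0_eq0; rewrite -(@RRe_real _ `|z|) ?normr_real//.
congr (_%:C); apply/eqP; rewrite eq_le cabs_ge0 andbT.
by apply/ler_addgt0Pl => e e0; rewrite addr0 h.
Qed.

Lemma cabsD (z w : C) : cabs (z + w) <= cabs z + cabs w.
Proof. by rewrite -lecR rmorphD/= !RRe_real ?normr_real// ler_normD. Qed.

Lemma cabsM (a b : C) : cabs (a * b) = cabs a * cabs b.
Proof. by apply: (@complexI R); rewrite rmorphM/= !RRe_real ?normr_real// normrM. Qed.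

Lemma Re_conjM (r : R) (w : C) :
  complex.Re (Num.conj (r%:C * w) * w) = r * cabs w ^+ 2.
Proof.
rewrite rmorphM/= conj_Creal ?complex_real// -mulrA (mulrC (Num.conj w)) -normCK.
by rewrite -[ `|w| ](@RRe_real R) ?normr_real// -rmorphXn -rmorphM.
Qed.

End Modulus.

Section RealNorm.
Variable R : realType.
Local Notation C := R[i].
Variable V : normedModType C.
Implicit Types x y : V.

(** Norms of a complex normed space take their values in the complex numbers;
the real valued version is the one that suits infima, square roots and linear
arithmetic. *)
Definition nrm (x : V) : R := complex.Re `|x|.

Lemma nrmC x : (nrm x)%:C = `|x|.
Proof. by rewrite RRe_real ?normr_real. Qed.

Lemma nrm_ge0 x : 0 <= nrm x. Proof. by rewrite -ler0c nrmC. Qed.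

Lemma nrm0 : nrm 0 = 0. Proof. by rewrite /nrm normr0. Qed.

Lemma nrm_eq0 x : nrm x = 0 -> x = 0.
Proof. by move=> h; apply: normr0_eq0; rewrite -nrmC h. Qed.

Lemma nrmN x : nrm (- x) = nrm x. Proof. by rewrite /nrm normrN. Qed.

Lemma nrmB x y : nrm (x - y) = nrm (y - x). Proof. by rewrite -nrmN opprB. Qed.

Lemma nrmD x y : nrm (x + y) <= nrm x + nrm y.
Proof. by rewrite -lecR rmorphD/= !nrmC ler_normD. Qed.

Lemma nrm_triangle z x y : nrm (x - y) <= nrm (x - z) + nrm (z - y).
Proof. by rewrite (le_trans _ (nrmD _ _))// addrA subrK. Qed.

Lemma nrmZ a x : nrm (a *: x) = cabs a * nrm x.
Proof.
by apply: (@complexI R); rewrite rmorphM/= !nrmC normrZ.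
Qed.

Lemma nrm_sum I (r : seq I) (P : pred I) (F : I -> V) :
  nrm (\sum_(i <- r | P i) F i) <= \sum_(i <- r | P i) nrm (F i).
Proof.
elim/big_ind2: _ => [|x a y b xa yb|//]; first by rewrite nrm0.
by rewrite (le_trans (nrmD _ _))// lerD.
Qed.

Lemma nrm_cvg (I : Type) (F : set_system I) (FF : Filter F) (u : I -> V) l :
  u i @[i --> F] --> l <->
  forall e : R, 0 < e -> \forall i \near F, nrm (l - u i) < e.
Proof.
split=> [/cvgrPdist_lt h e e0|h].
  have := h e%:C; rewrite ltcR => /(_ e0); apply: filterS => i.
  by rewrite -nrmC ltcR.
apply/cvgrPdist_lt => e /pos_real[r r0 ->].
by apply: filterS (h r r0) => i; rewrite -nrmC ltcR.
Qed.

Lemma nrm_cvg_seq (u : nat -> V) l : u i @[i --> \oo] --> l <->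
  forall e : R, 0 < e -> exists N, forall i, (N <= i)%N -> nrm (l - u i) < e.
Proof.
rewrite nrm_cvg; split=> h e e0; have := h e e0.
  by move=> [N _ hN]; exists N => i Ni; apply: hN.
by move=> [N hN]; exists N => // i /= Ni; apply: hN.
Qed.

Lemma cvg_seq_unique (u : nat -> V) (l l' : V) :
  u i @[i --> \oo] --> l -> u i @[i --> \oo] --> l' -> l = l'.
Proof. by move=> h h'; apply: (@norm_cvg_unique _ _ (u @ \oo) _ l l' h h'). Qed.

Lemma nrm_closureP (S : set V) x :
  closure S x <-> forall e : R, 0 < e -> exists2 y, S y & nrm (x - y) < e.
Proof.
split=> [cx e e0|h U /nbhs_ballP[e /= /pos_real[r r0 ->] eU]].
  have [y [Sy]] := cx _ (nbhsx_ballx x e%:C ltac:(by rewrite ltcR)).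
  by rewrite -ball_normE /= -nrmC ltcR; exists y.
have [y Sy xy] := h r r0; exists y; split=> //; apply: eU.
by rewrite -ball_normE /= -nrmC ltcR.
Qed.

Lemma nrm_eq0_lt x : (forall e : R, 0 < e -> nrm x < e) -> x = 0.
Proof.
move=> h; apply: nrm_eq0; apply/eqP; rewrite eq_le nrm_ge0 andbT leNgt.
by apply/negP => /h; rewrite ltxx.
Qed.

End RealNorm.

Lemma invr_succ_small (R : realType) (e : R) : 0 < e ->
  exists N : nat, forall i, (N <= i)%N -> i.+1%:R^-1 < e.
Proof.
move=> e0; exists (Num.truncn e^-1) => i Ni.
rewrite invf_plt ?posrE// (lt_le_trans (truncnS_gt _))//.
by rewrite ler_nat.
Qed.

Lemma seq_cauchy_cvg (R : realType) (V : completeNormedModType R[i])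
    (u : nat -> V) :
  (forall e : R, 0 < e -> exists N, forall i j, (N <= i)%N -> (N <= j)%N ->
    nrm (u i - u j) < e) -> exists l : V, u i @[i --> \oo] --> l.
Proof.
move=> h; suff cu : cvg (u i @[i --> \oo]) by exists (lim (u i @[i --> \oo])).
apply: cauchy_cvg; apply/cauchy_ballP => e /pos_real[r r0 ->].
have [N hN] := h r r0.
exists (u @` [set i | (N <= i)%N], u @` [set i | (N <= i)%N]) => /=.
  by split; exists N => // i Ni; exists i.
move=> [_ _] [/= [i Ni <-] [j Nj <-]].
by rewrite -ball_normE /= -nrmC ltcR hN.
Qed.

Section Inner.
Variables (R : realType) (V : hilbertType R).
Local Notation C := R[i].
Implicit Types x y z : V.

Lemma inner0r y : inner y 0 = 0.
Proof. by rewrite inner_conj inner0l rmorph0. Qed.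

Lemma innerNr y x : inner y (- x) = - inner y x.
Proof. by rewrite inner_conj innerNl rmorphN/= -inner_conj. Qed.

Lemma innerBr y x1 x2 : inner y (x1 - x2) = inner y x1 - inner y x2.
Proof. by rewrite innerDr innerNr. Qed.

Lemma inner_suml I (r : seq I) (P : pred I) (F : I -> V) y :
  inner (\sum_(i <- r | P i) F i) y = \sum_(i <- r | P i) inner (F i) y.
Proof.
elim/big_rec2: _ => [|i a x _ <-]; first by rewrite inner0l.
by rewrite innerDl.
Qed.

Lemma inner_sumr I (r : seq I) (P : pred I) (F : I -> V) y :
  inner y (\sum_(i <- r | P i) F i) = \sum_(i <- r | P i) inner y (F i).
Proof.
elim/big_rec2: _ => [|i a x _ <-]; first by rewrite inner0r.
by rewrite innerDr.
Qed.

Lemma inner_nrm x : inner x x = (nrm x ^+ 2)%:C.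
Proof. by rewrite inner_norm -nrmC rmorphXn. Qed.

Lemma inner_self_eq0 x : inner x x = 0 -> x = 0.
Proof.
rewrite inner_nrm => h; apply: nrm_eq0; apply/eqP; rewrite -sqrf_eq0; apply/eqP.
exact: (@complexI R).
Qed.

Lemma cabs_inner x y : cabs (inner x y) <= nrm x * nrm y.
Proof.
rewrite -lecR rmorphM/= !nrmC RRe_real ?normr_real//.
exact: inner_CauchySchwarz.
Qed.

Lemma nrmD2 x y :
  nrm (x + y) ^+ 2 = nrm x ^+ 2 + nrm y ^+ 2 + complex.Re (inner x y) *+ 2.
Proof.
apply: (@complexI R); rewrite -inner_nrm innerDl !innerDr !inner_nrm.
rewrite mulr2n !rmorphD/= (inner_conj x y) -!addrA; congr (_ + _).
rewrite addrA addrC; congr (_ + _).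
by case: (inner x y) => a b; apply/eqP; rewrite eq_complex/= addrN addr0 !eqxx.
Qed.

Lemma nrmD2_orth x y : inner x y = 0 ->
  nrm (x + y) ^+ 2 = nrm x ^+ 2 + nrm y ^+ 2.
Proof. by move=> h; rewrite nrmD2 h mul0rn addr0. Qed.

Lemma parallelogram x y :
  nrm (x + y) ^+ 2 + nrm (x - y) ^+ 2 = (nrm x ^+ 2 + nrm y ^+ 2) *+ 2.
Proof.
rewrite !nrmD2 nrmN innerNr raddfN/= mulNrn; lra.
Qed.

Lemma inner_all0 x : (forall y, inner x y = 0) -> x = 0.
Proof.
by move=> h; apply: inner_self_eq0.
Qed.

Lemma inner_inj x y : (forall z, inner x z = inner y z) -> x = y.
Proof.
move=> h; apply/eqP; rewrite -subr_eq0; apply/eqP/inner_all0 => z.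
by rewrite innerBl h subrr.
Qed.

(** Orthogonality to a set passes to its closed span by the Cauchy-Schwarz
inequality. *)
Lemma closure_orth (S : set V) x y :
  (forall z, S z -> inner x z = 0) -> closure (lspan S) y -> inner x y = 0.
Proof.
move=> h /nrm_closureP cy; apply: cabs_small => e e0.
have n1 : 0 < nrm x + 1 by rewrite ltr_wpDl ?nrm_ge0.
have [z [m [a [s [hs ->]]]] yz] := cy (e / (nrm x + 1)) ltac:(by rewrite divr_gt0).
have h0 : inner x (\sum_i a i *: s i) = 0.
  by rewrite inner_sumr big1// => i _; rewrite innerZr h ?mulr0.
rewrite -(subr0 (inner x y)) -h0 -innerBr (le_trans (cabs_inner _ _))//.
move: yz; rewrite ltr_pdivlMr// => /ltW; apply: le_trans.
by rewrite mulrC ler_wpM2l ?nrm_ge0// lerDl.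
Qed.

Lemma total_orth (S : set V) x : closure (lspan S) = setT ->
  (forall z, S z -> inner x z = 0) -> x = 0.
Proof. by move=> cS h; apply: inner_all0 => y; apply: (closure_orth h); rewrite cS. Qed.

Lemma lspan_incl (S : set V) : S `<=` lspan S.
Proof.
move=> x Sx; exists 1%N, (fun=> 1), (fun=> x); split=> //.
by rewrite big_ord1 scale1r.
Qed.

Lemma span_incl (S : set V) : S `<=` closure (lspan S).
Proof. by move=> x /lspan_incl; exact: subset_closure. Qed.

Lemma csub_comb (M : csubspace V) a x y : csub_set M x -> csub_set M y -> csub_set M (a *: x + y).
Proof.
by case: (csub_submod M) => _ h Mx My; have := h a x y; rewrite !inE; apply.
Qed.

Lemma csub0 (M : csubspace V) : csub_set M 0.
Proof. by case: (csub_submod M) => h _; move: h; rewrite inE. Qed.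

Lemma csubD (M : csubspace V) x y : csub_set M x -> csub_set M y -> csub_set M (x + y).
Proof. by move=> Mx My; rewrite -(scale1r x); apply: csub_comb. Qed.

Lemma csubZ (M : csubspace V) a x : csub_set M x -> csub_set M (a *: x).
Proof. by move=> Mx; rewrite -(addr0 (a *: x)); apply: csub_comb => //; exact: csub0. Qed.

Lemma csubB (M : csubspace V) x y : csub_set M x -> csub_set M y -> csub_set M (x - y).
Proof. by move=> Mx My; rewrite addrC -scaleN1r; apply: csub_comb. Qed.

Lemma csub_lspan (M : csubspace V) (S : set V) : S `<=` M -> lspan S `<=` M.
Proof.
move=> SM _ [m [a [s [hs ->]]]]; elim/big_ind: _ => [|x y Mx My|i _].
- exact: csub0.
- exact: csubD.
- by apply/csubZ/SM.
Qed.

Lemma csub_closure (M : csubspace V) (S : set V) : S `<=` M -> closure S `<=` M.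
Proof.
by move=> SM x /(closureS SM); rewrite -(closure_id _).1//; exact: csub_closed.
Qed.

Lemma csub_span (M : csubspace V) (S : set V) :
  S `<=` M -> closure (lspan S) `<=` M.
Proof. by move=> /csub_lspan /csub_closure. Qed.

Lemma csub_near (M : csubspace V) x :
  (forall e : R, 0 < e -> exists2 y, csub_set M y & nrm (x - y) < e) -> csub_set M x.
Proof. by move=> /nrm_closureP; rewrite -(closure_id _).1//; exact: csub_closed. Qed.

End Inner.

(** * Orthogonal projections, the Riesz representation and adjoints *)

Section Projection.
Variables (R : realType) (V : hilbertType R).
Local Notation C := R[i].

(** A near minimum of the distance is nearly orthogonal: moving x along m by
- <x, m> / |m|^2 lowers |x|^2 by |<x, m>|^2 / |m|^2, which is at most eta. *)
Lemma orth_of_min (x m : V) (eta : R) :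
  (forall a : C, nrm x ^+ 2 <= nrm (x + a *: m) ^+ 2 + eta) ->
  cabs (inner x m) ^+ 2 <= nrm m ^+ 2 * eta.
Proof.
move=> h; have [m0|m0] := eqVneq (nrm m) 0.
  by rewrite (nrm_eq0 m0) inner0r /cabs normr0 nrm0 expr0n/= mul0r.
have m2 : 0 < nrm m ^+ 2 by rewrite exprn_gt0// lt_neqAle eq_sym m0 nrm_ge0.
have := h ((- (nrm m ^+ 2)^-1)%:C * inner x m).
rewrite nrmD2 nrmZ exprMn innerZr cabsM Re_conjM cabsC.
set c := cabs _; set N := nrm m ^+ 2; rewrite -/N in m2 * => hh.
rewrite -ler_pdivrMl//.
have e1 : (`|- N^-1| * c) ^+ 2 * N = N^-1 * c ^+ 2.
  rewrite normrN ger0_norm ?invr_ge0 ?ltW// exprMn; field; by rewrite gt_eqF.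
by move: hh; rewrite e1 mulNr mulNrn mulr2n; lra.
Qed.

(** A minimizing sequence in M is Cauchy by the parallelogram law, and its limit
is the projection since its members are nearly orthogonal (orth_of_min). *)
Lemma projection_ex (M : csubspace V) (x : V) :
  exists2 p, csub_set M p & forall m, csub_set M m -> inner (x - p) m = 0.
Proof.
pose D := [set nrm (x - m) ^+ 2 | m in csub_set M].
have D0 : has_inf D.
  split; first by exists (nrm (x - 0) ^+ 2), 0 => //; exact: csub0.
  by exists 0 => _ [m _ <-]; rewrite sqr_ge0.
set d := inf D.
have dle m : csub_set M m -> d <= nrm (x - m) ^+ 2.
  by move=> Mm; apply: ge_inf; [exact: D0.2|exists m].
have ex k : exists m, csub_set M m /\ nrm (x - m) ^+ 2 < d + k.+1%:R^-1.
  have [|_ [m Mm <-] lt] := @inf_adherent _ D k.+1%:R^-1 _ D0.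
    by rewrite invr_gt0.
  by exists m.
have [u hu] := choice ex.
have Mu k : csub_set M (u k) by have [] := hu k.
have ud k : nrm (x - u k) ^+ 2 < d + k.+1%:R^-1 by have [] := hu k.
have uc : forall e : R, 0 < e -> exists N, forall i j,
    (N <= i)%N -> (N <= j)%N -> nrm (u i - u j) < e.
  move=> e e0; have [N hN] := @invr_succ_small R (e ^+ 2 / 4) ltac:(by rewrite divr_gt0// exprn_gt0).
  exists N => i j Ni Nj; rewrite -(@ltr_pXn2r _ 2) ?nnegrE ?nrm_ge0 ?ltW//.
  have := parallelogram (x - u i) (x - u j).
  have -> : x - u i - (x - u j) = u j - u i.
    by rewrite opprD opprK addrC addrACA addrA addNr add0r.
  (* the parallelogram law compares the midpoint of u i and u j with d *)
  have -> : x - u i + (x - u j) = (2 : C) *: (x - (2^-1 : C) *: (u i + u j)).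
    rewrite scalerBr scalerA divff ?pnatr_eq0// scale1r scaler_nat mulr2n opprD.
    by rewrite addrACA.
  rewrite nrmZ exprMn (nrmB (u j)).
  have -> : cabs (2 : C) = 2 :> R.
    have -> : (2 : C) = (2 : R)%:C by rewrite rmorph_nat.
    by rewrite cabsC ger0_norm.
  have := dle (2^-1 *: (u i + u j)) ltac:(by apply/csubZ/csubD).
  have := ud i; have := ud j; have := hN i Ni; have := hN j Nj.
  set c' := nrm (x - _ *: _) ^+ 2.
  have -> : (2 : R) ^+ 2 = 4 by rewrite expr2 -natrM.
  move: (i.+1%:R^-1) (j.+1%:R^-1) (nrm (x - u i)) (nrm (x - u j)).
  move: (nrm (u i - u j)) c' => a c' a' b' p q h1 h2 h3 h4 h5 h6; lra.
have [p up] := seq_cauchy_cvg uc.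
have {}up := (nrm_cvg_seq _ _).1 up.
exists p.
  by apply: csub_near => e e0; have [N hN] := up e e0; exists (u N) => //; exact: hN.
move=> m Mm; apply: cabs_small => e e0.
(* u k0 minimizes up to 1 / (k0 + 1) *)
have k k0 : cabs (inner (x - u k0) m) ^+ 2 <= nrm m ^+ 2 * k0.+1%:R^-1.
  apply: orth_of_min => a.
  have := dle (u k0 - a *: m) ltac:(by apply/csubB/csubZ).
  rewrite opprB addrA (addrAC x) => h; have := ud k0.
  by move: (k0.+1%:R^-1) h => q h h'; lra.
have c0 : 0 < nrm m + 1 by rewrite ltr_wpDl ?nrm_ge0.
set c := nrm m + 1 in c0 *.
have [N hN] := up (e / 2 / c) ltac:(by rewrite !divr_gt0).
have [N' hN'] := @invr_succ_small R ((e / 2 / c) ^+ 2) ltac:(by rewrite exprn_gt0// !divr_gt0).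
set i := maxn N N'.
have -> : inner (x - p) m = inner (x - u i) m + inner (u i - p) m.
  by rewrite -innerDl addrA subrK.
rewrite (le_trans (cabsD _ _))// (splitr e) lerD//.
  rewrite -(@ler_pXn2r _ 2) ?nnegrE ?cabs_ge0 ?divr_ge0 ?(ltW e0)//.
  rewrite (le_trans (k i))//.
  have -> : (e / 2) ^+ 2 = c ^+ 2 * (e / 2 / c) ^+ 2.
    by rewrite -exprMn; congr (_ ^+ 2); field; rewrite gt_eqF.
  rewrite ler_pM ?sqr_ge0 ?invr_ge0//.
    by rewrite ler_pXn2r ?nnegrE ?nrm_ge0 ?(ltW c0)// lerDl.
  by rewrite ltW// hN'// leq_maxr.
rewrite (le_trans (cabs_inner _ _))// nrmB.
have /ltW h := hN i (leq_maxl _ _).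
have h' : nrm (p - u i) * nrm m <= e / 2 / c * c.
  by rewrite ler_pM ?nrm_ge0// lerDl.
by apply: le_trans h' _; rewrite divfK// gt_eqF.
Qed.

Lemma orth_decomp (M : csubspace V) (x : V) :
  exists p q, [/\ csub_set M p, csub_set (orthocompl (csub_set M)) q & x = p + q].
Proof.
have [p Mp h] := projection_ex M x.
by exists p, (x - p); split => //; rewrite addrC subrK.
Qed.

(** The bipolar criterion, in the form in which totality is checked below. *)
Lemma closure_lspanP (S : set V) x :
  (forall y, (forall z, S z -> inner y z = 0) -> inner x y = 0) ->
  closure (lspan S) x.
Proof.
move=> h; have [p Mp hp] := projection_ex (closed_span S) x.
suff -> : x = p by [].
apply/eqP; rewrite -subr_eq0; apply/eqP.
have xp : inner x (x - p) = 0.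
  by apply: h => z Sz; apply: hp; exact: span_incl.
by apply: inner_self_eq0; rewrite innerBl xp inner_conj hp// rmorph0 subrr.
Qed.

(** The representing vector is a multiple of a vector orthogonal to the kernel. *)
Lemma riesz (phi : V -> C) (b : R) : (forall a x y, phi (a *: x + y) = a * phi x + phi y) ->
  (forall x, cabs (phi x) <= b * nrm x) -> exists v, forall x, phi x = inner x v.
Proof.
move=> lin bd.
have phi0 : phi 0 = 0.
  by have := lin 1 0 0; rewrite scaler0 addr0 mul1r => /(canLR (addrK _)); rewrite subrr.
have phiB x y : phi (x - y) = phi x - phi y.
  by rewrite addrC -scaleN1r lin mulN1r addrC.
pose K := [set x | phi x = 0].
have Ksub : submod_closed (mem K).
  split; first by rewrite inE.
  by move=> a x y; rewrite !inE /K /= lin => -> ->; rewrite mulr0 addr0.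
have Kcl : closed K.
  move=> x /nrm_closureP cx; apply: cabs_small => e e0.
  have b1 : 0 < `|b| + 1 by rewrite ltr_wpDl.
  have [y Ky xy] := cx (e / (`|b| + 1)) ltac:(by rewrite divr_gt0).
  rewrite -(subr0 (phi x)) -[X in _ - X]Ky -phiB (le_trans (bd _))//.
  move: xy; rewrite ltr_pdivlMr// => /ltW; apply: le_trans.
  rewrite mulrC ler_wpM2l ?nrm_ge0//; have := ler_norm b; lra.
pose M := CSubspace Ksub Kcl.
have [all0|/existsNP[x hx]] := pselect (forall x, phi x = 0).
  by exists 0 => x; rewrite all0 inner0r.
have [p Mp hp] := projection_ex M x.
set w := x - p in hp.
have pw : phi w = phi x by rewrite /w phiB [phi p]Mp subr0.
have w0 : inner w w != 0.
  apply/eqP => w0; apply: hx; rewrite -pw.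
  by rewrite (inner_self_eq0 w0) phi0.
exists (Num.conj (phi w / inner w w) *: w) => y.
rewrite innerZr conjCK.
have : inner w (phi y *: w - phi w *: y) = 0.
  apply: hp; rewrite /M /K /= -[X in phi X]addrC -scaleNr lin.
  have -> : phi (phi y *: w) = phi y * phi w.
    by rewrite -[_ *: w]addr0 lin phi0 addr0.
  by rewrite mulNr (mulrC (phi w)) addNr.
rewrite innerBr !innerZr => /eqP; rewrite subr_eq0 => /eqP e.
apply: (mulIf w0); rewrite mulrAC divfK//.
have := congr1 Num.conj e; rewrite !rmorphM/= !conjCK -!inner_conj => ->.
by rewrite mulrC.
Qed.

End Projection.

Section Adjoint.
Variable R : realType.
Local Notation C := R[i].

Lemma bop_nrm_le (V W : hilbertType R) (T : bop V W) x : nrm (T x) <= opnorm T * nrm x.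
Proof. by rewrite -lecR rmorphM/= !nrmC opnorm_ub. Qed.

Lemma nrm_bop (V W : hilbertType R) (T : bop V W) : nrm T = opnorm T.
Proof. by []. Qed.

Lemma opnorm_le_nrm (V W : hilbertType R) (T : bop V W) (M : R) : 0 <= M ->
  (forall x, nrm (T x) <= M * nrm x) -> opnorm T <= M.
Proof.
by move=> M0 h; apply: opnorm_le => // x; rewrite -!nrmC -rmorphM lecR.
Qed.

Lemma mk_bop (V W : hilbertType R) (T : V -> W) (M : R) : linear T ->
  (forall x, nrm (T x) <= M * nrm x) -> exists S : bop V W, forall x, S x = T x.
Proof.
move=> lT bT; have h : T \in @bounded_op R V W.
  by rewrite inE; split=> //; exists M => x; rewrite -!nrmC -rmorphM lecR.
by exists (Bop h).
Qed.

Variables V W : hilbertType R.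
Implicit Types (T : bop V W).

Lemma adj_ex T : exists S : bop W V, forall x y, inner (T x) y = inner x (S y).
Proof.
have ex y : exists v, forall x, inner (T x) y = inner x v.
  apply: (@riesz _ _ _ (opnorm T * nrm y)).
    by move=> a x x'; rewrite linearP innerDl innerZl.
  move=> x; rewrite (le_trans (cabs_inner _ _))// mulrAC ler_wpM2r ?nrm_ge0//.
  exact: bop_nrm_le.
have [S hS] := choice ex.
have [|y|S' hS'] := @mk_bop _ _ S (opnorm T).
- move=> a x y; apply: inner_inj => z.
  rewrite (inner_conj z) -hS innerDr innerZr rmorphD rmorphM/= conjCK.
  by rewrite !hS innerDl innerZl -!inner_conj.
- have [->|Sy0] := eqVneq (nrm (S y)) 0; first by rewrite mulr_ge0 ?opnorm_ge0 ?nrm_ge0.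
  have Sy : 0 < nrm (S y) by rewrite lt_neqAle eq_sym Sy0 nrm_ge0.
  rewrite -(ler_pM2l Sy).
  have e : (nrm (S y) * nrm (S y))%:C = inner (T (S y)) y by rewrite hS inner_nrm.
  have : cabs (inner (T (S y)) y) <= nrm (T (S y)) * nrm y by exact: cabs_inner.
  rewrite -e cabsC ger0_norm ?mulr_ge0 ?nrm_ge0// => /le_trans; apply.
  by rewrite mulrA ler_wpM2r ?nrm_ge0// mulrC bop_nrm_le.
- by exists S' => x y; rewrite hS' hS.
Qed.

Lemma adjP T x y : inner (T x) y = inner x (adj T y).
Proof.
have [S hS] := adj_ex T.
exact: (@xgetI _ 0 [set S : bop W V | forall x y, inner (T x) y = inner x (S y)] S hS).
Qed.

Lemma adj_unique T (S : bop W V) :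
  (forall x y, inner (T x) y = inner x (S y)) -> adj T = S.
Proof.
move=> h; apply: bopE => y; apply: inner_inj => z.
by rewrite (inner_conj z) -adjP h -inner_conj.
Qed.

Lemma adjPl T x y : inner (adj T y) x = inner y (T x).
Proof. by rewrite inner_conj -adjP -inner_conj. Qed.

End Adjoint.

(** * Gram matrices and orthonormal bases *)

Section Gram.
Variables (R : realType) (V W : hilbertType R).
Local Notation C := R[i].

(** Polarization: the real part comes from |x + y|^2, the imaginary part from
replacing y by i y. *)
Lemma isometry_inner (U : bop V W) : (forall x, nrm (U x) = nrm x) ->
  forall x y, inner (U x) (U y) = inner x y.
Proof.
move=> h.
have hre x y : complex.Re (inner (U x) (U y)) = complex.Re (inner x y).
  have := nrmD2 (U x) (U y); rewrite -linearD !h nrmD2 => /addrI.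
  by rewrite !mulr2n => e; lra.
move=> x y; have := hre x ((0 +i* 1)%C *: y).
rewrite linearZ/= !innerZr; move: (hre x y).
case: (inner (U x) (U y)) => a b; case: (inner x y) => c d /= -> e.
congr (_ +i* _)%C; move: e.
by rewrite !mul0r !sub0r !mulNr !mul1r !opprK.
Qed.

Lemma inner_comb (I : Type) m m' (a : 'I_m -> C) (a' : 'I_m' -> C)
    (s : 'I_m -> I) (s' : 'I_m' -> I) (v : I -> V) (w : I -> W) :
  (forall i j, inner (v i) (v j) = inner (w i) (w j)) ->
  inner (\sum_i a i *: v (s i)) (\sum_i a' i *: v (s' i)) =
  inner (\sum_i a i *: w (s i)) (\sum_i a' i *: w (s' i)).
Proof.
move=> h; rewrite !inner_suml; apply: eq_bigr => i _.
rewrite !inner_sumr; apply: eq_bigr => j _.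
by rewrite !innerZl !innerZr h.
Qed.

Lemma lspan_rangeP (I : Type) (v : I -> V) x : lspan (range v) x ->
  exists m (a : 'I_m -> C) (s : 'I_m -> I), x = \sum_i a i *: v (s i).
Proof.
move=> [m [a [t [ht ->]]]].
have ex i : exists j, v j = t i by have [j _ <-] := ht i; exists j.
have [s hs] := choice ex.
by exists m, a, s; apply: eq_bigr => i _; rewrite hs.
Qed.

(** On the span of v the map is forced and isometric, because all inner products
of combinations are read off the Gram matrix; it extends by completeness.  The
vector U x is characterized weakly, by its inner products with the total
family w, which makes uniqueness and linearity immediate. *)
Lemma gram_map (I : Type) (v : I -> V) (w : I -> W) :
  (forall i j, inner (v i) (v j) = inner (w i) (w j)) ->
  closure (lspan (range v)) = setT -> closure (lspan (range w)) = setT ->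
  exists U : bop V W, (forall x, nrm (U x) = nrm x) /\
    forall x i, inner (U x) (w i) = inner x (v i).
Proof.
move=> gram tv tw.
have nrm_comb m m' (a : 'I_m -> C) (a' : 'I_m' -> C) (s : 'I_m -> I) (s' : 'I_m' -> I) :
  nrm (\sum_i a i *: v (s i) - \sum_i a' i *: v (s' i)) =
  nrm (\sum_i a i *: w (s i) - \sum_i a' i *: w (s' i)).
  apply/eqP; rewrite -(@eqrXn2 _ 2) ?nrm_ge0//; apply/eqP.
  apply: (@complexI R); rewrite -!inner_nrm !innerBl !innerBr.
  by rewrite !(inner_comb _ _ _ _ gram).
have ex x : exists y, nrm y = nrm x /\ forall i, inner y (w i) = inner x (v i).
  have /nrm_closureP cx : closure (lspan (range v)) x by rewrite tv.
  (* approximate x by combinations of the v i, and carry them to W *)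
  have ex k : exists yz : V * W, nrm (x - yz.1) < k.+1%:R^-1 /\
      exists m (a : 'I_m -> C) (s : 'I_m -> I),
        yz.1 = \sum_i a i *: v (s i) /\ yz.2 = \sum_i a i *: w (s i).
    have [y /lspan_rangeP[m [a [s ->]]] xy] := cx k.+1%:R^-1 ltac:(by rewrite invr_gt0).
    by exists (\sum_i a i *: v (s i), \sum_i a i *: w (s i)); split => //; exists m, a, s.
  have [u hu] := choice ex.
  have u1 k : nrm (x - (u k).1) < k.+1%:R^-1 by have [] := hu k.
  have ud k l : nrm ((u k).1 - (u l).1) = nrm ((u k).2 - (u l).2).
    have [_ [m [a [s [-> ->]]]]] := hu k.
    by have [_ [m' [a' [s' [-> ->]]]]] := hu l.
  have u0 k : nrm (u k).1 = nrm (u k).2.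
    have [_ [m [a [s [-> ->]]]]] := hu k.
    have := nrm_comb m 0 a (fun=> 0) s (fun i => False_rect _ (notF (ltn_ord i))).
    by rewrite !big_ord0 !subr0.
  have uin k i : inner (u k).2 (w i) = inner (u k).1 (v i).
    have [_ [m [a [s [-> ->]]]]] := hu k.
    have := inner_comb a (fun _ : 'I_1 => 1) s (fun=> i) gram.
    by rewrite !big_ord1 !scale1r.
  have uc : forall e : R, 0 < e -> exists N, forall i j,
    (N <= i)%N -> (N <= j)%N -> nrm ((u i).2 - (u j).2) < e.
    move=> e e0; have [N hN] := @invr_succ_small R (e / 2) ltac:(by rewrite divr_gt0).
    exists N => i j Ni Nj; rewrite -ud (le_lt_trans (nrm_triangle x _ _))//.
    have := u1 i; have := u1 j; have := hN i Ni; have := hN j Nj; rewrite nrmB.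
    move: (i.+1%:R^-1) (j.+1%:R^-1) => p q *; lra.
  have [y yP] := seq_cauchy_cvg uc; have {}yP := (nrm_cvg_seq _ _).1 yP.
  (* one index approximates x and y at once *)
  have near e : 0 < e -> exists k, nrm (x - (u k).1) < e /\ nrm (y - (u k).2) < e.
    move=> e0; have [N hN] := invr_succ_small e0; have [N' hN'] := yP e e0.
    exists (maxn N N'); split; last by rewrite hN'// leq_maxr.
    by rewrite (lt_trans (u1 _))// hN// leq_maxl.
  exists y; split.
    apply/eqP; rewrite eq_le; apply/andP; split; apply/ler_addgt0Pl => e e0.
      have [k [h1 h2]] := near (e / 2) ltac:(by rewrite divr_gt0).
      have := nrmD (y - (u k).2) (u k).2; rewrite subrK -u0.
      have := nrmD ((u k).1 - x) x; rewrite subrK nrmB; lra.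
    have [k [h1 h2]] := near (e / 2) ltac:(by rewrite divr_gt0).
    have := nrmD (x - (u k).1) (u k).1; rewrite subrK u0.
    have := nrmD ((u k).2 - y) y; rewrite subrK nrmB; lra.
  move=> i; apply/eqP; rewrite -subr_eq0; apply/eqP/cabs_small => e e0.
  set c := nrm (w i) + nrm (v i) + 1.
  have c0 : 0 < c by rewrite ltr_wpDl ?addr_ge0 ?nrm_ge0.
  have [k [h1 h2]] := near (e / c) ltac:(by rewrite divr_gt0).
  have -> : inner y (w i) - inner x (v i) =
    inner (y - (u k).2) (w i) - inner (x - (u k).1) (v i).
    by rewrite !innerBl uin opprB addrA subrK.
  have := cabs_inner (y - (u k).2) (w i).
  have := cabs_inner (x - (u k).1) (v i).
  have := cabsD (inner (y - (u k).2) (w i)) (- inner (x - (u k).1) (v i)).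
  rewrite [cabs (- _)]/cabs normrN -/(cabs _) => h /= h3 h4.
  rewrite (le_trans h)// (le_trans (lerD h4 h3))//.
  have e1 : e / c * nrm (w i) + e / c * nrm (v i) <= e.
    rewrite -mulrDr mulrAC ler_pdivrMr// ler_pM2l// /c; lra.
  apply: le_trans e1; rewrite lerD// ler_wpM2r ?nrm_ge0// ltW//.
have [U0 hU0] := choice ex.
have [||U hU] := @mk_bop _ _ _ U0 1.
- move=> a x y; apply/eqP; rewrite -subr_eq0; apply/eqP.
  apply: (total_orth tw) => _ [i _ <-].
  by rewrite innerBl innerDl innerZl !(hU0 _).2 innerDl innerZl subrr.
- by move=> x; rewrite mul1r (hU0 x).1.
by exists U; split=> [x|x i]; rewrite hU; have [] := hU0 x.
Qed.

End Gram.

(** The one tool by which unitaries are built here.  Surjectivity comes from the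
map going the other way. *)
Lemma gram_unitary (R : realType) (V W : hilbertType R) (I : Type)
    (v : I -> V) (w : I -> W) :
  (forall i j, inner (v i) (v j) = inner (w i) (w j)) ->
  closure (lspan (range v)) = setT -> closure (lspan (range w)) = setT ->
  exists2 U : bop V W, unitary U & forall i, U (v i) = w i.
Proof.
move=> gram tv tw; have [U [Un Uw]] := gram_map gram tv tw.
have [U' [_ Uv]] := gram_map (fun i j => esym (gram i j)) tw tv.
exists U.
  split; first exact: isometry_inner.
  apply/seteqP; split=> // y _; exists (U' y) => //.
  apply/eqP; rewrite -subr_eq0; apply/eqP/(total_orth tw) => _ [i _ <-].
  by rewrite innerBl Uw Uv subrr.
move=> i; apply/eqP; rewrite -subr_eq0; apply/eqP/(total_orth tw) => _ [j _ <-].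
by rewrite innerBl Uw gram subrr.
Qed.

Section Bases.
Variables (R : realType) (V : hilbertType R).
Local Notation C := R[i].

Definition orthonormal_set (B : set V) :=
  forall x y, B x -> B y -> inner x y = (x == y)%:R.

Lemma orthonormal_nrm (B : set V) x : orthonormal_set B -> B x -> nrm x = 1.
Proof.
move=> oB Bx; have := oB x x Bx Bx; rewrite eqxx inner_nrm => /(congr1 (@complex.Re R)) /= h.
by apply/eqP; rewrite -(@eqrXn2 _ 2) ?nrm_ge0// h expr1n.
Qed.

(** By Zorn's lemma: if a maximal orthonormal subset of M did not span M, the
projection to M of a vector orthogonal to it could be normalized and added. *)
Lemma onb_ex (M : csubspace V) : exists B, basis_of_subspace (csub_set M) B.
Proof.
have [F FP tF|B [[BM oB] maxB]] := @Zorn_bigcup V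
    [set B | B `<=` csub_set M /\ orthonormal_set B].
  split; first by move=> x [B FB Bx]; have [BM _] := FP B FB; exact: BM.
  move=> x y [B FB Bx] [B' FB' By].
  have [h|h] := tF _ _ FB FB'.
    by have [_] := FP B' FB'; apply=> //; exact: h.
  by have [_] := FP B FB; apply=> //; exact: h.
exists B; split => // x Mx; apply: closure_lspanP => y yB; apply: contrapT => xy.
have [p [q [pM qM yE]]] := orth_decomp M y.
have xp : inner x p <> 0.
  by move=> h; apply: xy; rewrite yE innerDr h inner_conj qM// rmorph0 addr0.
have pB z : B z -> inner p z = 0.
  move=> Bz; have := yB z Bz; rewrite yE innerDl qM ?addr0//; exact: BM.
have p0 : nrm p != 0.
  by apply/eqP => h; apply: xp; rewrite (nrm_eq0 h) inner0r.
pose u := (nrm p)^-1%:C *: p.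
have uu : inner u u = 1.
  rewrite inner_nrm nrmZ cabsC ger0_norm ?invr_ge0 ?nrm_ge0//.
  by rewrite mulVf// expr1n.
have uB z : B z -> inner u z = 0 by move=> Bz; rewrite innerZl pB ?mulr0.
apply: (maxB (B `|` [set u])).
  split; first by move=> z Bz; left.
  move=> h; have /uB := h u (or_intror erefl).
  by rewrite uu => /eqP; rewrite oner_eq0.
split; first by move=> z [/BM//|->]; exact: csubZ.
have neq z : B z -> (z == u) = false.
  move=> Bz; apply/eqP => zu; have := uB z Bz; rewrite zu uu => /eqP.
  by rewrite oner_eq0.
move=> z z' [Bz|->] [Bz'|->]; first exact: oB.
- by rewrite inner_conj uB// rmorph0 neq.
- by rewrite uB// eq_sym neq.
- by rewrite eqxx.
Qed.

Lemma bessel_finite (s : seq V) (x : V) :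
  uniq s -> orthonormal_set [set` s] ->
  nrm (x - \sum_(b <- s) inner x b *: b) ^+ 2 =
    nrm x ^+ 2 - (\sum_(b <- s) cabs (inner x b) ^+ 2) /\
  (forall b, b \in s -> inner (x - \sum_(b <- s) inner x b *: b) b = 0).
Proof.
move=> us os; set y := \sum_(b <- s) _.
have yb b : b \in s -> inner y b = inner x b.
  move=> bs; rewrite inner_suml (bigD1_seq b)//= innerZl (os b b)// eqxx mulr1.
  rewrite big_seq_cond big1 ?addr0// => c /andP[cs cb].
  by rewrite innerZl (os c b)// (negPf cb) mulr0.
have h b : b \in s -> inner (x - y) b = 0 by move=> bs; rewrite innerBl yb// subrr.
split=> //; apply: (@complexI R); rewrite rmorphB/= -!inner_nrm.
rewrite innerBr [inner (x - y) y]inner_sumr big_seq big1 ?subr0; last first.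
  by move=> b bs; rewrite innerZr h ?mulr0.
rewrite innerBl; congr (_ - _); rewrite inner_suml rmorph_sum/=.
apply: eq_bigr => b _; rewrite innerZl (inner_conj x b) -normCK rmorphXn/=.
by rewrite RRe_real ?normr_real.
Qed.

Lemma bessel (s : seq V) (x : V) : uniq s -> orthonormal_set [set` s] ->
  \sum_(b <- s) cabs (inner x b) ^+ 2 <= nrm x ^+ 2.
Proof.
move=> us os; have [h _] := bessel_finite x us os.
by rewrite -subr_ge0 -h sqr_ge0.
Qed.

Lemma parseval_finite (s : seq V) (x : V) : uniq s -> orthonormal_set [set` s] ->
  closure (lspan [set` s]) x ->
  \sum_(b <- s) cabs (inner x b) ^+ 2 = nrm x ^+ 2.
Proof.
move=> us os cx; have [h1 h2] := bessel_finite x us os.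
set y := \sum_(b <- s) _ in h1 h2 *; suff xy : x - y = 0.
  by apply/eqP; rewrite eq_sym -subr_eq0 -h1 xy nrm0 expr0n.
have Mx : csub_set (closed_span [set` s]) x by [].
have My : csub_set (closed_span [set` s]) y.
  rewrite /y big_seq; elim/big_ind: _ => [|a b Ma Mb|b bs].
  - exact: csub0.
  - exact: csubD.
  - by apply/csubZ/span_incl.
by apply: inner_self_eq0; apply: (closure_orth h2); exact: (csubB Mx My).
Qed.

(** Evaluate the sum of |<b, c>|^2 over b in s and c in t in two ways: summing
over c first, Parseval gives the size of s; summing over b first, Bessel bounds
it by the size of t. *)
Lemma orthonormal_size (s t : seq V) : uniq s -> uniq t ->
  orthonormal_set [set` s] -> orthonormal_set [set` t] ->
  [set` s] `<=` closure (lspan [set` t]) -> (size s <= size t)%N.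
Proof.
move=> us ut os ot st; rewrite -(ler_nat R).
have -> : (size s)%:R = \sum_(b <- s) \sum_(c <- t) cabs (inner b c) ^+ 2 :> R.
  rewrite -[size s]count_predT -sum1_count natr_sum big_seq [RHS]big_seq.
  apply: eq_bigr => b bs; rewrite parseval_finite//; last exact: st.
  by rewrite (orthonormal_nrm os) ?expr1n.
rewrite exchange_big/= -[size t]count_predT -sum1_count natr_sum big_seq [leRHS]big_seq.
apply: ler_sum => c ct.
rewrite (_ : \sum_(b <- s) _ = \sum_(b <- s) cabs (inner c b) ^+ 2); last first.
  by apply: eq_bigr => b _; rewrite (inner_conj c b) /cabs norm_conjC.
by rewrite (le_trans (bessel c us os))// (orthonormal_nrm ot)// expr1n.
Qed.

(** Distinct orthonormal vectors are at distance sqrt 2, so that points of a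
countable dense set at distance less than 1/2 from them are distinct. *)
Lemma orthonormal_countable (B : set V) : separable V -> orthonormal_set B ->
  countable B.
Proof.
move=> [D [/countable_injP[g gi] dD]] oB.
have ex x : exists d, D d /\ nrm (x - d) < 2^-1.
  have [||d [+ Dd]] := dD (ball x (2^-1 : R)%:C).
  - by exists x; apply: ballxx; rewrite ltcR invr_gt0.
  - by apply: ball_open; rewrite ltcR invr_gt0.
  - by rewrite -ball_normE/= -nrmC ltcR => xd; exists d.
have [f hf] := choice ex.
apply/countable_injP; exists (g \o f) => x y /set_mem Bx /set_mem By /= e.
have {}e : f x = f y.
  by apply: gi => //; apply: mem_set; have [] := hf x; have [] := hf y.
apply/eqP; apply: contraT => xy.
have xy1 : nrm (x - y) < 1.
  rewrite (le_lt_trans (nrm_triangle (f x) _ _))// (splitr 1) div1r ltrD//.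
    by have [] := hf x.
  by rewrite e nrmB; have [] := hf y.
have := nrmD2_orth (x := x) (y := - y).
rewrite innerNr (oB x y)// (negPf xy) oppr0 nrmN (orthonormal_nrm oB Bx) (orthonormal_nrm oB By) => /(_ erefl).
have : nrm (x - y) ^+ 2 < 1 by rewrite expr_lt1 ?nrm_ge0.
by move=> + e1; rewrite e1 expr1n; lra.
Qed.

(** An infinite basis has the cardinality of the natural numbers by separability;
a finite one bounds the size of every finite orthonormal set. *)
Lemma basis_card_le (M B B' : set V) : separable V ->
  basis_of_subspace M B -> basis_of_subspace M B' -> (B #<= B')%card.
Proof.
move=> sV [BM oB MB] [B'M oB' MB'].
have [fB'|iB'] := pselect (finite_set B'); last first.
  apply: card_le_trans (orthonormal_countable sV oB) _.
  exact/infiniteP.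
have [X XE] := (finite_fsetP.1 fB').
have le (Y : {fset V}) : [set` Y] `<=` B -> (#|` Y| <= #|` X|)%N.
  move=> YB; apply: orthonormal_size; rewrite ?fset_uniq//.
  - by move=> x y /YB Bx /YB By; exact: oB.
  - by have <- : B' = [set` enum_fset X] by [].
  - have <- : B' = [set` enum_fset X] by [].
    by move=> y /YB /BM /MB'.
have fB : finite_set B.
  apply: contrapT => iB; have [Y YB] := infinite_set_fset #|` X|.+1 iB.
  by rewrite ltnNge le.
have [Y YE] := (finite_fsetP.1 fB).
have cY : ([set` Y] #= `I_(#|` Y|))%card by exact/card_eq_fsetP.
have cX : ([set` X] #= `I_(#|` X|))%card by exact/card_eq_fsetP.
by rewrite YE XE (card_le_eql cY) (card_le_eqr cX) card_le_II; apply: le; rewrite YE.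
Qed.

Lemma basis_card_eq (M B B' : set V) : separable V ->
  basis_of_subspace M B -> basis_of_subspace M B' -> (B #= B')%card.
Proof. by move=> sV hB hB'; rewrite card_eq_le !(@basis_card_le M). Qed.

End Bases.
Section OrthonormalBasis.
Variables (R : realType) (V : hilbertType R) (I : eqType) (e : I -> V).
Hypothesis e_basis : orthonormal_basis e.

Lemma onb_orth a b : inner (e a) (e b) = (a == b)%:R.
Proof. by case: e_basis. Qed.

Lemma onb_total : closure (lspan (range e)) = setT.
Proof. by case: e_basis. Qed.

Lemma onb_nrm a : nrm (e a) = 1.
Proof.
have := inner_nrm (e a); rewrite onb_orth eqxx => /(congr1 (@complex.Re R)) /= h.
by apply/eqP; rewrite -(@eqrXn2 _ 2) ?nrm_ge0// -h expr1n.
Qed.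

End OrthonormalBasis.

(** * Closed operator algebras and their representations *)

Section BopAlgebra.
Variable R : realType.
Local Notation C := R[i].

Lemma bop_compE (U V W : hilbertType R) (S : bop V W) (T : bop U V) x :
  bop_comp S T x = S (T x).
Proof. by []. Qed.

Lemma bopDE (V W : hilbertType R) (S T : bop V W) x : (S + T) x = S x + T x.
Proof. by []. Qed.

Lemma bopZE (V W : hilbertType R) a (T : bop V W) x : (a *: T) x = a *: T x.
Proof. by []. Qed.

Lemma bopBE (V W : hilbertType R) (S T : bop V W) x : (S - T) x = S x - T x.
Proof. by []. Qed.

Lemma bop0E (V W : hilbertType R) x : (0 : bop V W) x = 0.
Proof. by []. Qed.

Lemma bop_sumE (V W : hilbertType R) I (r : seq I) (P : pred I) (F : I -> bop V W) x :
  (\sum_(i <- r | P i) F i) x = \sum_(i <- r | P i) F i x.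
Proof. by elim/big_rec2: _ => [//|i a T _ <-]; rewrite bopDE. Qed.

Lemma opnorm_comp (U V W : hilbertType R) (S : bop V W) (T : bop U V) :
  opnorm (bop_comp S T) <= opnorm S * opnorm T.
Proof.
apply: opnorm_le_nrm; first by rewrite mulr_ge0 ?opnorm_ge0.
move=> x; rewrite bop_compE (le_trans (bop_nrm_le _ _))// -mulrA.
by rewrite ler_wpM2l ?opnorm_ge0// bop_nrm_le.
Qed.

Lemma opnorm_adj (V W : hilbertType R) (T : bop V W) : opnorm (adj T) <= opnorm T.
Proof.
apply: opnorm_le_nrm => [|y]; first exact: opnorm_ge0.
have [->|Sy0] := eqVneq (nrm (adj T y)) 0; first by rewrite mulr_ge0 ?opnorm_ge0 ?nrm_ge0.
have Sy : 0 < nrm (adj T y) by rewrite lt_neqAle eq_sym Sy0 nrm_ge0.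
rewrite -(ler_pM2l Sy).
have e : (nrm (adj T y) * nrm (adj T y))%:C = inner (T (adj T y)) y.
  by rewrite adjP inner_nrm.
have : cabs (inner (T (adj T y)) y) <= nrm (T (adj T y)) * nrm y by exact: cabs_inner.
rewrite -e cabsC ger0_norm ?mulr_ge0 ?nrm_ge0// => /le_trans; apply.
by rewrite mulrA ler_wpM2r ?nrm_ge0// mulrC bop_nrm_le.
Qed.

Lemma adjK (V W : hilbertType R) (T : bop V W) : adj (adj T) = T.
Proof. by apply: adj_unique => x y; rewrite adjPl. Qed.

Lemma adj_comb (V W : hilbertType R) a (S T : bop V W) :
  adj (a *: S + T) = Num.conj a *: adj S + adj T.
Proof.
apply: adj_unique => x y.
by rewrite bopDE bopZE innerDl innerZl !adjP innerDr innerZr conjCK.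
Qed.

Lemma adjD (V W : hilbertType R) (S T : bop V W) : adj (S + T) = adj S + adj T.
Proof. by have := adj_comb 1 S T; rewrite rmorph1 !scale1r. Qed.

Lemma adj0 (V W : hilbertType R) : adj (0 : bop V W) = 0.
Proof. by apply: adj_unique => x y; rewrite !bop0E inner0l inner0r. Qed.

Lemma adjZ (V W : hilbertType R) a (S : bop V W) : adj (a *: S) = Num.conj a *: adj S.
Proof. by rewrite -[a *: S]addr0 adj_comb adj0 addr0. Qed.

Lemma adjB (V W : hilbertType R) (S T : bop V W) : adj (S - T) = adj S - adj T.
Proof. by rewrite adjD -scaleN1r adjZ rmorphN rmorph1 scaleN1r. Qed.

Lemma adj_comp (U V W : hilbertType R) (S : bop V W) (T : bop U V) :
  adj (bop_comp S T) = bop_comp (adj T) (adj S).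
Proof. by apply: adj_unique => x y; rewrite !bop_compE !adjP. Qed.

Lemma adj_id (V : hilbertType R) : adj (bop_id V) = bop_id V.
Proof. by apply: adj_unique. Qed.

Lemma geometric_cauchy (V : normedModType C) (u : nat -> V) (c q : R) :
  0 <= c -> 0 <= q -> q < 1 -> (forall k, nrm (u k.+1 - u k) <= c * q ^+ k) ->
  forall e : R, 0 < e -> exists N, forall i j, (N <= i)%N -> (N <= j)%N ->
    nrm (u i - u j) < e.
Proof.
move=> c0 q0 q1 hu e e0; have q1' : 0 < 1 - q by rewrite subr_gt0.
have h k m : nrm (u (k + m)%N - u k) <= c * q ^+ k / (1 - q) * (1 - q ^+ m).
  elim: m => [|m IH]; first by rewrite addn0 !subrr nrm0 mulr0.
  rewrite addnS (le_trans (nrm_triangle (u (k + m)%N) _ _))//.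
  have -> : c * q ^+ k / (1 - q) * (1 - q ^+ m.+1) =
    c * q ^+ (k + m) + c * q ^+ k / (1 - q) * (1 - q ^+ m).
    by rewrite exprD exprS; field; rewrite gt_eqF.
  by rewrite lerD.
have h' k m : nrm (u (k + m)%N - u k) <= c * q ^+ k / (1 - q).
  rewrite (le_trans (h k m))// ler_piMr ?divr_ge0 ?mulr_ge0 ?exprn_ge0 ?(ltW q1')//.
  by rewrite lerBlDr lerDl exprn_ge0.
have qcvg : (fun k => q ^+ k) @ \oo --> (0 : R) by apply: cvg_expr; rewrite ger0_norm.
have c1 : 0 < c + 1 by rewrite ltr_wpDl.
have e' : 0 < e / 2 * (1 - q) / (c + 1) by rewrite !mulr_gt0 ?invr_gt0.
have /cvgrPdist_lt /(_ _ e') [N _ hN] := qcvg.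
have {}hN : c * q ^+ N / (1 - q) < e / 2.
  rewrite ltr_pdivrMr//; have := hN N (leqnn N).
  rewrite /= sub0r normrN ger0_norm ?exprn_ge0// ltr_pdivlMr//.
  have := exprn_ge0 N q0; move: (q ^+ N) => x x0; rewrite mulrDr mulr1 (mulrC x).
  by lra.
exists N => i j Ni Nj; rewrite (le_lt_trans (nrm_triangle (u N) _ _))//.
rewrite -(subnKC Ni) -(subnKC Nj) (nrmB (u N)).
have := h' N (i - N)%N; have := h' N (j - N)%N; lra.
Qed.

Lemma nrm_le_lim (V : normedModType C) (x : V) (b : R) :
  (forall e : R, 0 < e -> exists y, nrm y <= b /\ nrm (x - y) < e) -> nrm x <= b.
Proof.
move=> h; apply/ler_addgt0Pl => e e0; have [y [yb xy]] := h e e0.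
by have := nrmD (x - y) y; rewrite subrK; lra.
Qed.

Lemma bop_complete (V W : hilbertType R) (u : nat -> bop V W) :
  (forall e : R, 0 < e -> exists N, forall i j, (N <= i)%N -> (N <= j)%N ->
    nrm (u i - u j) < e) -> exists T : bop V W, u i @[i --> \oo] --> T.
Proof.
move=> cu.
have ex x : exists l : W, (u i x) @[i --> \oo] --> l.
  apply: seq_cauchy_cvg => e e0.
  have c0 : 0 < nrm x + 1 by rewrite ltr_wpDl ?nrm_ge0.
  have [N hN] := cu (e / (nrm x + 1)) ltac:(by rewrite divr_gt0).
  exists N => i j Ni Nj; rewrite -bopBE (le_lt_trans (bop_nrm_le _ _))//.
  have := hN i j Ni Nj; rewrite nrm_bop ltr_pdivlMr//; apply: le_lt_trans.
  by rewrite ler_wpM2l ?opnorm_ge0// lerDl.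
have [T0 hT0] := choice ex.
have T0P x e : 0 < e -> exists N, forall i, (N <= i)%N -> nrm (T0 x - u i x) < e.
  by move=> e0; have := (nrm_cvg_seq _ _).1 (hT0 x) e e0.
have unif e : 0 < e -> exists N, forall i x, (N <= i)%N -> nrm (T0 x - u i x) <= e * nrm x.
  move=> e0; have [N hN] := cu e e0; exists N => i x Ni.
  apply: nrm_le_lim => e' e'0; have [N' hN'] := T0P x e' e'0.
  exists (u (maxn N N') x - u i x); split; last first.
    by rewrite opprB addrA subrK hN'// leq_maxr.
  rewrite -bopBE (le_trans (bop_nrm_le _ _))// ler_wpM2r ?nrm_ge0// -nrm_bop ltW//.
  by rewrite hN// leq_maxl.
have lT : linear T0.
  move=> a x y; apply: (cvg_seq_unique (hT0 (a *: x + y))).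
  rewrite (_ : (fun i => u i (a *: x + y)) = (fun i => a *: u i x + u i y)).
    by apply: cvgD; [apply: cvgZl_tmp|]; exact: hT0.
  by apply/funext => i; rewrite linearP.
have [N hN] := unif 1 ltac:(by []).
have [|T hT] := @mk_bop _ _ _ T0 (1 + opnorm (u N)) lT.
  move=> x; have := nrmD (T0 x - u N x) (u N x); rewrite subrK.
  by have := hN N x (leqnn N); have := bop_nrm_le (u N) x; lra.
exists T; apply/nrm_cvg_seq => e e0.
have [N' hN'] := unif (e / 2) ltac:(by rewrite divr_gt0).
exists N' => i Ni; rewrite nrm_bop (@le_lt_trans _ _ (e / 2))//; last by lra.
apply: opnorm_le_nrm => [|x]; first by lra.
by rewrite bopBE hT hN'.
Qed.

Lemma bop_comp_cvg (V : hilbertType R) (u v : nat -> bop V V) S T :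
  u @ \oo --> S -> v @ \oo --> T ->
  bop_comp (u i) (v i) @[i --> \oo] --> bop_comp S T.
Proof.
move=> /nrm_cvg_seq hu /nrm_cvg_seq hv; apply/nrm_cvg_seq => e e0.
have s0 : 0 < opnorm S + opnorm T + 2.
  by rewrite ltr_wpDl// addr_ge0// opnorm_ge0.
set c := opnorm S + opnorm T + 2 in s0.
have d0 : 0 < Num.min 1 (e / c) by rewrite lt_min ltr01 divr_gt0.
have [N hN] := hu _ d0; have [N' hN'] := hv _ d0.
exists (maxn N N') => i; rewrite geq_max => /andP[/hN + /hN'].
rewrite !nrm_bop !lt_min => /andP[a1 a2] /andP[b1 b2].
have -> : bop_comp S T - bop_comp (u i) (v i) =
    bop_comp (S - u i) T + bop_comp (u i) (T - v i).
  apply: bopE => x; rewrite [RHS]bopDE bopBE !bop_compE bopBE linearB/=.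
  by rewrite addrA subrK.
rewrite -nrm_bop (le_lt_trans (nrmD _ _))// !nrm_bop.
have ui : opnorm (u i) <= opnorm S + 1.
  have := nrmD (u i - S) S; rewrite subrK nrmB !nrm_bop; lra.
rewrite (le_lt_trans (lerD (opnorm_comp _ _) (opnorm_comp _ _)))//.
have h1 : opnorm (S - u i) * opnorm T <= e / c * opnorm T.
  by rewrite ler_wpM2r ?opnorm_ge0// ltW.
have h2 : opnorm (u i) * opnorm (T - v i) <= (opnorm S + 1) * (e / c).
  by rewrite ler_pM ?opnorm_ge0// ltW.
have ec : 0 < e / c by rewrite divr_gt0.
have e1 : e = e / c * c by rewrite divfK// gt_eqF.
rewrite (le_lt_trans (lerD h1 h2))// [ltRHS]e1 /c.
rewrite -/c (mulrC (opnorm S + 1)) -mulrDr ltr_pM2l// /c; lra.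
Qed.

Lemma adj_cvg (V : hilbertType R) (u : nat -> bop V V) S :
  u @ \oo --> S -> adj (u i) @[i --> \oo] --> adj S.
Proof.
move=> /nrm_cvg_seq hu; apply/nrm_cvg_seq => e e0; have [N hN] := hu e e0.
exists N => i Ni; rewrite -adjB (le_lt_trans (opnorm_adj _))//; exact: hN.
Qed.

End BopAlgebra.

(** Adjoints are left out because the operators that preserve a given closed
subspace form such an algebra; see model_cyclic. *)
Definition closed_subalgebra (R : realType) (V : hilbertType R)
    (A : set (bop V V)) : Prop :=
  [/\ A (bop_id V),
      forall (a : R[i]) X Y, A X -> A Y -> A (a *: X + Y),
      forall X Y, A X -> A Y -> A (bop_comp X Y) &
      closed A].

Lemma cstar_closed_subalgebra (R : realType) (V : hilbertType R)
  (A : set (bop V V)) : cstar_subalgebra A -> closed_subalgebra A.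
Proof. by case. Qed.
Coercion cstar_closed_subalgebra : cstar_subalgebra >-> closed_subalgebra.

Section ClosedSubalgebra.
Variables (R : realType) (V : hilbertType R) (A : set (bop V V)).
Local Notation C := R[i].
Hypothesis hA : closed_subalgebra A.

Lemma alg_id : A (bop_id V). Proof. by case: hA. Qed.
Lemma alg_comb a X Y : A X -> A Y -> A (a *: X + Y).
Proof. by case: hA => _ h _ _; exact: h. Qed.
Lemma alg_comp X Y : A X -> A Y -> A (bop_comp X Y).
Proof. by case: hA => _ _ h _; exact: h. Qed.
Lemma alg_closed : closed A. Proof. by case: hA. Qed.

Lemma alg0 : A 0.
Proof. by have := alg_comb (-1) alg_id alg_id; rewrite scaleN1r addNr. Qed.
Lemma algD X Y : A X -> A Y -> A (X + Y).
Proof. by move=> AX AY; have := alg_comb 1 AX AY; rewrite scale1r. Qed.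
Lemma algZ a X : A X -> A (a *: X).
Proof. by move=> AX; have := alg_comb a AX alg0; rewrite addr0. Qed.
Lemma algB X Y : A X -> A Y -> A (X - Y).
Proof. by move=> AX AY; have := alg_comb (-1) AY AX; rewrite scaleN1r addrC. Qed.
Lemma alg_sum I (r : seq I) (P : pred I) (F : I -> bop V V) :
  (forall i, A (F i)) -> A (\sum_(i <- r | P i) F i).
Proof.
by move=> h; elim/big_ind: _ => [|X Y|i _]; [exact: alg0|exact: algD|exact: h].
Qed.

Lemma alg_near X : (forall e : R, 0 < e -> exists2 Y, A Y & nrm (X - Y) < e) -> A X.
Proof. by move=> /nrm_closureP; rewrite -(closure_id _).1//; exact: alg_closed. Qed.

Lemma alg_cvg (u : nat -> bop V V) X : u @ \oo --> X -> (forall i, A (u i)) -> A X.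
Proof.
move=> /nrm_cvg_seq h Au; apply: alg_near => e e0; have [N hN] := h e e0.
by exists (u N) => //; exact: hN.
Qed.

(** With Z = 1 - Y, the equation Z^2 = 1 - B says that Y is a fixed point of
Y |-> (B + Y^2) / 2, which contracts the ball of radius q by the factor q.  The
iterates from 0 are self-adjoint elements of the algebra. *)
Lemma alg_sqrt B (q : R) : A B -> adj B = B -> opnorm B <= q -> q < 1 ->
  exists Z, [/\ A Z, adj Z = Z & bop_comp Z Z = bop_id V - B].
Proof.
move=> AB Bs Bq q1; have q0 : 0 <= q by exact: le_trans (opnorm_ge0 B) Bq.
pose F (Y : bop V V) := (2^-1 : C) *: (B + bop_comp Y Y).
pose u k := iter k F 0.
have c2 : cabs (2^-1 : C) = 2^-1 :> R.
  have -> : (2^-1 : C) = (2^-1 : R)%:C by rewrite fmorphV rmorph_nat.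
  by rewrite cabsC ger0_norm.
have uA k : A (u k) by elim: k => [|k IH]; [exact: alg0|apply/algZ/algD/alg_comp].
have us k : adj (u k) = u k.
  elim: k => [|k IH]; first exact: adj0.
  rewrite /= adjZ adjD adj_comp IH Bs; congr (_ *: _).
  by rewrite conj_Creal// rpredV realn.
have uq k : opnorm (u k) <= q.
  elim: k => [|k IH]; first by rewrite -nrm_bop nrm0.
  rewrite /= -nrm_bop nrmZ c2; have := nrmD B (bop_comp (u k) (u k)).
  have := opnorm_comp (u k) (u k); rewrite !nrm_bop.
  have : opnorm (u k) * opnorm (u k) <= q * 1.
    by rewrite ler_pM ?opnorm_ge0// (le_trans IH)// ltW.
  by rewrite -!/(u _) => *; lra.
have FB S T : F S - F T = (2^-1 : C) *: (bop_comp S (S - T) + bop_comp (S - T) T).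
  rewrite /F -scalerBr; congr (_ *: _); rewrite opprD addrACA subrr add0r.
  apply: bopE => x; rewrite [RHS]bopDE bopBE !bop_compE bopBE linearB/=.
  by rewrite addrA subrK.
have ucon k : nrm (u k.+1 - u k) <= 1 * q ^+ k.
  rewrite mul1r.
  elim: k => [|k IH].
    by rewrite expr0 subr0 nrm_bop (le_trans (uq 1%N))// ltW.
  rewrite [u k.+2]/(F (u k.+1)) [X in _ - X]/(F (u k)) FB nrmZ c2.
  set d := u k.+1 - u k in IH *.
  have := nrmD (bop_comp (u k.+1) d) (bop_comp d (u k)).
  have := opnorm_comp (u k.+1) d; have := opnorm_comp d (u k).
  rewrite nrm_bop in IH; rewrite exprS !nrm_bop.
  have : opnorm (u k.+1) * opnorm d <= q * q ^+ k.
    by rewrite ler_pM ?opnorm_ge0.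
  have : opnorm d * opnorm (u k) <= q ^+ k * q.
    by rewrite ler_pM ?opnorm_ge0.
  by rewrite (mulrC (q ^+ k)) => *; lra.
have [Y hY] := bop_complete (geometric_cauchy ler01 q0 q1 ucon).
have AY : A Y by apply: alg_cvg hY uA.
have Ys : adj Y = Y.
  apply: (cvg_seq_unique _ hY); apply: cvg_trans (adj_cvg hY).
  by apply: near_eq_cvg; apply: nearW => i; rewrite us.
have YF : Y = F Y.
  have h : F (u i) @[i --> \oo] --> F Y.
    apply: (cvgZl_tmp (k := (2^-1 : C))); apply: cvgD; first exact: cvg_cst.
    exact: bop_comp_cvg.
  apply: (cvg_seq_unique _ h); have := hY; rewrite -(cvg_shiftS u); exact: cvg_trans.
exists (bop_id V - Y); split.
- exact/algB/AY/alg_id.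
- by rewrite adjB adj_id Ys.
have YY : bop_comp Y Y = Y + Y - B.
  rewrite -mulr2n -scaler_nat [X in 2 *: X]YF /F scalerA divff ?pnatr_eq0//.
  by rewrite scale1r addrC addKr.
apply: bopE => x; have := congr1 (fun T : bop V V => T x) YY.
rewrite bopBE bopDE !bop_compE !bopBE [Y (x - _)]linearB/= => ->.
by rewrite opprB (addrAC (Y x + Y x)) addrK addrA subrK.
Qed.

End ClosedSubalgebra.

Lemma cstar_adj (R : realType) (V : hilbertType R) (A : set (bop V V)) X :
  cstar_subalgebra A -> A X -> A (adj X).
Proof. by move=> [_ _ _ h _]; exact: h. Qed.

Section Representation.
Variables (R : realType) (V : hilbertType R) (A : set (bop V V)).
Local Notation C := R[i].
Hypothesis hA : cstar_subalgebra A.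
Variables (K : hilbertType R) (pi : bop V V -> bop K K).
Hypothesis hpi : star_rep A pi.

Lemma repZD a X Y : A X -> A Y -> pi (a *: X + Y) = a *: pi X + pi Y.
Proof. by case: hpi => h _ _; exact: h. Qed.
Lemma repM X Y : A X -> A Y -> pi (bop_comp X Y) = bop_comp (pi X) (pi Y).
Proof. by case: hpi => _ h _; exact: h. Qed.
Lemma rep_adj X : A X -> pi (adj X) = adj (pi X).
Proof. by case: hpi => _ _ h; exact: h. Qed.
Lemma repD X Y : A X -> A Y -> pi (X + Y) = pi X + pi Y.
Proof. by move=> AX AY; have := repZD 1 AX AY; rewrite !scale1r. Qed.
Lemma rep0 : pi 0 = 0.
Proof.
have := repZD (-1) (alg0 hA) (alg0 hA).
by rewrite scaler0 addr0 scaleN1r addNr.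
Qed.
Lemma repZ a X : A X -> pi (a *: X) = a *: pi X.
Proof. by move=> AX; have := repZD a AX (alg0 hA); rewrite rep0 !addr0. Qed.
Lemma repB X Y : A X -> A Y -> pi (X - Y) = pi X - pi Y.
Proof. by move=> AX AY; have := repZD (-1) AY AX; rewrite !scaleN1r !(addrC (- _)). Qed.
Lemma rep_sum I (r : seq I) (P : pred I) (F : I -> bop V V) :
  (forall i, A (F i)) -> pi (\sum_(i <- r | P i) F i) = \sum_(i <- r | P i) pi (F i).
Proof.
move=> h; suff [] : A (\sum_(i <- r | P i) F i) /\
  pi (\sum_(i <- r | P i) F i) = \sum_(i <- r | P i) pi (F i) by [].
elim/big_rec2: _ => [|i T S _ [AT <-]]; first by split; [exact: (alg0 hA)|exact: rep0].
by split; [exact: (algD hA)|exact: repD].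
Qed.

Hypothesis pi1 : pi (bop_id V) = bop_id K.

(** If |X| < 1 then 1 - adj X X = Z^2 with Z self-adjoint in A, and applying pi
gives |k|^2 - |pi(X) k|^2 = |pi(Z) k|^2 >= 0. *)
Lemma rep_contractive X : A X -> opnorm (pi X) <= opnorm X.
Proof.
move=> AX; apply/ler_addgt0Pl => e e0; set r := e + opnorm X.
have r0 : 0 < r by rewrite ltr_wpDr ?opnorm_ge0.
apply: opnorm_le_nrm => [|k]; first exact: ltW.
pose X' := r^-1%:C *: X; have AX' : A X' by exact: (algZ hA).
have X'1 : opnorm X' < 1.
  rewrite -nrm_bop nrmZ cabsC ger0_norm ?invr_ge0 ?(ltW r0)// mulrC ltr_pdivrMr// mul1r.
  by rewrite nrm_bop /r ltrDr.
pose B := bop_comp (adj X') X'; have AB : A B by apply: (alg_comp hA) => //; exact: (cstar_adj hA).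
have [||Z [AZ Zs ZZ]] := alg_sqrt hA (B := B) (q := opnorm X') AB _ _ X'1.
- by rewrite /B adj_comp adjK.
- rewrite (le_trans (opnorm_comp _ _))// -[leRHS]mul1r ler_wpM2r ?opnorm_ge0//.
  by rewrite (le_trans (opnorm_adj _))// ltW.
suff h : nrm (pi X' k) <= nrm k.
  have -> : pi X = r%:C *: pi X'.
    by rewrite repZ// scalerA -rmorphM/= divff ?gt_eqF// scale1r.
  by rewrite bopZE nrmZ cabsC ger0_norm ?(ltW r0)// ler_wpM2l// ltW.
rewrite -(@ler_pXn2r _ 2) ?nnegrE ?nrm_ge0// -subr_ge0.
have -> : nrm k ^+ 2 - nrm (pi X' k) ^+ 2 = nrm (pi Z k) ^+ 2; last exact: sqr_ge0.
apply: (@complexI R); rewrite rmorphB/= -!inner_nrm.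
rewrite [RHS]adjP -rep_adj// Zs -bop_compE -repM// ZZ repB//; last exact: (alg_id hA).
rewrite pi1 bopBE innerBr; congr (_ - _).
by rewrite adjP -rep_adj// -bop_compE -repM//; exact: (cstar_adj hA).
Qed.

Lemma rep_cvg (I : Type) (F : set_system I) (FF : Filter F) (u : I -> bop V V) X :
  A X -> (\forall i \near F, A (u i)) -> u i @[i --> F] --> X ->
  pi (u i) @[i --> F] --> pi X.
Proof.
move=> AX Au /nrm_cvg h; apply/nrm_cvg => e e0.
apply: filterS2 Au (h e e0) => i Ai; rewrite -repB//; apply: le_lt_trans.
by rewrite !nrm_bop rep_contractive//; exact: (algB hA).
Qed.

End Representation.

(** * Values of a power series at a tuple of operators *)

Section Abel.
Variable R : realType.
Local Notation C := R[i].

Lemma near_left1P (P : R -> Prop) :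
  (\forall r \near 1^'-, P r) <-> exists2 d : R, 0 < d < 1 & forall r, d < r < 1 -> P r.
Proof.
split.
  move=> [e /= e0 he]; exists (Num.max 2^-1 (1 - e)).
    by rewrite lt_max invr_gt0 ltr0n/= gt_max invf_lt1 ?ltr1n//= gtrBl e0.
  move=> r /andP[+ r1]; rewrite gt_max => /andP[_ er].
  apply: he => //=; rewrite ger0_norm ?subr_ge0 ?ltW//; lra.
move=> [d /andP[d0 d1] h]; exists (1 - d) => /=; first by rewrite subr_gt0.
move=> r /= rd r1; apply: h; rewrite r1 andbT.
move: rd; rewrite ger0_norm ?subr_ge0 ?ltW//; lra.
Qed.

(** Abel's theorem in a normed space.  Summation by parts expresses the error at
r through the errors D of the partial sums, with weights r^k (1 - r) of total
mass at most 1. *)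
Lemma abel (E : normedModType C) (a : nat -> E) (L : E) (g : R -> E) (d : R) :
  0 < d < 1 -> (\sum_(k < N) a k) @[N --> \oo] --> L ->
  (forall r : R, d < r < 1 ->
     (\sum_(k < N) (r ^+ k)%:C *: a k) @[N --> \oo] --> g r) ->
  g r @[r --> 1^'-] --> L.
Proof.
move=> /andP[d0 d1] /nrm_cvg_seq sL hg; apply/nrm_cvg => e e0.
pose D N := \sum_(k < N) a k - L.
have e4 : 0 < e / 4 by rewrite divr_gt0.
have [M hM] := sL _ e4.
pose c := \sum_(k < M) nrm (D k.+1).
have c0 : 0 <= c by apply: sumr_ge0 => k _; exact: nrm_ge0.
apply/near_left1P; pose d' := 1 - e / 4 / (c + 1).
have c1 : 0 < c + 1 by rewrite ltr_wpDl.
exists (Num.max d d').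
  by rewrite lt_max d0/= gt_max d1/= gtrBl divr_gt0.
move=> r /andP[]; rewrite gt_max => /andP[dr d'r] r1.
have r0 : 0 < r by exact: lt_trans dr.
(* summation by parts; D 0 = - L accounts for the limit on the left *)
have Abs N : \sum_(k < N) (r ^+ k)%:C *: a k - L =
    (r ^+ N)%:C *: D N + \sum_(k < N) (r ^+ k * (1 - r))%:C *: D k.+1.
  elim: N => [|N IH]; first by rewrite /D !big_ord0 addr0 expr0 scale1r.
  rewrite !big_ord_recr/= addrAC IH.
  have -> : a N = D N.+1 - D N.
    by rewrite /D big_ord_recr/= opprB addrA subrK addrAC subrr add0r.
  rewrite mulrBr mulr1 rmorphB/= scalerBl -exprSr [_ *: (D _ - D _)]scalerBr.
  by rewrite (addrC ((r ^+ N)%:C *: D N)) -addrA subrKC [RHS]addrCA subrKC.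
have DM k : (M <= k)%N -> nrm (D k) < e / 4 by move=> Mk; rewrite nrmB; exact: hM.
(* the first M weights are small since r is close to 1, and the others
   add up to at most r ^ M *)
have bound m : \sum_(k < M + m) r ^+ k * (1 - r) * nrm (D k.+1) <=
    (1 - r) * c + e / 4 * (r ^+ M - r ^+ (M + m)).
  elim: m => [|m IH].
    rewrite addn0 subrr mulr0 addr0 /c mulr_sumr; apply: ler_sum => k _.
    rewrite ler_wpM2r ?nrm_ge0// ler_piMl ?subr_ge0 ?(ltW r1)//.
    by rewrite exprn_ile1// ltW.
  rewrite addnS big_ord_recr/=.
  have : r ^+ (M + m) * (1 - r) * nrm (D (M + m).+1) <= r ^+ (M + m) * (1 - r) * (e / 4).
    rewrite ler_wpM2l ?mulr_ge0 ?exprn_ge0 ?subr_ge0 ?(ltW r0) ?(ltW r1)//.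
    by rewrite ltW// DM// -addnS leq_addr.
  by rewrite exprSr; lra.
have [N1 hN1] := (nrm_cvg_seq _ _).1 (hg r ltac:(by rewrite dr r1)) _ e4.
set N := (M + N1)%N.
have h1 := hN1 N (leq_addl _ _).
have h2 := bound N1; rewrite -/N in h2.
have h3 : nrm (\sum_(k < N) (r ^+ k)%:C *: a k - L) <= e / 4 + ((1 - r) * c + e / 4).
  rewrite Abs (le_trans (nrmD _ _))// lerD//.
    rewrite nrmZ cabsC ger0_norm ?exprn_ge0 ?(ltW r0)//.
    have h : r ^+ N * nrm (D N) <= 1 * nrm (D N).
      by rewrite ler_wpM2r ?nrm_ge0// exprn_ile1 ?(ltW r0) ?(ltW r1).
    by rewrite (le_trans h)// mul1r ltW// DM// leq_addr.
  rewrite (le_trans (nrm_sum _ _ _))//.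
  rewrite (_ : \sum_(i < N) nrm _ = \sum_(k < N) r ^+ k * (1 - r) * nrm (D k.+1)); last first.
    apply: eq_bigr => k _; rewrite nrmZ cabsC ger0_norm//.
    by rewrite mulr_ge0 ?exprn_ge0 ?subr_ge0 ?(ltW r0) ?(ltW r1).
  rewrite (le_trans h2)// lerD2l ler_piMr ?(ltW e4)//.
  have : r ^+ M <= 1 by rewrite exprn_ile1 ?(ltW r0) ?(ltW r1).
  have : 0 <= r ^+ N by rewrite exprn_ge0// ltW.
  by rewrite -/N; lra.
have h4 : (1 - r) * c <= e / 4.
  have h5 : 1 - r <= e / 4 / (c + 1) by move: d'r; rewrite /d'; lra.
  have h6 : (1 - r) * c <= e / 4 / (c + 1) * (c + 1).
    by rewrite ler_pM// ?subr_ge0 ?(ltW r1)// lerDl.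
  by apply: le_trans h6 _; rewrite divfK// gt_eqF.
rewrite (le_lt_trans (nrm_triangle (\sum_(k < N) (r ^+ k)%:C *: a k) _ _))//.
move: h1 h3; rewrite (nrmB (g r)) (nrmB L); lra.
Qed.

End Abel.

Section Evaluation.
Variables (R : realType) (n : nat).
Local Notation C := R[i].

(** The homogeneous component of degree k of p, evaluated at Y. *)
Definition hom_part (H : hilbertType R) (p : fps R n) (Y : 'I_n -> bop H H) (k : nat) :=
  \sum_(a : k.-tuple 'I_n) p a *: op_word Y a.

Section OneSpace.
Variable H : hilbertType R.
Implicit Types (p : fps R n) (Y : 'I_n -> bop H H).

Lemma op_word_dilate Y r (a : word n) :
  op_word (dilate Y r) a = (r ^+ size a)%:C *: op_word Y a.
Proof.
elim: a => [|i a IH] /=; first by rewrite expr0 scale1r.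
apply: bopE => x; rewrite IH !bopZE !bop_compE !bopZE/= linearZ/= scalerA.
by rewrite -rmorphM exprS.
Qed.

Lemma partial_sum_dilate p Y r N :
  partial_sum p (dilate Y r) N = \sum_(k < N) (r ^+ k)%:C *: hom_part p Y k.
Proof.
apply: eq_bigr => k _; rewrite scaler_sumr; apply: eq_bigr => a _.
by rewrite op_word_dilate size_tuple !scalerA mulrC.
Qed.

Lemma bop_cvg_pt (I : Type) (F : set_system I) (FF : Filter F) (u : I -> bop H H) (T : bop H H) x :
  u i @[i --> F] --> T -> u i x @[i --> F] --> T x.
Proof.
move=> /nrm_cvg h; apply/nrm_cvg => e e0.
have c0 : 0 < nrm x + 1 by rewrite ltr_wpDl ?nrm_ge0.
have := h (e / (nrm x + 1)) ltac:(by rewrite divr_gt0); apply: filterS => i.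
rewrite nrm_bop ltr_pdivlMr// => hi; rewrite -bopBE (le_lt_trans (bop_nrm_le _ _))//.
by apply: le_lt_trans hi; rewrite ler_wpM2l ?opnorm_ge0// lerDl.
Qed.

(** Abel's theorem at each vector. *)
Lemma sot_agree p Y T T' : sot_value p Y T -> sot_radial_value p Y T' -> T = T'.
Proof.
move=> hT [[d [d01 rc]] hT']; apply: bopE => x.
have h : norm_eval p (dilate Y r) x @[r --> 1^'-] --> T x.
  apply: (@abel R H (fun k => hom_part p Y k x) _ _ d d01).
    have := hT x; apply: cvg_trans; apply: near_eq_cvg; apply: nearW => N.
    by rewrite bop_sumE.
  move=> r /rc /(@bop_cvg_pt _ _ _ _ _ x); apply: cvg_trans.
  apply: near_eq_cvg; apply: nearW => N.
  rewrite -/(partial_sum p (dilate Y r) N) partial_sum_dilate bop_sumE.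
  by apply: eq_bigr => k _; rewrite bopZE.
apply: (@norm_cvg_unique _ _ (norm_eval p (dilate Y r) x @[r --> 1^'-]) _ _ _ h).
exact: hT'.
Qed.

Definition strong_value p Y T := sot_value p Y T \/ sot_radial_value p Y T.
Definition uniform_value p Y T := norm_value p Y T \/ norm_radial_value p Y T.

Lemma uniform_strong p Y T : uniform_value p Y T -> strong_value p Y T.
Proof.
move=> [h|[rc h]]; [left|right; split=> //] => x; exact: bop_cvg_pt.
Qed.

Lemma strong_value_unique p Y T T' : strong_value p Y T -> strong_value p Y T' -> T = T'.
Proof.
move=> [h|h] [h'|h']; last 3 first.
- exact: sot_agree h h'.
- by apply/esym/(sot_agree h' h).
- apply: bopE => x.
  exact: (@norm_cvg_unique _ _ (norm_eval p (dilate Y r) x @[r --> 1^'-]) _ _ _ (h.2 x) (h'.2 x)).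
- by apply: bopE => x; exact: (cvg_seq_unique (h x) (h' x)).
Qed.

Lemma series_atE p Y T : uniform_value p Y T -> series_at p Y = T.
Proof.
move=> h; apply: (@strong_value_unique p Y); last exact: uniform_strong.
apply: uniform_strong.
exact: (@xgetI _ 0 [set T | norm_value p Y T \/ norm_radial_value p Y T] T h).
Qed.

Lemma op_word_mem (A : set (bop H H)) Y (a : word n) : closed_subalgebra A ->
  (forall i, A (Y i)) -> A (op_word Y a).
Proof.
move=> hA hY; elim: a => [|i a IH]/=; first exact: alg_id.
by apply: (alg_comp hA).
Qed.

Lemma partial_sum_mem (A : set (bop H H)) p Y N : closed_subalgebra A ->
  (forall i, A (Y i)) -> A (partial_sum p Y N).
Proof.
move=> hA hY; apply: (alg_sum hA) => k; apply: (alg_sum hA) => a.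
by apply: (algZ hA); exact: op_word_mem.
Qed.

Lemma norm_eval_mem (A : set (bop H H)) p Y : closed_subalgebra A ->
  (forall i, A (Y i)) -> norm_cvg p Y -> A (norm_eval p Y).
Proof.
move=> hA hY h; apply: (alg_cvg hA (u := partial_sum p Y)); first exact: h.
by move=> N; exact: partial_sum_mem.
Qed.

Lemma dilate_mem (A : set (bop H H)) Y r : closed_subalgebra A ->
  (forall i, A (Y i)) -> forall i, A (dilate Y r i).
Proof. by move=> hA hY i; exact: (algZ hA). Qed.

(** Values are limits of polynomials, or of limits of polynomials. *)
Lemma uniform_value_mem (A : set (bop H H)) p Y T : closed_subalgebra A ->
  (forall i, A (Y i)) -> uniform_value p Y T -> A T.
Proof.
move=> hA hY [h|[[d [/andP[d0 d1] rc]] h]].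
  by apply: (alg_cvg hA h) => N; exact: partial_sum_mem.
apply: (alg_near hA) => e e0.
have := h => /nrm_cvg /(_ e e0) /near_left1P [d' /andP[d'0 d'1] hd'].
(* a radius beyond both thresholds *)
pose r := (Num.max d d' + 1) / 2.
have m1 : Num.max d d' < 1 by rewrite gt_max d1.
have m2 : d <= Num.max d d' by rewrite le_max lexx.
have m3 : d' <= Num.max d d' by rewrite le_max lexx orbT.
exists (norm_eval p (dilate Y r)); last by apply: hd'; rewrite /r; apply/andP; split; lra.
apply: norm_eval_mem => //; first exact: dilate_mem.
by apply: rc; rewrite /r; apply/andP; split; lra.
Qed.

End OneSpace.

Section Transfer.
Variables (V : hilbertType R) (A : set (bop V V)).
Hypothesis hA : cstar_subalgebra A.
Variables (K : hilbertType R) (pi : bop V V -> bop K K).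
Hypothesis hpi : star_rep A pi.
Hypothesis pi1 : pi (bop_id V) = bop_id K.
Variables (p : fps R n) (Y : 'I_n -> bop V V).
Hypothesis hY : forall i, A (Y i).

Lemma rep_op_word (Z : 'I_n -> bop V V) (a : word n) :
  (forall i, A (Z i)) -> pi (op_word Z a) = op_word (pi \o Z) a.
Proof.
move=> hZ; elim: a => [//|i a IH] /=.
by rewrite (repM hpi)// ?IH//; exact: (op_word_mem _ hA).
Qed.

Lemma rep_partial_sum (Z : 'I_n -> bop V V) N :
  (forall i, A (Z i)) -> pi (partial_sum p Z N) = partial_sum p (pi \o Z) N.
Proof.
move=> hZ; rewrite (rep_sum hA hpi); last first.
  by move=> k; apply: (alg_sum hA) => a; apply: (algZ hA); exact: (op_word_mem _ hA).
apply: eq_bigr => k _; rewrite (rep_sum hA hpi); last first.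
  by move=> a; apply: (algZ hA); exact: (op_word_mem _ hA).
apply: eq_bigr => a _; rewrite (repZ hA hpi) ?rep_op_word//.
exact: (op_word_mem _ hA).
Qed.

Lemma rep_norm_value (Z : 'I_n -> bop V V) T : (forall i, A (Z i)) ->
  norm_value p Z T -> norm_value p (pi \o Z) (pi T).
Proof.
move=> hZ h; have AT : A T by apply: (uniform_value_mem hA hZ); left; exact: h.
have AF : \forall N \near \oo, A (partial_sum p Z N).
  by apply: nearW => N; exact: (partial_sum_mem _ _ hA).
rewrite /norm_value (_ : partial_sum p (pi \o Z) = fun N => pi (partial_sum p Z N)).
  exact: (rep_cvg hA hpi pi1 _ AT AF h).
by apply/funext => N; rewrite rep_partial_sum.
Qed.

(** Contractivity is used twice, for the series at each radius and for the
radial limit. *)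
Lemma rep_radial_value T :
  norm_radial_value p Y T -> norm_radial_value p (pi \o Y) (pi T).
Proof.
move=> h0; have AT : A T by apply: (uniform_value_mem hA hY); right; exact: h0.
case: h0 => [[d [d01 rc]] h].
have dil r : dilate (pi \o Y) r = pi \o dilate Y r.
  by apply/funext => i; rewrite /dilate /= (repZ hA hpi).
have cv r : d < r < 1 -> norm_value p (dilate (pi \o Y) r) (pi (norm_eval p (dilate Y r))).
  by move=> dr; rewrite dil; apply: rep_norm_value; [exact: (dilate_mem _ hA)|exact: rc].
split.
  exists d; split=> // r dr; rewrite /norm_cvg.
  by apply/cvg_ex; exists (pi (norm_eval p (dilate Y r))); exact: cv.
have nr : \forall r \near 1^'-, d < r < 1 by apply/near_left1P; exists d.
have AF : \forall r \near 1^'-, A (norm_eval p (dilate Y r)).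
  apply: filterS nr => r dr; apply: (norm_eval_mem hA) => //; first exact: (dilate_mem _ hA).
  exact: rc.
have h2 : pi (norm_eval p (dilate Y r)) @[r --> 1^'-] --> pi T.
  exact: (rep_cvg hA hpi pi1 _ AT AF h).
apply: cvg_trans h2.
apply: near_eq_cvg; apply: filterS nr => r dr; apply/esym; apply: norm_cvg_lim.
exact: cv.
Qed.

End Transfer.

End Evaluation.

(** * The algebra of noncommutative formal series *)

Section WordSums.
Variable n : nat.
Local Notation word := (seq 'I_n).

(** Words up to a fixed length form a list without repetition, so that every sum
met below is a big operator over a list. *)
Definition words (N : nat) : seq word := [seq bseqval a | a : N.-bseq 'I_n].

Lemma words_uniq N : uniq (words N).
Proof. by rewrite map_inj_uniq ?enum_uniq//; exact: val_inj. Qed.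

Lemma mem_words N (a : word) : (a \in words N) = (size a <= N)%N.
Proof.
apply/mapP/idP => [[b _ ->]|h]; first exact: size_bseq.
by exists (Bseq h) => //; rewrite mem_enum.
Qed.

Definition words_of_size (k : nat) : seq word := [seq tval a | a : k.-tuple 'I_n].

Lemma words_of_size_uniq k : uniq (words_of_size k).
Proof. by rewrite map_inj_uniq ?enum_uniq//; exact: val_inj. Qed.

Lemma mem_words_of_size k (a : word) : (a \in words_of_size k) = (size a == k).
Proof.
apply/mapP/idP => [[b _ ->]|h]; first by rewrite size_tuple.
by exists (Tuple h) => //; rewrite mem_enum.
Qed.

Lemma sum_words_of_size (M : nmodType) k (F : word -> M) :
  \sum_(a <- words_of_size k) F a = \sum_(a : k.-tuple 'I_n) F a.
Proof. by rewrite /words_of_size big_image. Qed.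

Lemma sum_delta (M : pzRingType) (s : seq word) (F : word -> M) w : uniq s -> w \in s ->
  \sum_(a <- s) F a * (w == a)%:R = F w.
Proof.
move=> us ws; rewrite (bigD1_seq w)//= eqxx mulr1 big1 ?addr0// => a aw.
by rewrite eq_sym (negPf aw) mulr0.
Qed.

Lemma sum_words_recl (M : nmodType) k (F : word -> M) :
  \sum_(a <- words_of_size k.+1) F a =
  \sum_(i : 'I_n) \sum_(a <- words_of_size k) F (i :: a).
Proof.
pose s := [seq i :: a | i <- enum 'I_n, a <- words_of_size k].
have ps : perm_eq (words_of_size k.+1) s.
  apply: uniq_perm; first exact: words_of_size_uniq.
    apply: allpairs_uniq; rewrite ?enum_uniq ?words_of_size_uniq//.
    by move=> [i a] [j b] _ _ /= [-> ->].
  move=> a; rewrite mem_words_of_size; apply/idP/allpairsP.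
    case: a => // i a /=; rewrite eqSS => h; exists (i, a); split=> //=.
      by rewrite mem_enum.
    by rewrite mem_words_of_size.
  move=> [[i b] [_ /= hb ->]] /=; rewrite eqSS; by rewrite mem_words_of_size in hb.
by rewrite (perm_big _ ps) big_allpairs_dep/= big_enum.
Qed.

Lemma sum_words_split (M : nmodType) N (F : word -> M) :
  \sum_(k < N.+1) \sum_(a : k.-tuple 'I_n) F a = \sum_(a <- words N) F a.
Proof.
under eq_bigr => k _ do rewrite -(sum_words_of_size _ F).
elim: N => [|N IH].
  rewrite big_ord1; apply: perm_big; apply: uniq_perm.
  - exact: words_of_size_uniq.
  - exact: words_uniq.
  - by move=> a; rewrite mem_words_of_size mem_words leqn0.
rewrite big_ord_recr/= IH -big_cat; apply: perm_big; apply: uniq_perm.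
- rewrite cat_uniq words_uniq words_of_size_uniq andbT/=; apply/hasPn => a.
  by rewrite mem_words_of_size mem_words -ltnNge => /eqP ->.
- exact: words_uniq.
- by move=> a; rewrite mem_cat mem_words_of_size !mem_words [RHS]leq_eqVlt ltnS orbC.
Qed.

End WordSums.

Section SeriesAlgebra.
Variables (R : realType) (n : nat).
Local Notation C := R[i].
Local Notation word := (word n).
Implicit Types (p q r : fps R n) (g h : 'I_n -> fps R n) (a b c : word).

Lemma natr_eq_neq0 a b : (a == b)%:R != 0 :> C -> a = b.
Proof. by have [//|_] := eqVneq a b; rewrite eqxx. Qed.

Definition delta_fps a : fps R n := fun b => (b == a)%:R.

(** A series is the sum of its monomials; this turns products of series into
sums over pairs of words. *)
Lemma delta_expand (F : fps R n) (u : seq word) w : uniq u ->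
  (F w != 0 -> w \in u) -> F w = \sum_(a <- u) F a * (w == a)%:R.
Proof.
move=> uu hu; have [wu|wu] := boolP (w \in u); first by rewrite sum_delta.
have -> : F w = 0 by apply/eqP; apply: contraNT wu; exact: hu.
rewrite big_seq big1// => a au; rewrite (_ : (w == a) = false) ?mulr0//.
by apply/eqP => wa; rewrite wa au in wu.
Qed.

(** Each cut of c into two words is one pair (a, b) with c = a ++ b.  The
hypotheses only concern words up to the length of c, so that the formula applies
to all series and not only to polynomials. *)
Lemma fps_mul_delta p q c s t : uniq s -> uniq t ->
  (forall a, (size a <= size c)%N -> p a != 0 -> a \in s) ->
  (forall a, (size a <= size c)%N -> q a != 0 -> a \in t) ->
  fps_mul p q c = \sum_(a <- s) \sum_(b <- t) p a * q b * (c == a ++ b)%:R.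
Proof.
move=> us ut ps qt; rewrite /fps_mul.
transitivity (\sum_(k < (size c).+1) \sum_(a <- s) \sum_(b <- t)
    p a * q b * ((take k c == a)%:R * (drop k c == b)%:R)).
  apply: eq_bigr => k _; rewrite (@delta_expand p s (take k c))//; last first.
    by apply: ps; rewrite size_take_min geq_minr.
  rewrite (@delta_expand q t (drop k c))//; last by apply: qt; rewrite size_drop leq_subr.
  rewrite mulr_suml; apply: eq_bigr => a _; rewrite mulr_sumr; apply: eq_bigr => b _.
  by rewrite mulrACA.
rewrite exchange_big; apply: eq_bigr => a _ /=; rewrite exchange_big; apply: eq_bigr => b _ /=.
rewrite -mulr_sumr; congr (_ * _).
have [->|cab] := eqVneq c (a ++ b).
  have ha : (size a < (size (a ++ b)).+1)%N by rewrite size_cat ltnS leq_addr.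
  rewrite (bigD1 (Ordinal ha))//= take_size_cat// drop_size_cat// !eqxx mulr1.
  rewrite big1 ?addr0// => k kh; rewrite (_ : (_ == a) = false) ?mul0r//.
  apply/eqP => /(congr1 size); rewrite size_takel; last by rewrite -ltnS.
  by move=> e; move/eqP: kh; apply; apply: val_inj.
rewrite big1// => k _; have [ta|] := eqVneq (take k c) a; last by rewrite mul0r.
have [db|] := eqVneq (drop k c) b; last by rewrite mulr0.
by rewrite -ta -db cat_take_drop eqxx in cab.
Qed.

(** Both sides are the sum over the triples of words concatenating to c. *)
Lemma fps_mulA p q r : fps_mul (fps_mul p q) r = fps_mul p (fps_mul q r).
Proof.
apply/funext => c; set s := words n (size c).
have us : uniq s by exact: words_uniq.
have hs (F : fps R n) a : (size a <= size c)%N -> F a != 0 -> a \in s.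
  by rewrite mem_words.
have E p' q' w : w \in s ->
    fps_mul p' q' w = \sum_(a <- s) \sum_(b <- s) p' a * q' b * (w == a ++ b)%:R.
  rewrite mem_words => wc.
  by apply: fps_mul_delta => // a aw _; rewrite mem_words (leq_trans aw).
have cs : c \in s by rewrite mem_words.
transitivity (\sum_(a <- s) \sum_(b <- s) \sum_(d <- s) p a * q b * r d *
    (c == a ++ b ++ d)%:R).
  rewrite E//; transitivity (\sum_(w <- s) \sum_(d <- s) \sum_(a <- s) \sum_(b <- s)
      p a * q b * r d * ((w == a ++ b) && (c == w ++ d))%:R).
    rewrite big_seq [RHS]big_seq; apply: eq_bigr => w ws; apply: eq_bigr => d _.
    rewrite E// !mulr_suml; apply: eq_bigr => a _.
    rewrite !mulr_suml; apply: eq_bigr => b _.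
    by rewrite -mulnb natrM !mulrA (mulrAC (p a * q b)).
  rewrite exchange_big/=.
  under eq_bigr => d _.
    rewrite exchange_big/=; under eq_bigr => a _ do rewrite exchange_big/=.
    over.
  rewrite exchange_big/=; apply: eq_bigr => a _; rewrite exchange_big/=.
  apply: eq_bigr => b _; apply: eq_bigr => d _; rewrite -mulr_sumr; congr (_ * _).
  have [cE|cE] := eqVneq c (a ++ b ++ d).
    rewrite (bigD1_seq (a ++ b))//=; last first.
      by rewrite mem_words cE !size_cat addnA leq_addr.
    rewrite eqxx -catA cE eqxx/= big1 ?addr0// => w wab.
    by rewrite (negPf wab).
  rewrite big1// => w _; case: eqVneq => // ->.
  by rewrite -catA (negPf cE).
rewrite E//; apply: eq_bigr => a _.
transitivity (\sum_(w <- s) \sum_(b <- s) \sum_(d <- s)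
   p a * q b * r d * ((w == b ++ d) && (c == a ++ w))%:R); last first.
  rewrite big_seq [RHS]big_seq; apply: eq_bigr => w ws.
  rewrite E// mulr_sumr mulr_suml; apply: eq_bigr => b _.
  rewrite mulr_sumr mulr_suml; apply: eq_bigr => d _.
  by rewrite -mulnb natrM !mulrA.
rewrite [RHS]exchange_big/=; apply: eq_bigr => b _.
rewrite [RHS]exchange_big/=; apply: eq_bigr => d _.
rewrite -mulr_sumr; congr (_ * _).
have [cE|cE] := eqVneq c (a ++ b ++ d).
  rewrite (bigD1_seq (b ++ d))//=; last first.
    by rewrite mem_words cE [size (a ++ _)]size_cat leq_addl.
  rewrite eqxx cE eqxx/= big1 ?addr0// => w wab.
  by rewrite (negPf wab).
rewrite big1// => w _; case: eqVneq => // ->.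
by rewrite (negPf cE).
Qed.

Lemma fps_mul1 p : fps_mul (@fps_one R n) p = p.
Proof.
apply/funext => c; rewrite /fps_mul big_ord_recl /fps_one take0 drop0 eqxx mul1r.
rewrite big1 ?addr0// => k _; case: c k => [|i c] k; first by case: k.
by rewrite /= mul0r.
Qed.

Lemma fps_word_cat g a b :
  fps_word g (a ++ b) = fps_mul (fps_word g a) (fps_word g b).
Proof.
elim: a => [|i a IH] /=; first by rewrite fps_mul1.
by rewrite IH fps_mulA.
Qed.

Lemma fps_mul_deltaE a p c :
  fps_mul (delta_fps a) p c = \sum_(k < (size c).+1) (take k c == a)%:R * p (drop k c).
Proof. by []. Qed.

Lemma fps_word_var a : fps_word (@fps_var R n) a = delta_fps a.
Proof.
elim: a => [//|i a IH] /=; rewrite IH; apply/funext => c.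
rewrite (@fps_mul_delta _ _ _ [:: [:: i]] [:: a])//=.
- by rewrite !big_seq1 /fps_var /delta_fps !eqxx !mul1r.
- by move=> b _ /natr_eq_neq0 ->; rewrite inE.
- by move=> b _ /natr_eq_neq0 ->; rewrite inE.
Qed.

Lemma fps_comp_fin p g b s : uniq s ->
  (forall a, a \notin s -> p a * fps_word g a b = 0) ->
  fps_comp p g b = \sum_(a <- s) p a * fps_word g a b.
Proof.
move=> us h; rewrite /fps_comp (@fsbigE _ _ _ _ _ s)//; last by move=> a _; exact: h.
by apply: eq_bigl => a; rewrite in_setT.
Qed.

Lemma fps_comp_delta a g : fps_comp (delta_fps a) g = fps_word g a.
Proof.
apply/funext => b; rewrite (@fps_comp_fin _ _ _ [:: a])//.
  by rewrite big_seq1 /delta_fps eqxx mul1r.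
by move=> c; rewrite inE /delta_fps => /negPf ->; rewrite mul0r.
Qed.

Definition fps_degree_le p N := forall a, p a != 0 -> (size a <= N)%N.

Lemma fps_poly_degree_le p : fps_poly p -> exists N, fps_degree_le p N.
Proof.
move=> /finite_seqP[s hs]; exists (\max_(a <- s) size a)%N => a pa.
have : a \in s by have : [set` s] a by rewrite -hs.
by move=> as_; exact: (@leq_bigmax_seq _ s xpredT size a).
Qed.

Lemma fps_degree_le_comp p g b N : fps_degree_le p N ->
  fps_comp p g b = \sum_(a <- words n N) p a * fps_word g a b.
Proof.
move=> pN; apply: fps_comp_fin; first exact: words_uniq.
move=> a; rewrite mem_words => aN; have [->|/pN] := eqVneq (p a) 0.
  by rewrite mul0r.
by rewrite (negPf aN).
Qed.

Lemma fps_degree_le_mul p q N M :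
  fps_degree_le p N -> fps_degree_le q M -> fps_degree_le (fps_mul p q) (N + M).
Proof.
move=> pN qM a; apply: contraNT; rewrite -ltnNge => ha.
rewrite /fps_mul big1// => k _.
have [->|/pN hp] := eqVneq (p (take k a)) 0; first by rewrite mul0r.
have [->|/qM hq] := eqVneq (q (drop k a)) 0; first by rewrite mulr0.
have : (size (take k a) + size (drop k a) <= N + M)%N by rewrite leq_add.
by rewrite -size_cat cat_take_drop leqNgt ha.
Qed.

Lemma fps_degree_le_trans p N M : (N <= M)%N -> fps_degree_le p N -> fps_degree_le p M.
Proof. by move=> NM pN a /pN h; rewrite (leq_trans h). Qed.

Lemma fps_degree_le_word g N a : (forall i, fps_degree_le (g i) N) ->
  fps_degree_le (fps_word g a) (size a * N).
Proof.
move=> gN; elim: a => [|i a IH] /=.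
  by move=> b /natr_eq_neq0 ->.
by rewrite mulSn; exact: fps_degree_le_mul.
Qed.

Lemma fps_tuple_degree_le g : (forall i, fps_poly (g i)) ->
  exists N, forall i, fps_degree_le (g i) N.
Proof.
move=> gp; have [N hN] := choice (fun i => fps_poly_degree_le (gp i)).
exists (\max_i N i)%N => i; apply: fps_degree_le_trans (hN i); exact: leq_bigmax.
Qed.

(** Composition with g is a ring morphism on polynomials.  The degree bounds make
composition a finite sum even if g has constant terms; an infinite sum would be
given the value 0. *)
Lemma fps_comp_mul p q g N M : fps_degree_le p N -> fps_degree_le q M ->
  fps_comp (fps_mul p q) g = fps_mul (fps_comp p g) (fps_comp q g).
Proof.
move=> pN qM; apply/funext => c.
rewrite (fps_degree_le_comp _ _ (fps_degree_le_mul pN qM)).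
set s := words n N; set t := words n M.
transitivity (\sum_(a <- s) \sum_(b <- t) p a * q b * fps_word g (a ++ b) c).
  transitivity (\sum_(w <- words n (N + M)) \sum_(a <- s) \sum_(b <- t)
     p a * q b * ((w == a ++ b)%:R * fps_word g w c)).
    apply: eq_bigr => w _; rewrite (@fps_mul_delta _ _ _ s t) ?words_uniq//.
    - rewrite mulr_suml; apply: eq_bigr => a _; rewrite mulr_suml.
      by apply: eq_bigr => b _; rewrite mulrA.
    - by move=> a _ /pN; rewrite mem_words.
    - by move=> a _ /qM; rewrite mem_words.
  rewrite exchange_big/= big_seq [RHS]big_seq; apply: eq_bigr => a; rewrite mem_words => aN.
  rewrite exchange_big/= big_seq [RHS]big_seq; apply: eq_bigr => b; rewrite mem_words => bM.
  rewrite -mulr_sumr; congr (_ * _).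
  under eq_bigr => w _ do rewrite mulrC eq_sym.
  by rewrite sum_delta ?words_uniq// mem_words size_cat leq_add.
rewrite /fps_mul; under [RHS]eq_bigr => k _ do
  rewrite (fps_degree_le_comp _ _ pN) (fps_degree_le_comp _ _ qM) mulr_suml.
rewrite [RHS]exchange_big/=; apply: eq_bigr => a _.
under [RHS]eq_bigr => k _ do rewrite mulr_sumr.
rewrite [RHS]exchange_big/=; apply: eq_bigr => b _.
rewrite fps_word_cat /fps_mul mulr_sumr; apply: eq_bigr => k _.
by rewrite mulrACA.
Qed.

Lemma fps_comp_one g : fps_comp (@fps_one R n) g = @fps_one R n.
Proof. by have := fps_comp_delta [::] g. Qed.

(** Composition with q undoes composition with f, by linearity and fps_comp_mul,
since it maps f_a to the monomial a. *)
Lemma fps_comp_cancel p (f q : 'I_n -> fps R n) N : (forall i, fps_poly (f i)) ->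
  (forall i, fps_comp (f i) q = fps_var R i) ->
  fps_degree_le p N -> fps_comp (fps_comp p f) q = p.
Proof.
move=> fp fq pN; have [M fM] := fps_tuple_degree_le fp.
have wq a : fps_comp (fps_word f a) q = delta_fps a.
  rewrite -fps_word_var; elim: a => [|i a IH] /=; first exact: fps_comp_one.
  by rewrite (fps_comp_mul _ (fM i) (fps_degree_le_word (a := a) fM)) IH fq.
have pfE b : fps_comp p f b = \sum_(a <- words n N) p a * fps_word f a b.
  exact: fps_degree_le_comp.
have wNM a : a \in words n N -> fps_degree_le (fps_word f a) (N * M).
  rewrite mem_words => aN; apply: fps_degree_le_trans (fps_degree_le_word (a := a) fM).
  by rewrite leq_mul2r aN orbT.
have pfb : fps_degree_le (fps_comp p f) (N * M).
  move=> b; apply: contraNT => bNM; rewrite pfE big_seq big1// => a /wNM h.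
  have [->|/h] := eqVneq (fps_word f a b) 0; first by rewrite mulr0.
  by rewrite (negPf bNM).
apply/funext => c; rewrite (fps_degree_le_comp _ _ pfb).
under eq_bigr => b _ do rewrite pfE mulr_suml.
rewrite exchange_big/=.
transitivity (\sum_(a <- words n N) p a * (c == a)%:R).
  rewrite big_seq [RHS]big_seq; apply: eq_bigr => a /wNM aN.
  under eq_bigr => b _ do rewrite -mulrA.
  by rewrite -mulr_sumr -(fps_degree_le_comp _ _ aN) wq.
by rewrite -delta_expand ?words_uniq// => /pN; rewrite mem_words.
Qed.

End SeriesAlgebra.

(** * Left shifts: polynomial automorphisms *)

Section Model.
Variables (R : realType) (n : nat).
Local Notation C := R[i].
Local Notation word := (word n).
Variables (f : 'I_n -> fps R n) (H2 : hilbertType R) (e : word -> H2).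
Hypothesis e_basis : orthonormal_basis e.
Variable MZ : 'I_n -> bop H2 H2.

Lemma coefs_inj x y : (forall a, coefs e x a = coefs e y a) -> x = y.
Proof.
move=> h; apply/eqP; rewrite -subr_eq0; apply/eqP/(total_orth (onb_total e_basis)) => _ [a _ <-].
by rewrite innerBl [inner x _]h subrr.
Qed.

Lemma coefs_e a : coefs e (e a) = delta_fps R a.
Proof. by apply/funext => b; rewrite /coefs /delta_fps (onb_orth e_basis) eq_sym. Qed.

Lemma coefsB x y a : coefs e (x - y) a = coefs e x a - coefs e y a.
Proof. exact: innerBl. Qed.

Lemma delta_poly (a : word) : fps_poly (delta_fps R a).
Proof.
apply: (@sub_finite_set _ _ [set a]); last exact: finite_set1.
by move=> b /= /natr_eq_neq0 ->.
Qed.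

Definition shift_values (T : 'I_n -> bop H2 H2) :=
  (forall j, strong_value (f j) MZ (T j)) /\ forall j a, T j (e a) = e (j :: a).

Lemma sum_words_bounded (M : nmodType) (F : word -> M) N N' : (N <= N')%N ->
  (forall a, (N < size a)%N -> F a = 0) ->
  \sum_(a <- words n N') F a = \sum_(a <- words n N) F a.
Proof.
move=> NN h; rewrite (bigID (fun a => (size a <= N)%N))/= [X in _ + X]big1 ?addr0; last first.
  by move=> a; rewrite -ltnNge; exact: h.
rewrite -big_filter; apply: perm_big; apply: uniq_perm.
- by rewrite filter_uniq// words_uniq.
- exact: words_uniq.
- move=> a; rewrite mem_filter !mem_words; apply: andb_idr => aN.
  exact: leq_trans NN.
Qed.

Lemma partial_sum_words (H : hilbertType R) (p : fps R n) (Y : 'I_n -> bop H H) N :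
  partial_sum p Y N.+1 = \sum_(a <- words n N) p a *: op_word Y a.
Proof. exact: (sum_words_split N (fun a => p a *: op_word Y a)). Qed.

Lemma degree_le_norm_value (H : hilbertType R) (p : fps R n) (Y : 'I_n -> bop H H) N :
  fps_degree_le p N -> norm_value p Y (\sum_(a <- words n N) p a *: op_word Y a).
Proof.
move=> pN; apply/nrm_cvg_seq => eps eps0; exists N.+1 => -[//|i] Ni.
rewrite -/(partial_sum p Y i.+1) partial_sum_words (@sum_words_bounded _ _ N i)// ?subrr ?nrm0//.
move=> a aN; have [->|/pN] := eqVneq (p a) 0; first by rewrite scale0r.
by rewrite leqNgt aN.
Qed.

Lemma sum_delta_mul (p g : fps R n) N c : fps_degree_le p N ->
  \sum_(a <- words n N) p a * fps_mul (delta_fps R a) g c = fps_mul p g c.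
Proof.
move=> pN; under eq_bigr => a _ do rewrite fps_mul_deltaE mulr_sumr.
rewrite exchange_big/=; apply: eq_bigr => k _.
rewrite [in RHS](@delta_expand _ _ p (words n N)) ?words_uniq//; last first.
  by move=> /pN; rewrite mem_words.
by rewrite mulr_suml; apply: eq_bigr => a _; rewrite mulrA.
Qed.

(** The operator f_j(M_Z) is a finite sum, and f_j(M_Z) e_b and e_(j b) are
polynomials in f with the same series.  They agree by fps_comp_cancel. *)
Lemma shift_of_poly : property_A f e MZ -> exists T, shift_values T.
Proof.
move=> [fp [q [qp fq qf]] hZ]; have [N fN] := fps_tuple_degree_le fp.
exists (fun j => \sum_(a <- words n N) f j a *: op_word MZ a); split=> j.
  apply: uniform_strong; left; exact: degree_le_norm_value.
move=> b; set Tb := bop_fun _ _.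
have word_b a : fps_poly (coefs e (op_word MZ a (e b))) /\
    formal_series f e (op_word MZ a (e b)) = fps_mul (delta_fps R a) (fps_word f b).
  elim: a => [|i a [IH1 IH2]] /=.
    rewrite /formal_series coefs_e; split; first exact: delta_poly.
    by rewrite fps_comp_delta [RHS]fps_mul1.
  have [h1 h2] := hZ i _ IH1; split=> //.
  by rewrite h2 IH2 -fps_mulA -!fps_word_var.
have [B hB] := choice (fun a => fps_poly_degree_le (word_b a).1).
(* a common degree bound for all the vectors involved *)
pose N' := (\max_(a <- words n N) B a + (size b).+1)%N.
pose x := Tb - e (j :: b).
have bw a : a \in words n N -> fps_degree_le (coefs e (op_word MZ a (e b))) N'.
  move=> aN; apply: fps_degree_le_trans (hB a).
  rewrite (leq_trans _ (leq_addr _ _))//.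
  exact: (@leq_bigmax_seq _ (words n N) xpredT B a).
have be : fps_degree_le (coefs e (e (j :: b))) N'.
  by rewrite coefs_e => a /natr_eq_neq0 ->; rewrite leq_addl.
have xE c : coefs e x c = \sum_(a <- words n N) f j a * coefs e (op_word MZ a (e b)) c -
    coefs e (e (j :: b)) c.
  rewrite coefsB /Tb /coefs bop_sumE inner_suml; congr (_ - _).
  by apply: eq_bigr => a _; rewrite innerZl.
have bx : fps_degree_le (coefs e x) N'.
  move=> c; apply: contraNT => cN; rewrite xE big_seq big1 ?sub0r ?oppr_eq0.
    by apply: contraNT cN; exact: be.
  move=> a /bw h; have [->|/h] := eqVneq (coefs e (op_word MZ a (e b)) c) 0.
    by rewrite mulr0.
  by rewrite (negPf cN).
have x0 : fps_comp (coefs e x) f = fun=> 0.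
  apply/funext => c; rewrite (fps_degree_le_comp _ _ bx).
  under eq_bigr => w _ do rewrite xE mulrBl mulr_suml.
  rewrite sumrB -(fps_degree_le_comp _ _ be) coefs_e fps_comp_delta exchange_big/=.
  rewrite -(sum_delta_mul (fps_word f b) c (fN j)); apply/eqP; rewrite subr_eq0; apply/eqP.
  rewrite big_seq [RHS]big_seq; apply: eq_bigr => a aN.
  under eq_bigr => w _ do rewrite -mulrA.
  by rewrite -mulr_sumr -(fps_degree_le_comp _ _ (bw a aN)) -(word_b a).2.
have := fps_comp_cancel fp fq bx; rewrite x0 => xz.
apply: coefs_inj => a; apply/eqP; rewrite -subr_eq0 -coefsB -/x -xz.
rewrite (@fps_comp_fin _ _ _ _ _ [::])// ?big_nil// => w _; exact: mul0r.
Qed.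

End Model.

(** * Left shifts: formal power series *)

Section FormalCase.
Variables (R : realType) (n : nat).
Local Notation C := R[i].
Local Notation word := (word n).
Variables (f : 'I_n -> fps R n).
Hypothesis f0 : forall i, f i [::] = 0.

(** f_a has order at least the length of a. *)
Lemma fps_word_short (a b : word) : (size b < size a)%N -> fps_word f a b = 0.
Proof.
elim: a b => [//|i a IH] b /= ab; rewrite /fps_mul big1// => -[[|k] /= hk] _.
  by rewrite take0 f0 mul0r.
case: b ab hk => [|j b] /=; first by rewrite f0 mul0r.
move=> ab hk; rewrite IH ?mulr0// size_drop.
by rewrite (leq_ltn_trans (leq_subr _ _)).
Qed.

(** The terms of lowest order of f_a multiply, one letter at a time. *)
Lemma fps_word_diag i (a : word) j (b : word) : size a = size b ->
  fps_word f (i :: a) (j :: b) = f i [:: j] * fps_word f a b.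
Proof.
move=> ab; rewrite /= /fps_mul/= big_ord_recl take0 f0 mul0r add0r.
rewrite big_ord_recl/= take0 drop0 big1 ?addr0// => k _.
rewrite fps_word_short ?mulr0//= size_drop ab ltn_subrL/=.
by case: k => k /=; case: (size b).
Qed.

(** The matrix of the f_a(b) with a and b of length k is the k-th tensor power of
the matrix of linear coefficients, and is inverted one letter at a time. *)
Lemma diag_transform_inj k (F : word -> C) : \det (linear_coefs f) != 0 ->
  (forall b, size b = k -> \sum_(a <- words_of_size n k) F a * fps_word f a b = 0) ->
  forall a, size a = k -> F a = 0.
Proof.
move=> det0; elim: k F => [|k IH] F h a.
  move=> /size0nil ->; have := h [::] erefl.
  have ps : perm_eq (words_of_size n 0) [:: [::]].
    apply: uniq_perm => //; first exact: words_of_size_uniq.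
    by move=> b; rewrite mem_words_of_size inE; case: b.
  by rewrite (perm_big _ ps) big_seq1/= /fps_one eqxx mulr1.
case: a => // i a [sa].
pose v := \row_(i < n) F (i :: a).
suff : v *m linear_coefs f = 0.
  have uJ : linear_coefs f \in unitmx by rewrite unitmxE unitfE.
  move=> /(congr1 (mulmx^~ (invmx (linear_coefs f)))); rewrite mulmxK// mul0mx.
  by move=> /rowP /(_ i); rewrite !mxE.
apply/rowP => j; rewrite !mxE.
rewrite (eq_bigr (fun i => F (i :: a) * f i [:: j])); last by move=> i' _; rewrite !mxE.
apply: (IH (fun a => \sum_i F (i :: a) * f i [:: j])) sa => b sb.
have := h (j :: b) ltac:(by rewrite /= sb); rewrite sum_words_recl exchange_big/= => hb.
rewrite -[RHS]hb.
apply: eq_big_seq => c; rewrite mem_words_of_size => /eqP sc.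
rewrite mulr_suml; apply: eq_bigr => i' _.
have := @fps_word_diag i' c j b; rewrite /= => ->; last by rewrite sc sb.
by rewrite mulrA.
Qed.

Lemma fps_comp_local p (b : word) :
  fps_comp p f b = \sum_(a <- words n (size b)) p a * fps_word f a b.
Proof.
apply: fps_comp_fin; first exact: words_uniq.
by move=> a; rewrite mem_words -ltnNge => h; rewrite fps_word_short ?mulr0.
Qed.

(** The coefficients of lowest degree of p vanish by diag_transform_inj. *)
Lemma fps_comp_eq0 p : \det (linear_coefs f) != 0 ->
  (forall b, fps_comp p f b = 0) -> forall a, p a = 0.
Proof.
move=> det0 h a; have [k] := ubnP (size a); elim: k a => // k IH a.
rewrite ltnS leq_eqVlt => /orP[/eqP|/IH//].
apply: diag_transform_inj => // b sb; rewrite -[RHS](h b); apply/esym/fps_comp_fin.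
  exact: words_of_size_uniq.
move=> c; rewrite mem_words_of_size neq_ltn => /orP[/IH ->|ck]; first by rewrite mul0r.
by rewrite fps_word_short ?mulr0// sb.
Qed.

End FormalCase.

Section FormalShift.
Variables (R : realType) (n : nat).
Variables (f : 'I_n -> fps R n) (H2 : hilbertType R) (e : word n -> H2).
Hypothesis e_basis : orthonormal_basis e.
Variable MZ : 'I_n -> bop H2 H2.

Lemma model_value_strong T : model_value f MZ T -> forall j, strong_value (f j) MZ (T j).
Proof. by move=> [h|h] j; [left|right]. Qed.

Lemma shift_of_formal : property_S f e MZ -> exists T, shift_values f e MZ T.
Proof.
move=> [f0 _ det0 [_ _ [T [mT hT]]]]; exists T; split; first exact: model_value_strong.
move=> j a; apply: (coefs_inj e_basis) => b; apply/eqP; rewrite -subr_eq0; apply/eqP.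
move: b; apply: (fps_comp_eq0 f0 det0) => c; rewrite fps_comp_local//.
under eq_bigr => w _ do rewrite mulrBl.
rewrite sumrB -!fps_comp_local// -/(formal_series f e (T j (e a))) hT.
by rewrite /formal_series !coefs_e// !fps_comp_delta subrr.
Qed.

End FormalShift.

(** * Left shifts: free holomorphic functions *)

Section HolomorphicCase.
Variables (R : realType) (n : nat).
Local Notation C := R[i].
Local Notation word := (word n).
Variables (H2 : hilbertType R) (e : word -> H2).
Hypothesis e_basis : orthonormal_basis e.

Lemma nrm_comb_basis (s : seq word) (d : word -> C) : uniq s ->
  nrm (\sum_(a <- s) d a *: e a) ^+ 2 = \sum_(a <- s) cabs (d a) ^+ 2.
Proof.
move=> us; apply: (@complexI R); rewrite -inner_nrm inner_suml rmorph_sum/=.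
apply: eq_big_seq => a as_; rewrite innerZl inner_sumr.
rewrite (eq_bigr (fun b => Num.conj (d b) * (a == b)%:R)); last first.
  by move=> b _; rewrite innerZr (onb_orth e_basis).
by rewrite sum_delta// -normCK rmorphXn/= RRe_real ?normr_real.
Qed.

(** A finite sum of coefficients is an inner product with a combination of basis
vectors, which gives the Cauchy-Schwarz inequality without a separate proof. *)
Lemma coefs_pairing (s : seq word) (d : word -> C) x : uniq s ->
  cabs (\sum_(a <- s) coefs e x a * d a) ^+ 2 <=
  nrm x ^+ 2 * \sum_(a <- s) cabs (d a) ^+ 2.
Proof.
move=> us.
have -> : \sum_(a <- s) coefs e x a * d a = inner x (\sum_(a <- s) Num.conj (d a) *: e a).
  rewrite inner_sumr; apply: eq_bigr => a _.
  by rewrite innerZr conjCK mulrC.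
have := cabs_inner x (\sum_(a <- s) Num.conj (d a) *: e a).
rewrite -(@ler_pXn2r _ 2) ?nnegrE ?cabs_ge0 ?mulr_ge0 ?nrm_ge0// exprMn nrm_comb_basis//.
move=> h; rewrite (le_trans h)// (_ : \sum_(a <- s) cabs (Num.conj _) ^+ 2 = \sum_(a <- s) cabs (d a) ^+ 2)//.
by apply: eq_bigr => a _; rewrite /cabs norm_conjC.
Qed.

Lemma coefs_bessel (s : seq word) x : uniq s ->
  \sum_(a <- s) cabs (coefs e x a) ^+ 2 <= nrm x ^+ 2.
Proof.
move=> us; have := coefs_pairing (fun a => Num.conj (coefs e x a)) x us.
set S := \sum_(a <- s) cabs (coefs e x a) ^+ 2.
have -> : \sum_(a <- s) coefs e x a * Num.conj (coefs e x a) = S%:C.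
  rewrite rmorph_sum; apply: eq_bigr => a _ /=.
  by rewrite -normCK rmorphXn/= RRe_real ?normr_real.
rewrite (_ : \sum_(a <- s) cabs _ ^+ 2 = S); last first.
  by apply: eq_bigr => a _; rewrite /cabs norm_conjC.
have S0 : 0 <= S by apply: sumr_ge0 => a _; rewrite sqr_ge0.
rewrite cabsC ger0_norm// expr2; have [->|Sn0] := eqVneq S 0; first by rewrite sqr_ge0.
by rewrite ler_pM2r// lt_neqAle eq_sym Sn0.
Qed.

(** The k-th coefficient sum is at most |x|^2 + 1, whose 2k-th root tends to 1. *)
Lemma coefs_free_holomorphic x : free_holomorphic 1 (coefs e x).
Proof.
rewrite /free_holomorphic /inv_radius invr1; set u := fun k : nat => _.
pose M := nrm x ^+ 2 + 1.
have M1 : 1 <= M by rewrite lerDr sqr_ge0.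
apply/lee_addgt0Pr => eps eps0.
(* Bernoulli's inequality makes (1 + eps) ^ (2 k) exceed any bound *)
have [K hK] : exists K : nat, forall k, (K <= k)%N -> M <= (1 + eps) ^+ (2 * k).
  exists (Num.truncn (M / eps)).+1 => k Kk.
  have bern m : 1 + m%:R * eps <= (1 + eps) ^+ m.
    elim: m => [|m IH]; first by rewrite mul0r addr0 expr0.
    rewrite exprSr (@le_trans _ _ ((1 + m%:R * eps) * (1 + eps)))//.
      rewrite -natr1; have : 0 <= m%:R * eps * eps by rewrite !mulr_ge0 ?(ltW eps0).
      by move: (m%:R) => q; lra.
    by rewrite ler_wpM2r//; lra.
  rewrite (le_trans _ (bern _))// (@le_trans _ _ (k%:R * eps))//.
    rewrite -ler_pdivrMr// (le_trans (ltW (truncnS_gt _)))//.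
    by rewrite ler_nat.
  rewrite natrM; have : 0 <= k%:R * eps by rewrite mulr_ge0 ?(ltW eps0).
  by move: (k%:R) => q; lra.
have hu k : (K <= k)%N -> (0 < k)%N -> (u k <= (1 + eps)%:E)%E.
  move=> Kk k0; rewrite /u lee_fin.
  have e1 : 1 + eps = ((1 + eps) ^+ (2 * k)) `^ ((2 * k)%:R^-1).
    rewrite -powR_mulrn; last by lra.
    rewrite -powRrM divff ?powRr1//; first by lra.
    by rewrite pnatr_eq0 muln_eq0/= -lt0n.
  rewrite e1 ge0_ler_powR ?invr_ge0// ?nnegrE ?exprn_ge0//; try lra.
    by apply: sumr_ge0 => a _; rewrite sqr_ge0.
  rewrite -(sum_words_of_size k (fun a => cabs (coefs e x a) ^+ 2)).
  rewrite (le_trans (coefs_bessel _ (words_of_size_uniq n k)))// (le_trans _ (hK _ Kk))//.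
  by rewrite lerDl.
apply: (@le_trans _ _ (ereal_sup (u @` [set k | (maxn K 1 <= k)%N]))).
  apply: ereal_inf_lbound; exists [set k | (maxn K 1 <= k)%N] => //.
  by exists (maxn K 1).
apply: ge_ereal_sup => _ [k /= + <-]; rewrite geq_max => /andP[Kk k1]; exact: hu.
Qed.

Section RowBall.
Variables (H : hilbertType R) (Y : 'I_n -> bop H H).
Let row := \sum_i bop_comp (Y i) (adj (Y i)).

Lemma row_sum_le y : \sum_i nrm (adj (Y i) y) ^+ 2 <= opnorm row * nrm y ^+ 2.
Proof.
have E : (\sum_i nrm (adj (Y i) y) ^+ 2)%:C = inner (row y) y.
  rewrite rmorph_sum bop_sumE inner_suml; apply: eq_bigr => i _ /=.
  by rewrite -inner_nrm [RHS]adjP.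
have := cabs_inner (row y) y; rewrite -E cabsC.
move=> h; rewrite (le_trans (ler_norm _))// (le_trans h)// expr2 mulrA.
by rewrite ler_wpM2r ?nrm_ge0// bop_nrm_le.
Qed.

(** Iterate row_sum_le over the letters: the adjoint of Y_(i a) is the adjoint of
Y_a after that of Y_i. *)
Lemma word_sum_le k y :
  \sum_(a <- words_of_size n k) nrm (adj (op_word Y a) y) ^+ 2 <= opnorm row ^+ k * nrm y ^+ 2.
Proof.
elim: k y => [|k IH] y.
  rewrite (perm_big [:: [::]]).
    by rewrite big_seq1/= adj_id expr0 mul1r.
  apply: uniq_perm => //; first exact: words_of_size_uniq.
  by move=> b; rewrite mem_words_of_size inE; case: b.
rewrite sum_words_recl exprSr -mulrA (le_trans _ (ler_wpM2l _ (row_sum_le y)))//; last first.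
  by rewrite exprn_ge0 ?opnorm_ge0.
rewrite mulr_sumr; apply: ler_sum => i _; apply: le_trans (IH _).
by apply: ler_sum => a _; rewrite /= adj_comp.
Qed.

(** Pair hom_part z with y = hom_part z: this is the sum of x_a <z, adj(Y_a) y>,
bounded by coefs_pairing and word_sum_le. *)
Lemma hom_part_le x k :
  opnorm (hom_part (coefs e x) Y k) <= nrm x * Num.sqrt (opnorm row) ^+ k.
Proof.
set rho := Num.sqrt _; have rho2 : rho ^+ 2 = opnorm row by rewrite sqr_sqrtr ?opnorm_ge0.
apply: opnorm_le_nrm => [|z]; first by rewrite mulr_ge0 ?nrm_ge0 ?exprn_ge0 ?sqrtr_ge0.
set y := hom_part _ _ _ z.
have [->|y0] := eqVneq (nrm y) 0.
  by rewrite !mulr_ge0 ?nrm_ge0 ?exprn_ge0 ?sqrtr_ge0.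
have yp : 0 < nrm y by rewrite lt_neqAle eq_sym y0 nrm_ge0.
have E : (nrm y ^+ 2)%:C = \sum_(a <- words_of_size n k)
    coefs e x a * inner z (adj (op_word Y a) y).
  rewrite -inner_nrm [X in inner X _]bop_sumE inner_suml.
  rewrite -(sum_words_of_size k (fun a => inner ((coefs e x a *: op_word Y a) z) y)).
  by apply: eq_bigr => a _; rewrite bopZE innerZl adjP.
have := coefs_pairing (fun a => inner z (adj (op_word Y a) y)) x (words_of_size_uniq n k).
rewrite -E cabsC ger0_norm ?sqr_ge0// => h1.
have h2 : \sum_(a <- words_of_size n k) cabs (inner z (adj (op_word Y a) y)) ^+ 2 <=
    nrm z ^+ 2 * (opnorm row ^+ k * nrm y ^+ 2).
  rewrite (le_trans _ (ler_wpM2l (sqr_ge0 _) (word_sum_le k y)))// mulr_sumr.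
  apply: ler_sum => a _; rewrite -exprMn ler_pXn2r ?nnegrE ?cabs_ge0 ?mulr_ge0 ?nrm_ge0//.
  exact: cabs_inner.
have h3 := le_trans h1 (ler_wpM2l (sqr_ge0 (nrm x)) h2).
rewrite -(ler_pM2r yp) -(@ler_pXn2r _ 2) ?nnegrE ?mulr_ge0 ?nrm_ge0 ?exprn_ge0 ?sqrtr_ge0//.
rewrite -expr2 (le_trans h3)// !exprMn -rho2 -!exprM (mulnC k) !mulrA.
by rewrite le_eqVlt; apply/orP; left; apply/eqP; ring.
Qed.

Lemma row_ball_cvg x : row_ball 1 Y -> norm_cvg (coefs e x) Y.
Proof.
move=> Y1; have [] := @bop_complete _ _ _ (partial_sum (coefs e x) Y).
  apply: (geometric_cauchy (c := nrm x) (q := Num.sqrt (opnorm row))).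
  - exact: nrm_ge0.
  - exact: sqrtr_ge0.
  - exact: Y1.
  move=> k; rewrite (_ : _ - _ = hom_part (coefs e x) Y k); first exact: hom_part_le.
  by rewrite /partial_sum big_ord_recr/= addrAC subrr add0r.
by move=> T hT; apply/cvg_ex; exists T.
Qed.

End RowBall.
End HolomorphicCase.

Section HolomorphicShift.
Variables (R : realType) (n : nat).
Variables (f : 'I_n -> fps R n) (H2 : hilbertType R) (e : word n -> H2).
Hypothesis e_basis : orthonormal_basis e.
Variable MZ : 'I_n -> bop H2 H2.

Lemma norm_eval_delta (H : hilbertType R) (Y : 'I_n -> bop H H) a :
  norm_eval (delta_fps R a) Y = op_word Y a.
Proof.
have b : fps_degree_le (delta_fps R a) (size a) by move=> c /natr_eq_neq0 ->.
have h := degree_le_norm_value (Y := Y) b; rewrite /norm_eval (norm_cvg_lim h).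
rewrite (bigD1_seq a) ?words_uniq ?mem_words//= /delta_fps eqxx scale1r.
by rewrite big1 ?addr0// => c /negPf ->; rewrite scale0r.
Qed.

(** The difference G of the two coefficient families is free holomorphic on the
unit ball and vanishes after composition with f.  Evaluation is only additive
on convergent series, whence row_ball_cvg. *)
Lemma shift_of_holomorphic (H : hilbertType R) : property_F f e MZ H ->
  exists T, shift_values f e MZ T.
Proof.
move=> [gamma g0 [fh fr finj [_ _ [T [mT hT]]]]].
exists T; split; first exact: model_value_strong.
move=> j a; apply/eqP; rewrite -subr_eq0; apply/eqP.
apply: (coefs_inj e_basis) => b; rewrite [RHS]/coefs inner0l.
move: b; apply: finj; first exact: coefs_free_holomorphic.
move=> X X1; have Y1 := fr X X1; set Y := map_at f X in Y1 *.
have c1 := row_ball_cvg e_basis (x := T j (e a)) Y1.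
have c2 := row_ball_cvg e_basis (x := e (j :: a)) Y1.
have -> : norm_eval (coefs e (T j (e a) - e (j :: a))) Y =
    norm_eval (coefs e (T j (e a))) Y - norm_eval (coefs e (e (j :: a))) Y.
  apply: norm_cvg_lim; rewrite (_ : partial_sum _ Y = (fun N =>
    partial_sum (coefs e (T j (e a))) Y N - partial_sum (coefs e (e (j :: a))) Y N)).
    by apply: cvgB.
  apply/funext => N; rewrite -sumrB; apply: eq_bigr => k _; rewrite -sumrB.
  by apply: eq_bigr => c _; rewrite coefsB scalerBl.
have := hT j (e a) X X1; rewrite /function_at -/Y => ->.
by rewrite !(coefs_e e_basis) !norm_eval_delta subrr.
Qed.

End HolomorphicShift.

Section Shift.
Variables (R : realType) (n : nat).
Variables (f : 'I_n -> fps R n) (H2 : hilbertType R) (e : word n -> H2).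
Hypothesis e_basis : orthonormal_basis e.
Variable MZ : 'I_n -> bop H2 H2.

(** One mode of convergence for the whole tuple, as in the class of f. *)
Definition uniform_values (K : hilbertType R) (Y T : 'I_n -> bop K K) :=
  (forall i, norm_value (f i) Y (T i)) \/ (forall i, norm_radial_value (f i) Y (T i)).

Lemma uniform_valuesE (K : hilbertType R) (Y T : 'I_n -> bop K K) :
  uniform_values Y T -> forall i, uniform_value (f i) Y (T i).
Proof. by move=> [h|h] i; [left|right]. Qed.

(** The norm value that the class of f provides is also a strong value, hence is
the shift by the uniqueness of strong values. *)
Lemma shift_ex H : norm_model_property f e MZ H ->
  exists S, uniform_values MZ S /\ forall j a, S j (e a) = e (j :: a).
Proof.
move=> [mp dom].
have [T [sT hT]] : exists T, shift_values f e MZ T.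
  case: mp; [exact: shift_of_poly|exact: shift_of_formal|exact: shift_of_holomorphic].
exists T; split=> //; case: dom => /choice[S hS]; [left|right] => i.
  rewrite (_ : T i = S i)//; apply: (strong_value_unique (sT i)).
  by apply: uniform_strong; left.
rewrite (_ : T i = S i)//; apply: (strong_value_unique (sT i)).
by apply: uniform_strong; right.
Qed.

End Shift.

(** * Rank one and compact operators in the model algebra *)

Section Totality.
Variables (R : realType) (V W : hilbertType R).
Local Notation C := R[i].

Lemma span_map (T : bop V W) (S : set V) (N : csubspace W) :
  (forall x, S x -> csub_set N (T x)) ->
  forall x, closure (lspan S) x -> csub_set N (T x).
Proof.
move=> h x /nrm_closureP cx; apply: csub_near => e e0.
have c0 : 0 < opnorm T + 1 by rewrite ltr_wpDl ?opnorm_ge0.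
have [y [m [a [s [hs ->]]]] xy] := cx (e / (opnorm T + 1)) ltac:(by rewrite divr_gt0).
exists (T (\sum_i a i *: s i)).
  rewrite linear_sum; elim/big_ind: _ => [|u v Nu Nv|i _].
  - exact: csub0.
  - exact: csubD.
  - by rewrite linearZ; apply/csubZ/h.
rewrite -linearB (le_lt_trans (bop_nrm_le _ _))//.
move: xy; rewrite ltr_pdivlMr//; apply: le_lt_trans.
by rewrite mulrC ler_wpM2l ?nrm_ge0// lerDl.
Qed.

Lemma zero_submod : submod_closed (mem [set 0 : W]).
Proof.
split; first exact: mem_set.
by move=> a x y /set_mem /= -> /set_mem /= ->; apply: mem_set; rewrite scaler0 addr0.
Qed.

Lemma zero_closed : closed [set 0 : W].
Proof.
move=> x /nrm_closureP h; apply: nrm_eq0_lt => e /h[y ->].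
by rewrite subr0.
Qed.

Definition zero_csub : csubspace W := CSubspace zero_submod zero_closed.

Lemma bop_ext_span (S T : bop V W) (D : set V) :
  (forall x, D x -> S x = T x) -> forall x, closure (lspan D) x -> S x = T x.
Proof.
move=> h x Dx; apply/eqP; rewrite -subr_eq0 -bopBE; apply/eqP.
apply: (@span_map (S - T) D zero_csub _ x Dx) => y Dy.
by rewrite bopBE h// subrr.
Qed.

Lemma bop_ext_total (S T : bop V W) (D : set V) : closure (lspan D) = setT ->
  (forall x, D x -> S x = T x) -> S = T.
Proof. by move=> tD h; apply: bopE => x; apply: (bop_ext_span h); rewrite tD. Qed.

End Totality.

Section RankOne.
Variables (R : realType) (V W : hilbertType R).
Local Notation C := R[i].

Lemma rank1_subproof (x : W) (y : V) : (fun z => inner z y *: x) \in @bounded_op R V W.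
Proof.
rewrite inE; split; first by move=> a u v; rewrite inner_linearl scalerDl scalerA.
exists (nrm y * nrm x) => z; rewrite -!nrmC -rmorphM lecR nrmZ.
rewrite [leLHS]mulrC (mulrC (nrm y)) -mulrA ler_wpM2l ?nrm_ge0// mulrC.
exact: cabs_inner.
Qed.

Definition rank1 (x : W) (y : V) : bop V W := Bop (rank1_subproof x y).

Lemma rank1E x y z : rank1 x y z = inner z y *: x.
Proof. by []. Qed.

Lemma opnorm_rank1 x y : opnorm (rank1 x y) <= nrm x * nrm y.
Proof.
apply: opnorm_le_nrm => [|z]; first by rewrite mulr_ge0 ?nrm_ge0.
by rewrite rank1E nrmZ mulrC -mulrA ler_wpM2l ?nrm_ge0// mulrC cabs_inner.
Qed.

Lemma rank1_comb a x x' y : rank1 (a *: x + x') y = a *: rank1 x y + rank1 x' y.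
Proof. by apply: bopE => z; rewrite bopDE bopZE !rank1E scalerDr !scalerA mulrC. Qed.

Lemma rank1Z a x y : rank1 (a *: x) y = a *: rank1 x y.
Proof. by apply: bopE => z; rewrite bopZE !rank1E !scalerA mulrC. Qed.

Lemma rank1B x x' y : rank1 (x - x') y = rank1 x y - rank1 x' y.
Proof. by apply: bopE => z; rewrite bopBE !rank1E scalerBr. Qed.

End RankOne.

Section RankOneAlgebra.
Variables (R : realType) (V : hilbertType R).

Lemma adj_rank1 (x y : V) : adj (rank1 x y) = rank1 y x.
Proof.
apply: adj_unique => u v; rewrite !rank1E innerZl innerZr.
by rewrite (inner_conj v x) mulrC.
Qed.

Lemma comp_rank1 (T : bop V V) (x y : V) : bop_comp T (rank1 x y) = rank1 (T x) y.
Proof. by apply: bopE => z; rewrite bop_compE !rank1E linearZ. Qed.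

Lemma rank1_rank1 (x y z w : V) :
  bop_comp (rank1 x y) (rank1 z w) = inner z y *: rank1 x w.
Proof.
apply: bopE => u; rewrite bop_compE bopZE !rank1E innerZl scalerA.
by rewrite mulrC.
Qed.

End RankOneAlgebra.

Section CompactApproximation.
Variables (R : realType) (V : hilbertType R) (I : choiceType) (e : I -> V).
Local Notation C := R[i].
Hypothesis e_basis : orthonormal_basis e.

(** Best approximation by orthogonal projection. *)
Lemma fourier_le (s : seq I) (d : I -> C) (x : V) : uniq s ->
  nrm (x - \sum_(a <- s) inner x (e a) *: e a) <= nrm (x - \sum_(a <- s) d a *: e a).
Proof.
move=> us; set p := \sum_(a <- s) _; set y := \sum_(a <- s) d a *: _.
have h a : a \in s -> inner (x - p) (e a) = 0.
  move=> as_; rewrite innerBl inner_suml (bigD1_seq a)//= innerZl (onb_orth e_basis) eqxx mulr1.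
  rewrite big1 ?addr0 ?subrr// => b ba.
  by rewrite innerZl (onb_orth e_basis) (negPf ba) mulr0.
have o : inner (x - p) (p - y) = 0.
  rewrite /p /y -sumrB inner_sumr big_seq big1// => a as_.
  by rewrite -scalerBl innerZr h// mulr0.
rewrite -(@ler_pXn2r _ 2) ?nnegrE ?nrm_ge0//.
have -> : x - y = (x - p) + (p - y) by rewrite addrA subrK.
by rewrite (nrmD2_orth o) lerDl sqr_ge0.
Qed.

(** Finitely many balls of radius eps / 2 cover the image of the unit ball.  Their
centers are within eps / 2 of the span of finitely many basis vectors, and the
projection P to that span approximates T, since P T = sum_a e_a (x) adj(T) e_a. *)
Lemma compact_approx (T : bop V V) : compact_op T -> forall eps : R, 0 < eps ->
  exists s : seq I, opnorm (T - \sum_(a <- s) rank1 (e a) (adj T (e a))) <= eps.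
Proof.
rewrite /compact_op precompactE => cT eps eps0.
have e2 : 0 < eps / 2 by rewrite divr_gt0.
set K := closure _ in cT.
have cov : K `<=` cover setT (fun x : V => ball x (eps / 2)%:C).
  by move=> x Kx; exists x => //; apply: ballxx; rewrite ltcR.
have [D' _ covD] : finite_subset_cover setT (fun x : V => ball x (eps / 2)%:C) K.
  move: cT; rewrite compact_cover; apply=> // x _.
  by apply: ball_open; rewrite ltcR.
have app x : exists m : seq I * (I -> C), uniq m.1 /\
    nrm (x - \sum_(a <- m.1) m.2 a *: e a) < eps / 2.
  have /nrm_closureP cx : closure (lspan (range e)) x by rewrite (onb_total e_basis).
  have [y /lspan_rangeP[m [a [t ->]]] xy] := cx _ e2.
  (* collect the repeated vectors of a combination *)
  exists (undup [seq t i | i <- enum 'I_m], fun w => \sum_(i | t i == w) a i).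
  rewrite undup_uniq/=; split=> //; apply: le_lt_trans xy.
  rewrite le_eqVlt; apply/orP; left; apply/eqP; congr (nrm (_ - _)).
  under eq_bigr => w _ do rewrite scaler_suml.
  rewrite (exchange_big_dep xpredT)//=; apply: eq_bigr => i _.
  rewrite -big_filter (@perm_big _ _ _ _ _ [:: t i]) ?big_seq1//.
  apply: uniq_perm; rewrite ?filter_uniq ?undup_uniq// => w.
  rewrite mem_filter mem_undup inE eq_sym; apply: andb_idr => /eqP ->.
  by rewrite map_f// mem_enum.
have [m hm] := choice app.
pose s := undup (flatten [seq (m x).1 | x <- enum_fset D']).
have us : uniq s by exact: undup_uniq.
exists s; apply: opnorm_le_nrm => [|x]; first exact: ltW.
have unit y : nrm y <= 1 -> nrm (T y - \sum_(a <- s) inner (T y) (e a) *: e a) <= eps.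
  move=> y1; have KTy : K (T y).
    by apply: subset_closure; exists y => //=; rewrite -nrmC lecR.
  have [z /= zD zT] := covD _ KTy; have [uz xz] := hm z.
  (* the combination approximating z, extended by 0 to s *)
  pose d a := if a \in (m z).1 then (m z).2 a else 0.
  apply: (le_trans (fourier_le d _ us)).
  have -> : \sum_(a <- s) d a *: e a = \sum_(a <- (m z).1) (m z).2 a *: e a.
    rewrite (bigID (fun a => a \in (m z).1))/= [X in _ + X]big1 ?addr0; last first.
      by move=> a /negPf az; rewrite /d az scale0r.
    rewrite -big_filter; rewrite (@perm_big _ _ _ _ _ (m z).1).
      by apply: eq_big_seq => a az; rewrite /d az.
    apply: uniq_perm; rewrite ?filter_uniq// => a; rewrite mem_filter mem_undup.
    by apply: andb_idr => az; apply/flatten_mapP; exists z.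
  rewrite (le_trans (nrm_triangle z _ _))// [leRHS]splitr lerD ?(ltW xz)//.
  by move: zT; rewrite -ball_normE /= -nrmC ltcR nrmB => /ltW.
set D := T - _.
have DE y : D y = T y - \sum_(a <- s) inner (T y) (e a) *: e a.
  rewrite bopBE bop_sumE; congr (_ - _); apply: eq_bigr => a _.
  by rewrite rank1E -adjP.
have [x0|x0] := eqVneq (nrm x) 0.
  by rewrite (nrm_eq0 x0) linear0 !nrm0 mulr0.
have xp : 0 < nrm x by rewrite lt_neqAle eq_sym x0 nrm_ge0.
have := unit ((nrm x)^-1%:C *: x); rewrite -DE linearZ/= !nrmZ cabsC.
rewrite ger0_norm ?invr_ge0 ?nrm_ge0// mulVf// => /(_ (lexx _)).
by rewrite mulrC ler_pdivrMr.
Qed.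

End CompactApproximation.

Section Model.
Variables (R : realType) (n : nat).
Local Notation C := R[i].
Variables (f : 'I_n -> fps R n) (H2 : hilbertType R) (e : word n -> H2).
Hypothesis e_basis : orthonormal_basis e.
Variables (MZ S : 'I_n -> bop H2 H2).
Hypothesis S_val : uniform_values f MZ S.
Hypothesis S_shift : forall j a, S j (e a) = e (j :: a).

Local Notation A := (model_algebra MZ).
Local Notation e0 := (e [::]).

Lemma model_algebra_cstar : cstar_subalgebra A.
Proof.
split.
- by move=> B [[]].
- by move=> a X Y AX AY B hB; case: (hB) => -[_ h _ _ _] _; apply: h; [exact: AX|exact: AY].
- by move=> X Y AX AY B hB; case: (hB) => -[_ _ h _ _] _; apply: h; [exact: AX|exact: AY].
- by move=> X AX B hB; case: (hB) => -[_ _ _ h _] _; apply: h; exact: AX.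
- move=> X cX B hB; case: (hB) => -[_ _ _ _ h] _; apply: h.
  by apply: closureS cX => Y; exact.
Qed.

Lemma model_algebra_gen i : A (MZ i).
Proof. by move=> B [_]; apply; exists i. Qed.

Lemma shift_mem j : A (S j).
Proof.
apply: (uniform_value_mem model_algebra_cstar model_algebra_gen).
exact: (uniform_valuesE S_val j).
Qed.

Lemma shift_adj0 j : adj (S j) e0 = 0.
Proof.
apply: (coefs_inj e_basis) => a; rewrite /coefs adjPl S_shift (onb_orth e_basis) inner0l.
by [].
Qed.

Lemma shift_adj i j a : adj (S j) (e (i :: a)) = (i == j)%:R *: e a.
Proof.
apply: (coefs_inj e_basis) => b; rewrite /coefs adjPl S_shift (onb_orth e_basis).
by rewrite innerZl (onb_orth e_basis) eqseq_cons -mulnb natrM.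
Qed.

(** The ranges of the S_j are spanned by the e_a with a nonempty. *)
Lemma vacuum_projection : bop_id H2 - \sum_j bop_comp (S j) (adj (S j)) = rank1 e0 e0.
Proof.
apply: (bop_ext_total (onb_total e_basis)) => _ [a _ <-].
rewrite bopBE bop_sumE rank1E (onb_orth e_basis); case: a => [|i a] /=.
  rewrite big1 ?subr0 ?scale1r// => j _.
  by rewrite ?bop_compE shift_adj0 linear0.
rewrite scale0r (bigD1 i)//= big1 ?addr0; last first.
  move=> j ji; rewrite ?bop_compE shift_adj eq_sym (negPf ji) scale0r.
  by rewrite linear0.
by rewrite ?bop_compE shift_adj eqxx scale1r S_shift subrr.
Qed.

Lemma vacuum_mem : A (rank1 e0 e0).
Proof.
have hA := model_algebra_cstar.
rewrite -vacuum_projection; apply: (algB hA); first exact: (alg_id hA).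
apply: (alg_sum hA) => j; apply: (alg_comp hA); first exact: shift_mem.
by apply: (cstar_adj hA); exact: shift_mem.
Qed.

(** For x = e_a this is S_a composed with the vacuum projection; other x are
limits of combinations of the e_a. *)
Lemma rank1_vacuum_mem x : A (rank1 x e0).
Proof.
have hA := model_algebra_cstar.
have he a : A (rank1 (e a) e0).
  elim: a => [|j a IH]; first exact: vacuum_mem.
  by rewrite -S_shift -comp_rank1; apply: (alg_comp hA) => //; exact: shift_mem.
apply: (alg_near hA) => eps eps0.
have /nrm_closureP cx : closure (lspan (range e)) x by rewrite (onb_total e_basis).
have [y [m [a [s [hs ->]]]] xy] := cx eps eps0.
exists (rank1 (\sum_i a i *: s i) e0).
  elim/big_rec: _ => [|i z _ Az].
    have -> : rank1 (0 : H2) e0 = 0 by apply: bopE => u; rewrite rank1E scaler0.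
    exact: (alg0 hA).
  rewrite rank1_comb; apply: (alg_comb hA) => //.
  by have [b _ <-] := hs i.
rewrite -rank1B nrm_bop (le_lt_trans (opnorm_rank1 _ _))// (onb_nrm e_basis) mulr1.
exact: xy.
Qed.

Lemma rank1_mem x y : A (rank1 x y).
Proof.
have hA := model_algebra_cstar.
have -> : rank1 x y = bop_comp (rank1 x e0) (adj (rank1 y e0)).
  by rewrite adj_rank1 rank1_rank1 (onb_orth e_basis) eqxx scale1r.
apply: (alg_comp hA); first exact: rank1_vacuum_mem.
by apply: (cstar_adj hA); exact: rank1_vacuum_mem.
Qed.

Lemma compact_mem X : compact_op X -> A X.
Proof.
have hA := model_algebra_cstar.
move=> cX; apply: (alg_near hA) => eps eps0.
have [s hs] := compact_approx e_basis cX (eps := eps / 2) ltac:(by rewrite divr_gt0).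
exists (\sum_(a <- s) rank1 (e a) (adj X (e a))).
  by apply: (alg_sum hA) => a; exact: rank1_mem.
by rewrite nrm_bop (le_lt_trans hs)//; lra.
Qed.

(** The operators preserving the closed span M of the (M_Z)_a e_0 form a closed
algebra containing M_Z, hence the S_j, and e_0 is in M. *)
Lemma model_cyclic : closure (lspan [set x | exists a, x = op_word MZ a e0]) = setT.
Proof.
set D := [set x | _]; pose M := closed_span D.
pose L := [set T : bop H2 H2 | forall x, csub_set M x -> csub_set M (T x)].
have hL : closed_subalgebra L.
  split.
  - by move=> x.
  - by move=> a X Y LX LY x Mx; rewrite bopDE bopZE; apply: csub_comb; [exact: LX|exact: LY].
  - by move=> X Y LX LY x Mx; apply/LX/LY.
  move=> X /nrm_closureP cX x Mx; apply: csub_near => eps eps0.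
  have c0 : 0 < nrm x + 1 by rewrite ltr_wpDl ?nrm_ge0.
  have [Y LY XY] := cX (eps / (nrm x + 1)) ltac:(by rewrite divr_gt0).
  exists (Y x); first exact: LY.
  rewrite -bopBE (le_lt_trans (bop_nrm_le _ _))//.
  move: XY; rewrite nrm_bop ltr_pdivlMr//; apply: le_lt_trans.
  by rewrite ler_wpM2l ?opnorm_ge0// lerDl.
have LMZ i : L (MZ i).
  move=> x Mx; apply: (@span_map _ _ _ (MZ i) D M _ x Mx) => _ [a ->].
  by apply: span_incl; exists (i :: a).
have LS j : L (S j).
  by apply: (uniform_value_mem hL LMZ); exact: (uniform_valuesE S_val j).
have Me a : csub_set M (e a).
  elim: a => [|j a IH]; first by apply: span_incl; exists [::].
  by rewrite -S_shift; apply: LS.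
apply/seteqP; split=> // x _.
have : closure (lspan (range e)) x by rewrite (onb_total e_basis).
by apply: (@csub_span _ _ M) => _ [a _ <-].
Qed.

End Model.

(** * The Wold decomposition of a representation *)

Section Restriction.
Variables (R : realType) (K : hilbertType R) (M : csubspace K).

Lemma sub_valP (x : sub_hilbert M) : csub_set M (sub_val x).
Proof. by case: x => x /= /set_mem. Qed.

Definition to_sub (x : K) (Mx : csub_set M x) : sub_hilbert M := SubHilbert (mem_set Mx).

Lemma sub_val_inj (x y : sub_hilbert M) : sub_val x = sub_val y -> x = y.
Proof. exact: val_inj. Qed.

Lemma sub_innerE (x y : sub_hilbert M) : inner x y = inner (sub_val x) (sub_val y).
Proof. by []. Qed.

Lemma sub_nrmE (x : sub_hilbert M) : nrm x = nrm (sub_val x).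
Proof. by []. Qed.

(** Meaningful for operators that leave M invariant, and 0 otherwise; a total
function of the operator is what a representation on M requires. *)
Definition restriction (T : bop K K) : bop (sub_hilbert M) (sub_hilbert M) :=
  xget 0 [set T' : bop (sub_hilbert M) (sub_hilbert M) |
    forall x : sub_hilbert M, sub_val (T' x) = T (sub_val x)].

Lemma restrictionE (T : bop K K) : (forall x, csub_set M x -> csub_set M (T x)) ->
  forall x : sub_hilbert M, sub_val (restriction T x) = T (sub_val x).
Proof.
move=> h; have [||T' hT'] := @mk_bop _ _ _
    (fun x : sub_hilbert M => to_sub (h _ (sub_valP x))) (opnorm T).
- by move=> a x y; apply: sub_val_inj; rewrite /= linearP.
- by move=> x; rewrite !sub_nrmE; exact: bop_nrm_le.
apply: (@xgetI _ 0 [set T' : bop (sub_hilbert M) (sub_hilbert M) |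
    forall x : sub_hilbert M, sub_val (T' x) = T (sub_val x)] T') => x.
by rewrite hT'.
Qed.

Lemma basis_sub (B : set K) : basis_of_subspace (csub_set M) B ->
  basis_of_subspace [set: sub_hilbert M] (@sub_val R K M @^-1` B) /\
  ((@sub_val R K M @^-1` B) #= B)%card.
Proof.
move=> [BM oB MB]; split.
  split=> // [x y Bx By|x _]; first by rewrite sub_innerE oB.
  apply: closure_lspanP => y yB; rewrite sub_innerE inner_conj.
  rewrite (@closure_orth _ _ B) ?rmorph0//; last exact/MB/sub_valP.
  by move=> z Bz; exact: (yB (to_sub (BM z Bz))).
have E : @sub_val R K M @` (@sub_val R K M @^-1` B) = B.
  apply/seteqP; split=> [_ [x Bx <-]//|x Bx].
  by exists (to_sub (BM x Bx)).
rewrite -[X in (_ #= X)%card]E card_eq_sym; apply: inj_card_eq.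
by move=> x y _ _; exact: sub_val_inj.
Qed.

Section Representation.
Variables (V : hilbertType R) (A : set (bop V V)) (pi : bop V V -> bop K K).
Hypothesis hA : cstar_subalgebra A.
Hypothesis hpi : star_rep A pi.
Hypothesis inv : forall X, A X -> forall x, csub_set M x -> csub_set M (pi X x).

Definition sub_rep (X : bop V V) := restriction (pi X).

Lemma sub_repE X : A X -> forall x, sub_val (sub_rep X x) = pi X (sub_val x).
Proof. by move=> AX; apply: restrictionE; exact: inv. Qed.

Lemma sub_rep_star : star_rep A sub_rep.
Proof.
split.
- move=> a X Y AX AY; apply: bopE => x; apply: sub_val_inj.
  rewrite sub_repE; last exact: (alg_comb hA).
  by rewrite (repZD hpi)//= !sub_repE.
- move=> X Y AX AY; apply: bopE => x; apply: sub_val_inj.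
  rewrite sub_repE; last exact: (alg_comp hA).
  by rewrite (repM hpi)//= !sub_repE.
- move=> X AX; apply/esym/adj_unique => x y.
  rewrite !sub_innerE !sub_repE//; last exact: (cstar_adj hA).
  by rewrite adjP (rep_adj hpi).
Qed.

Lemma sub_rep_unital : pi (bop_id V) = bop_id K ->
  sub_rep (bop_id V) = bop_id (sub_hilbert M).
Proof.
move=> h; apply: bopE => x; apply: sub_val_inj.
by rewrite sub_repE ?h//; exact: (alg_id hA).
Qed.

End Representation.
End Restriction.

(** pi(1) is the identity on the vectors pi(X) k, which are total. *)
Lemma nondegenerate_unital (R : realType) (V K : hilbertType R)
    (A : set (bop V V)) (pi : bop V V -> bop K K) :
  cstar_subalgebra A -> star_rep A pi -> nondegenerate_rep A pi ->
  pi (bop_id V) = bop_id K.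
Proof.
move=> hA hpi nd; apply: (bop_ext_total nd) => _ [X [k [AX ->]]].
rewrite -bop_compE -(repM hpi)//; last exact: (alg_id hA).
by congr (pi _ k); apply: bopE.
Qed.

Section Decomposition.
Variables (R : realType) (n : nat).
Local Notation C := R[i].
Variables (f : 'I_n -> fps R n) (H2 : hilbertType R) (e : word n -> H2).
Hypothesis e_basis : orthonormal_basis e.
Variables (MZ S : 'I_n -> bop H2 H2).
Hypothesis S_val : uniform_values f MZ S.
Hypothesis S_shift : forall j a, S j (e a) = e (j :: a).

Local Notation A := (model_algebra MZ).
Local Notation e0 := (e [::]).
Let hA : cstar_subalgebra A.
Proof. exact: model_algebra_cstar. Qed.
Let r1A x y : A (rank1 x y).
Proof. exact: (rank1_mem e_basis S_val S_shift). Qed.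
Let SA j : A (S j).
Proof. exact: (shift_mem S_val). Qed.
Let AZ i : A (MZ i).
Proof. exact: model_algebra_gen. Qed.

Section UnitalRep.
Variables (K : hilbertType R) (pi : bop H2 H2 -> bop K K).
Hypothesis hpi : star_rep A pi.
Hypothesis pi1 : pi (bop_id H2) = bop_id K.

Lemma rep_values : uniform_values f (pi \o MZ) (pi \o S).
Proof.
case: S_val => h; [left|right] => i.
  by apply: (rep_norm_value hA hpi pi1 AZ); exact: h.
by apply: (rep_radial_value hA hpi pi1 AZ); exact: h.
Qed.

Lemma rep_domain : in_norm_domain f (pi \o MZ).
Proof. by case: rep_values => h; [left|right] => i; exists (pi (S i)). Qed.

Lemma rep_row_square :
  row_square f (pi \o MZ) = pi (\sum_i bop_comp (S i) (adj (S i))).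
Proof.
have AS i : A (bop_comp (S i) (adj (S i))).
  by apply: (alg_comp hA) => //; exact: (cstar_adj hA).
rewrite (rep_sum hA hpi)//; apply: eq_bigr => i _.
rewrite (series_atE (uniform_valuesE rep_values i)) /= (repM hpi) ?(rep_adj hpi)//.
exact: (cstar_adj hA).
Qed.

(** Representations commute with the evaluation of the f_i, because they are
contractive. *)
Lemma rep_defectE : rep_defect f MZ pi = pi (rank1 e0 e0).
Proof.
rewrite /rep_defect rep_row_square -pi1 -(repB hpi).
- by rewrite (vacuum_projection e_basis S_shift).
- exact: (alg_id hA).
- apply: (alg_sum hA) => i; apply: (alg_comp hA) => //; exact: (cstar_adj hA).
Qed.

End UnitalRep.

Section OneRep.
Variables (K : hilbertType R) (pi : bop H2 H2 -> bop K K).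
Hypothesis hpi : star_rep A pi.
Hypothesis pi1 : pi (bop_id H2) = bop_id K.

Local Notation Q := (rep_defect f MZ pi).
Local Notation K0 := (space0 f MZ pi).
Local Notation K1 := (space1 f MZ pi).

Let gens := [set x | exists (a : word n) (k : K), x = pi (op_word MZ a) (Q k)].

Let QE : Q = pi (rank1 e0 e0).
Proof. exact: (rep_defectE hpi pi1). Qed.

Let opA a : A (op_word MZ a).
Proof. exact: (op_word_mem _ hA AZ). Qed.

Lemma rep_rank1 X x y k : A X -> pi X (pi (rank1 x y) k) = pi (rank1 (X x) y) k.
Proof. by move=> AX; rewrite -bop_compE -(repM hpi)// comp_rank1. Qed.

Lemma gensE a k : pi (op_word MZ a) (Q k) = pi (rank1 (op_word MZ a e0) e0) k.
Proof. by rewrite QE rep_rank1. Qed.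

Lemma rank1_e0 x k : pi (rank1 x e0) (Q k) = pi (rank1 x e0) k.
Proof.
rewrite QE rep_rank1// rank1E (onb_orth e_basis) eqxx scale1r.
by [].
Qed.

Lemma defect_idem k : Q (Q k) = Q k.
Proof. by have := rank1_e0 e0 k; rewrite -!QE. Qed.

(** The composite of adj(y (x) e_0) and x (x) e_0 is <x, y> e_0 (x) e_0, and Q g = g. *)
Lemma rank1_inner x y g h : Q g = g ->
  inner (pi (rank1 x e0) g) (pi (rank1 y e0) h) = inner x y * inner g h.
Proof.
move=> Qg; rewrite -adjPl -(rep_adj hpi)// adj_rank1 rep_rank1// rank1E rank1Z.
by rewrite (repZ hA hpi)// bopZE innerZl -QE Qg.
Qed.

(** The defining vectors of K_0 are the pi(x (x) e_0) k with x = (M_Z)_a e_0, and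
these x are total. *)
Lemma space0_rank1 x k : csub_set K0 (pi (rank1 x e0) k).
Proof.
have [||T hT] := @mk_bop _ _ _ (fun x => pi (rank1 x e0) k) (nrm k).
- by move=> a u v; rewrite rank1_comb (repZD hpi).
- move=> u; rewrite (le_trans (bop_nrm_le _ _))// mulrC ler_wpM2l ?nrm_ge0//.
  rewrite (le_trans (rep_contractive hA hpi pi1 _))//.
  by rewrite (le_trans (opnorm_rank1 _ _))// (onb_nrm e_basis) mulr1.
rewrite -hT; apply: (@span_map _ _ _ T [set x | exists a, x = op_word MZ a e0]).
  move=> _ [a ->]; rewrite hT -gensE; apply: span_incl.
  by exists a, k.
by rewrite (model_cyclic e_basis S_val S_shift).
Qed.

Lemma space0_inv X : A X -> forall x, csub_set K0 x -> csub_set K0 (pi X x).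
Proof.
move=> AX x K0x; apply: (@span_map _ _ _ (pi X) gens K0 _ x K0x) => _ [a [k ->]].
by rewrite gensE rep_rank1//; exact: space0_rank1.
Qed.

Lemma space1_inv X : A X -> forall x, csub_set K1 x -> csub_set K1 (pi X x).
Proof.
move=> AX x K1x y K0y; rewrite adjP -(rep_adj hpi)//; apply: K1x.
by apply: space0_inv => //; exact: (cstar_adj hA).
Qed.

Lemma space0_eq0 y : csub_set K0 y ->
  (forall x k, inner y (pi (rank1 x e0) (Q k)) = 0) -> y = 0.
Proof.
move=> K0y h; apply: inner_self_eq0; apply: (@closure_orth _ _ gens) => // _ [a [k ->]].
by rewrite gensE -rank1_e0.
Qed.

(** pi(x (x) y) maps every vector into K_0, since x (x) y factors through x (x) e_0,
and it leaves K_1 invariant. *)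
Lemma space1_rank1 x y k : csub_set K1 k -> pi (rank1 x y) k = 0.
Proof.
move=> K1k; set z := pi _ k.
have K1z : csub_set K1 z by exact: space1_inv.
have K0z : csub_set K0 z.
  rewrite /z (_ : rank1 x y = bop_comp (rank1 x e0) (rank1 e0 y)).
    by rewrite (repM hpi)//; exact: space0_rank1.
  by rewrite rank1_rank1 (onb_orth e_basis) eqxx scale1r.
by apply: inner_self_eq0; exact: K1z.
Qed.

(** The part of pi that is a multiple of the identity representation. *)
Definition shift_part : bop H2 H2 -> bop (sub_hilbert K0) (sub_hilbert K0) := @sub_rep R K K0 H2 pi.
(** The part of pi that factors through the quotient by the compact operators. *)
Definition residual_part : bop H2 H2 -> bop (sub_hilbert K1) (sub_hilbert K1) := @sub_rep R K K1 H2 pi.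

Lemma shift_partE X : A X -> forall x : sub_hilbert K0, sub_val (shift_part X x) = pi X (sub_val x).
Proof. exact: (sub_repE space0_inv). Qed.

Lemma residual_partE X : A X -> forall x : sub_hilbert K1, sub_val (residual_part X x) = pi X (sub_val x).
Proof. exact: (sub_repE space1_inv). Qed.

Lemma shift_part_star : star_rep A shift_part.
Proof. exact: (sub_rep_star hA hpi space0_inv). Qed.

Lemma residual_part_star : star_rep A residual_part.
Proof. exact: (sub_rep_star hA hpi space1_inv). Qed.

Lemma residual_part_unital : residual_part (bop_id H2) = bop_id (sub_hilbert K1).
Proof. exact: (sub_rep_unital hA space1_inv pi1). Qed.

Lemma residual_part_rank1 x y : residual_part (rank1 x y) = 0.
Proof.
apply: bopE => k; apply: sub_val_inj; rewrite residual_partE// space1_rank1//.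
exact: sub_valP.
Qed.

Lemma residual_part_compact X : compact_op X -> residual_part X = 0.
Proof.
move=> cX; apply: nrm_eq0_lt => eps eps0.
have [s hs] := compact_approx e_basis cX (eps := eps / 2) ltac:(by rewrite divr_gt0).
set Y := \sum_(a <- s) _ in hs.
have AY : A Y by apply: (alg_sum hA) => a; exact: r1A.
have AX := compact_mem e_basis S_val S_shift cX.
have Y0 : residual_part Y = 0.
  by rewrite (rep_sum hA residual_part_star)// big1// => a _; exact: residual_part_rank1.
have AXY : A (X - Y) by exact: (algB hA).
have := rep_contractive hA residual_part_star residual_part_unital AXY.
rewrite (repB residual_part_star)// Y0 subr0 nrm_bop; lra.
Qed.

Lemma rep_sum01 : direct_sum_rep A pi shift_part residual_part.
Proof.
split.
- by move=> x y K0x K1y; rewrite inner_conj K1y// rmorph0.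
- move=> k; have [p [q [K0p K1q ->]]] := orth_decomp K0 k.
  by exists (to_sub K0p), (to_sub K1q).
- by move=> X AX x y; rewrite linearD/= shift_partE// residual_partE.
Qed.

(** The rank one operators e_0 (x) y kill tau, hence sigma; so the vectors of M are
orthogonal to all pi(y (x) e_0) k, which are total in K_0. *)
Lemma rep_disjoint : disjoint_reps A shift_part residual_part.
Proof.
move=> M N sigma tau hs ht [U [Uiso _] hU].
apply/seteqP; split=> [m Mm|_ ->]; last exact: csub0.
pose x := to_sub Mm; rewrite /=; apply: sub_val_inj.
have sx y : sigma (rank1 e0 y) x = 0.
  apply: inner_all0 => z; rewrite -Uiso -bop_compE hU// bop_compE.
  have -> : tau (rank1 e0 y) (U x) = 0; last by rewrite inner0l.
  by apply: sub_val_inj; rewrite ht// residual_part_rank1.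
apply: space0_eq0; first exact: sub_valP.
move=> y k; have := hs _ (r1A e0 y) x; rewrite sx => /(congr1 (@sub_val R K K0)).
rewrite shift_partE// => /esym h.
have -> : rank1 y e0 = adj (rank1 e0 y) by rewrite adj_rank1.
by rewrite (rep_adj hpi)// -adjP h inner0l.
Qed.

(** The range of Q is already closed, Q being a projection; taking the closed span
spares the proof. *)
Definition multiplicity : csubspace K := closed_span (range Q).

Lemma multiplicity_fix g : csub_set multiplicity g -> Q g = g.
Proof.
move=> Gg; apply: (@bop_ext_span _ _ _ Q (bop_id K) (range Q)) => // _ [k _ <-].
exact: defect_idem.
Qed.

Lemma multiplicity_dim :
  same_hilbert_dim [set: sub_hilbert multiplicity] (range Q).
Proof.
have [B hB] := onb_ex multiplicity; have [h1 h2] := basis_sub hB.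
case: hB => BM oB MB; exists (@sub_val R K multiplicity @^-1` B), B; split=> //.
split=> //.
  by move=> b /BM /multiplicity_fix <-; exists b.
by move=> x Qx; apply: MB; exact: span_incl.
Qed.

Definition tensor (x : H2) (g : sub_hilbert multiplicity) : sub_hilbert K0 :=
  to_sub (@space0_rank1 x (sub_val g)).

Lemma tensor_hilbert : hilbert_tensor tensor.
Proof.
split.
- move=> g a x y; apply: sub_val_inj.
  by rewrite /= rank1_comb (repZD hpi).
- by move=> x a g h; apply: sub_val_inj; rewrite /= linearP.
- move=> x y g h; rewrite sub_innerE /= rank1_inner//.
  exact/multiplicity_fix/sub_valP.
- apply/seteqP; split=> // z _; apply: closure_lspanP => y hy.
  have -> : y = 0; last by rewrite inner0r.
  apply: sub_val_inj; apply: space0_eq0; first exact: sub_valP.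
  move=> x k; have Qk : csub_set multiplicity (Q k) by apply: span_incl; exists k.
  by apply: (hy (tensor x (to_sub Qk))); exists x, (to_sub Qk).
Qed.

(** K_0 is itself a Hilbert tensor product of H2 and the multiplicity space, so
the identity serves as the unitary. *)
Lemma rep_tensor : exists (T : hilbertType R) (t : H2 -> sub_hilbert multiplicity -> T)
      (U : bop (sub_hilbert K0) T),
    [/\ hilbert_tensor t, unitary U &
      forall X, A X -> exists Y : bop T T,
        ampliation t X Y /\ bop_comp U (shift_part X) = bop_comp Y U].
Proof.
exists (sub_hilbert K0), tensor, (bop_id _); split.
- exact: tensor_hilbert.
- split=> //; apply/seteqP; split=> // x _; by exists x.
move=> X AX; exists (shift_part X); split; last exact: bopE.
by move=> x g; apply: sub_val_inj; rewrite shift_partE//= rep_rank1.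
Qed.

Lemma rep_wold : wold_decomposition shift_part residual_part (sub_hilbert multiplicity).
Proof.
split.
- exact: shift_part_star.
- exact: residual_part_star.
- exact: rep_sum01.
- exact: rep_disjoint.
- exact: rep_tensor.
- exact: multiplicity_dim.
- move=> X cX; split; last exact: residual_part_compact.
  exact: (compact_mem e_basis S_val S_shift).
- exact: (rep_domain residual_part_star residual_part_unital).
- rewrite (rep_row_square residual_part_star residual_part_unital).
  have -> : \sum_i bop_comp (S i) (adj (S i)) = bop_id H2 - rank1 e0 e0.
    by rewrite -(vacuum_projection e_basis S_shift) opprB addrC subrK.
  rewrite (repB residual_part_star)//; last exact: (alg_id hA).
  by rewrite residual_part_unital residual_part_rank1 subr0.
Qed.

End OneRep.
End Decomposition.

(** * Unitary equivalence of representations *)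

Lemma unitary_basis (R : realType) (K L : hilbertType R) (U : bop K L)
    (M B : set K) (N : set L) :
  (forall x y, inner (U x) (U y) = inner x y) -> U @` M = N ->
  basis_of_subspace M B -> basis_of_subspace N (U @` B) /\ (U @` B #= B)%card.
Proof.
move=> Ui UM [BM oB MB].
have Uinj x y : U x = U y -> x = y.
  by move=> Uxy; apply: inner_inj => z; rewrite -Ui Uxy Ui.
split; last by apply: inj_card_eq => x y _ _; exact: Uinj.
split.
- by rewrite -UM; exact: image_subset.
- move=> _ _ [x Bx <-] [y By <-]; rewrite Ui oB//.
  by have [->|xy] := eqVneq x y; rewrite ?eqxx//; case: eqP => // /Uinj /eqP; rewrite (negPf xy).
- rewrite -UM => _ [x Mx <-].
  apply: (@span_map _ _ _ U B (closed_span (U @` B)) _ x (MB x Mx)) => b Bb.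
  by apply: span_incl; exists b.
Qed.

Section WoldData.
Variables (R : realType) (n : nat).
Local Notation C := R[i].
Variables (f : 'I_n -> fps R n) (H2 : hilbertType R) (e : word n -> H2).
Hypothesis e_basis : orthonormal_basis e.
Variables (MZ S : 'I_n -> bop H2 H2).
Hypothesis S_val : uniform_values f MZ S.
Hypothesis S_shift : forall j a, S j (e a) = e (j :: a).

Local Notation A := (model_algebra MZ).
Local Notation e0 := (e [::]).
Let hA : cstar_subalgebra A.
Proof. exact: model_algebra_cstar. Qed.
Let r1A x y : A (rank1 x y).
Proof. exact: (rank1_mem e_basis S_val S_shift). Qed.
Let AZ i : A (MZ i).
Proof. exact: model_algebra_gen. Qed.

Section OneSide.
Variables (K : hilbertType R) (pi : bop H2 H2 -> bop K K).
Local Notation K0 := (space0 f MZ pi).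
Local Notation K1 := (space1 f MZ pi).
Variables (pi0 : bop H2 H2 -> bop (sub_hilbert K0) (sub_hilbert K0))
  (pi1 : bop H2 H2 -> bop (sub_hilbert K1) (sub_hilbert K1)) (G : hilbertType R).
Hypothesis hw : wold_decomposition pi0 pi1 G.

Lemma wold_sub0 X : A X -> forall x, pi X (sub_val x) = sub_val (pi0 X x).
Proof.
move=> AX x; have [_ _ h] := wold_sum hw; have := h X AX x 0.
by rewrite linear0 /= !addr0.
Qed.

Lemma wold_sub1 X : A X -> forall x, pi X (sub_val x) = sub_val (pi1 X x).
Proof.
move=> AX x; have [_ _ h] := wold_sum hw; have := h X AX 0 x.
by rewrite linear0 /= !add0r.
Qed.

(** The tensor coordinates transported to K_0, and restricted to a basis B of G.
Only B is needed for totality because x (x) g is continuous in g. *)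
Lemma wold_coordinates (B : set G) : basis_of_subspace setT B ->
  exists u : H2 -> G -> sub_hilbert K0,
    [/\ forall X, A X -> forall x g, pi0 X (u x g) = u (X x) g,
        forall x y g h, inner (u x g) (u y h) = inner x y * inner g h &
        forall y, (forall x b, B b -> inner y (u x b) = 0) -> y = 0].
Proof.
move=> [_ oB TB]; have [T [t [U0 [[tl tr tin tt] [Ui Us] hY]]]] := wold_tensor hw.
have ex xg : exists v, U0 v = t xg.1 xg.2.
  have : range U0 (t xg.1 xg.2) by rewrite Us.
  by move=> [v _ <-]; exists v.
have [u0 hu0] := choice ex; pose u x g := u0 (x, g).
have hu x g : U0 (u x g) = t x g by exact: (hu0 (x, g)).
have Uinj x y : U0 x = U0 y -> x = y.
  by move=> Uxy; apply: inner_inj => z; rewrite -Ui Uxy Ui.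
exists u; split.
- move=> X AX x g; apply: Uinj; have [Y [YX UY]] := hY X AX.
  by rewrite -bop_compE UY bop_compE !hu YX.
- by move=> x y g h; rewrite -Ui !hu tin.
move=> y hy; apply: Uinj; rewrite linear0; apply: (total_orth tt) => _ [x [g ->]].
have [W hW] : exists W : bop G T, forall g, W g = t x g.
  apply: (@mk_bop _ _ _ (t x) (nrm x)); first exact: tr.
  move=> v; rewrite -(@ler_pXn2r _ 2) ?nnegrE ?mulr_ge0 ?nrm_ge0// exprMn.
  by rewrite -lecR -inner_nrm tin !inner_nrm -rmorphM.
rewrite -hW inner_conj; apply/eqP; rewrite fmorph_eq0; apply/eqP.
apply: (@span_map _ _ _ W B (orthocompl [set U0 y]) _ g (TB g _)) => // b Bb _ ->.
by rewrite hW -hu Ui inner_conj hy// rmorph0.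
Qed.

Lemma wold_orth x y : inner (sub_val (x : sub_hilbert K0)) (sub_val (y : sub_hilbert K1)) = 0.
Proof.
have [h _ _] := wold_sum hw; apply: h; exact: sub_valP.
Qed.

(** Vectors orthogonal to the coordinates of K_0 and to K_1 vanish. *)
Lemma wold_total (B : set G) (u : H2 -> G -> sub_hilbert K0) y :
  (forall z, (forall x b, B b -> inner z (u x b) = 0) -> z = 0) ->
  (forall x b, B b -> inner y (sub_val (u x b)) = 0) ->
  (forall k : sub_hilbert K1, inner y (sub_val k) = 0) -> y = 0.
Proof.
move=> hu h0 h1; have [_ h _] := wold_sum hw; have [y0 [y1 yE]] := h y.
have y10 : y1 = 0.
  apply: inner_self_eq0; rewrite sub_innerE; have := h1 y1.
  by rewrite yE innerDl wold_orth add0r.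
have y00 : y0 = 0.
  apply: hu => x b Bb; rewrite sub_innerE; have := h0 x b Bb.
  by rewrite yE y10 /= addr0.
by rewrite yE y00 y10 /= addr0.
Qed.

End OneSide.

Section TwoSides.
Variables (K K' : hilbertType R).
Variables (pi : bop H2 H2 -> bop K K) (pi' : bop H2 H2 -> bop K' K').
Hypothesis hpi : star_rep A pi.
Hypothesis hpi' : star_rep A pi'.
Hypothesis pi_id : pi (bop_id H2) = bop_id K.
Hypothesis pi_id' : pi' (bop_id H2) = bop_id K'.
Local Notation K0 := (space0 f MZ pi).
Local Notation K1 := (space1 f MZ pi).
Local Notation K0' := (space0 f MZ pi').
Local Notation K1' := (space1 f MZ pi').
Variables (pi0 : bop H2 H2 -> bop (sub_hilbert K0) (sub_hilbert K0))
  (pi1 : bop H2 H2 -> bop (sub_hilbert K1) (sub_hilbert K1)) (G : hilbertType R).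
Variables (pi0' : bop H2 H2 -> bop (sub_hilbert K0') (sub_hilbert K0'))
  (pi1' : bop H2 H2 -> bop (sub_hilbert K1') (sub_hilbert K1')) (G' : hilbertType R).
Hypothesis hw : wold_decomposition pi0 pi1 G.
Hypothesis hw' : wold_decomposition pi0' pi1' G'.

Local Notation Q := (rep_defect f MZ pi).
Local Notation Q' := (rep_defect f MZ pi').

Let QE : Q = pi (rank1 e0 e0).
Proof. exact: (rep_defectE e_basis S_val S_shift hpi pi_id). Qed.
Let QE' : Q' = pi' (rank1 e0 e0).
Proof. exact: (rep_defectE e_basis S_val S_shift hpi' pi_id'). Qed.

(** The union of the tensor coordinates u x b of K_0 and of the vectors of K_1 is a
total family in K, stable under pi(X).  A bijection of bases and W match it with
the one of K', with the same Gram matrix. *)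
Lemma wold_equiv_of_parts : same_hilbert_dim [set: G] [set: G'] ->
  unitarily_equivalent A pi1 pi1' -> unitarily_equivalent A pi pi'.
Proof.
move=> [B [B' [hB hB' cB]]] [W [Wi Ws] hW].
have [u [uX uin utot]] := wold_coordinates hw hB.
have [u' [uX' uin' utot']] := wold_coordinates hw' hB'.
have [phi [phiB phiinj phisurj]] : exists phi, set_bij B B' phi by exact/card_set_bijP.
have oB : orthonormal_set B by case: hB.
have oB' : orthonormal_set B' by case: hB'.
(* index K_0 by a vector of H2 and a basis vector of G, and K_1 by itself *)
pose I : Type := ((H2 * {b : G | B b}) + sub_hilbert K1)%type.
pose v (i : I) : K := match i with
  | inl (x, b) => sub_val (u x (sval b)) | inr k => sub_val k end.
pose w (i : I) : K' := match i with
  | inl (x, b) => sub_val (u' x (phi (sval b))) | inr k => sub_val (W k) end.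
have gram i j : inner (v i) (v j) = inner (w i) (w j).
  case: i j => [[x [b Bb]]|k] [[y [c Bc]]|l] /=.
  - have := uin x y b c; have := uin' x y (phi b) (phi c); rewrite !sub_innerE => -> ->.
    rewrite (oB _ _ Bb Bc) (oB' _ _ (phiB _ Bb) (phiB _ Bc)); congr (_ * _%:R).
    have [->|bc] := eqVneq b c; first by rewrite eqxx.
    by case: eqP => // /(phiinj _ _ (mem_set Bb) (mem_set Bc)) /eqP; rewrite (negPf bc).
  - by rewrite (wold_orth hw) (wold_orth hw').
  - rewrite inner_conj (wold_orth hw) rmorph0.
    by rewrite inner_conj (wold_orth hw') rmorph0.
  - by have := Wi k l; rewrite !sub_innerE => ->.
have tv : closure (lspan (range v)) = setT.
  apply/seteqP; split=> // x _; apply: closure_lspanP => y hy.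
  suff -> : y = 0 by rewrite inner0r.
  apply: (wold_total hw utot) => [z b Bb|k].
    by apply: hy; exists (inl (z, exist _ b Bb)).
  by apply: hy; exists (inr k).
have tw : closure (lspan (range w)) = setT.
  apply/seteqP; split=> // x _; apply: closure_lspanP => y hy.
  suff -> : y = 0 by rewrite inner0r.
  apply: (wold_total hw' utot') => [z b' B'b|k'].
    have [b Bb <-] := phisurj _ B'b.
    by apply: hy; exists (inl (z, exist _ b Bb)).
  have [k _ <-] : range W k' by rewrite Ws.
  by apply: hy; exists (inr k).
have [U Uu Uv] := gram_unitary gram tv tw.
exists U => // X AX; apply: (bop_ext_total tv) => _ [i _ <-]; rewrite !bop_compE.
case: i => [[x b]|k].
- rewrite Uv /= (wold_sub0 hw)// (wold_sub0 hw')// uX// uX'//.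
  exact: (Uv (inl (X x, b))).
- rewrite Uv /= (wold_sub1 hw)// (wold_sub1 hw')//.
  rewrite -[in RHS]bop_compE -hW//.
  exact: (Uv (inr (pi1 X k))).
Qed.

Section Forward.
Variable U : bop K K'.
Hypothesis Uu : unitary U.
Hypothesis hU : forall X, A X -> bop_comp U (pi X) = bop_comp (pi' X) U.

Let UX X x : A X -> U (pi X x) = pi' X (U x).
Proof. by move=> AX; rewrite -bop_compE hU. Qed.

Let Usurj y : exists x, U x = y.
Proof. by have [_ Us] := Uu; have [x _ <-] : range U y; [rewrite Us|exists x]. Qed.

Let UQ x : U (Q x) = Q' (U x).
Proof. by rewrite QE QE' UX. Qed.

Lemma unitary_defect_range : U @` range Q = range Q'.
Proof.
apply/seteqP; split=> [_ [_ [x _ <-] <-]|_ [y _ <-]].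
  by exists (U x).
by have [x <-] := Usurj y; exists (Q x) => //; exists x.
Qed.

Lemma wold_dim_eq : separable K' -> same_hilbert_dim [set: G] [set: G'].
Proof.
move=> sK'; have [Ui _] := Uu.
have [B1 [B2 [h1 h2 c12]]] := wold_dim hw.
have [B1' [B2' [h1' h2' c12']]] := wold_dim hw'.
have [h3 c3] := unitary_basis Ui unitary_defect_range h2.
exists B1, B1'; split=> //; apply: (card_eq_trans c12).
have c4 := basis_card_eq sK' h3 h2'.
rewrite card_eq_sym in c3; apply: (card_eq_trans c3); apply: (card_eq_trans c4).
by rewrite card_eq_sym.
Qed.

Let opA a : A (op_word MZ a).
Proof. exact: (op_word_mem _ hA AZ). Qed.

(** U intertwines the representations and hence matches the generators of K_0 and
K_0'. *)
Lemma unitary_space1 x : csub_set K1 x <-> csub_set K1' (U x).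
Proof.
have [Ui _] := Uu; split=> K1x y K0y.
  apply: closure_orth K0y => _ [a [k' ->]]; have [k <-] := Usurj k'.
  rewrite -UQ -UX// Ui; apply: K1x; apply: span_incl; by exists a, k.
apply: closure_orth K0y => _ [a [k ->]]; rewrite -Ui UX// UQ.
by apply: K1x; apply: span_incl; exists a, (U k).
Qed.

Lemma wold_equiv1 : unitarily_equivalent A pi1 pi1'.
Proof.
have [Ui _] := Uu.
pose w (x : sub_hilbert K1) : sub_hilbert K1' :=
  to_sub ((unitary_space1 _).1 (sub_valP x)).
have [|||V Vu Vw] := @gram_unitary _ _ _ (sub_hilbert K1) id w.
- by move=> x y; rewrite !sub_innerE /= Ui.
- by apply/seteqP; split=> // x _; apply: span_incl; exists x.
- apply/seteqP; split=> // y _; apply: span_incl.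
  have [x xy] := Usurj (sub_val y).
  have K1x : csub_set K1 x by apply/unitary_space1; rewrite xy; exact: sub_valP.
  by exists (to_sub K1x) => //; apply: sub_val_inj.
exists V => // X AX; apply: bopE => x; apply: sub_val_inj.
by rewrite !bop_compE !Vw -(wold_sub1 hw')//= -(wold_sub1 hw)// UX.
Qed.

End Forward.
End TwoSides.
End WoldData.

Theorem theorem3p2 (R : realType) (n : nat) (n_gt0 : (0 < n)%N)
    (H : hilbertType R) (H_inf : infinite_dim H)
    (f : 'I_n -> fps R n)
    (H2 : hilbertType R) (e : word n -> H2) (e_basis : orthonormal_basis e)
    (MZ : 'I_n -> bop H2 H2)
    (f_model : norm_model_property f e MZ H) :
  (forall (K : hilbertType R) (pi : bop H2 H2 -> bop K K),
     separable K ->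
     star_rep (model_algebra MZ) pi ->
     nondegenerate_rep (model_algebra MZ) pi ->
     in_norm_domain f (pi \o MZ) /\
     exists pi0 pi1 (G : hilbertType R),
       @wold_decomposition R n f H2 MZ K pi pi0 pi1 G) /\
  (forall (K K' : hilbertType R)
      (pi : bop H2 H2 -> bop K K) (pi' : bop H2 H2 -> bop K' K'),
     separable K -> separable K' ->
     star_rep (model_algebra MZ) pi ->
     nondegenerate_rep (model_algebra MZ) pi ->
     star_rep (model_algebra MZ) pi' ->
     nondegenerate_rep (model_algebra MZ) pi' ->
     forall pi0 pi1 (G : hilbertType R) pi0' pi1' (G' : hilbertType R),
       @wold_decomposition R n f H2 MZ K pi pi0 pi1 G ->
       @wold_decomposition R n f H2 MZ K' pi' pi0' pi1' G' ->
       unitarily_equivalent (model_algebra MZ) pi pi' <->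
       same_hilbert_dim [set: G] [set: G'] /\
       unitarily_equivalent (model_algebra MZ) pi1 pi1').
Proof.
have [S [S_val S_shift]] := shift_ex e_basis f_model.
have hA := @model_algebra_cstar R n H2 MZ.
split=> [K pi _ hpi nd|K K' pi pi' _ sK' hpi nd hpi' nd' pi0 pi1 G pi0' pi1' G' hw hw'].
  have pi_id := nondegenerate_unital hA hpi nd; split.
    exact: (rep_domain S_val hpi pi_id).
  do 3 eexists; exact: (rep_wold e_basis S_val S_shift hpi pi_id).
have pi_id := nondegenerate_unital hA hpi nd.
have pi_id' := nondegenerate_unital hA hpi' nd'.
split=> [[U Uu hU]|[dimG eq1]]; last first.
  exact: (wold_equiv_of_parts hw hw').
split; first exact: (wold_dim_eq e_basis S_val S_shift hpi hpi' pi_id pi_id' hw hw' Uu hU sK').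
exact: (wold_equiv1 e_basis S_val S_shift hpi hpi' pi_id pi_id' hw hw' Uu hU).
Qed.
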